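(* Let $g_1,g_2,\dots$ be real-valued exchangeable random variables on a probability space $(\Omega,\mathcal F,\mathbb P)$ with tail $\sigma$-algebra $\mathcal T_*=\bigcap_{n}\sigma(g_n,g_{n+1},\dots)$. For $\varepsilon>0$, $t>0$, $N\in\mathbb N$ define $\Delta_t=\mathbb E(g_1\mathbf 1_{\{|g_1|\le t\}}\mid\mathcal T_* )$; $T_t(\varepsilon)=t\,\mathbb P(|g_1|>\varepsilon t\mid\mathcal T_* )$; $\Sigma_t(\varepsilon)=\frac1t\mathbb E(g_1^2\mathbf 1_{\{|g_1|\le\varepsilon t\}}\mid\mathcal T_* )$; $V_t(\varepsilon)=\frac1t\mathrm{Var}(g_1\mathbf 1_{\{|g_1|\le\varepsilon t\}}\mid\mathcal T_* )$; $R_t(\varepsilon)=\frac1t\mathbb E\big((|g_1|\wedge\varepsilon t)^2\mid\mathcal T_*\big)$. The following are equivalent: (i) there exist real-valued $\mathcal T_*$-measurable $D_1,D_2,\dots$ such that for each $\varepsilon>0$, $\mathbb P\big(\big|\frac1N\sum_{n=1}^N g_n-D_N\big|>\varepsilon\big)\to0$ as $N\to\infty$; (i)$'$ there exist real-valued $\mathcal T_*$-measurable $D_1,D_2,\dots$ such that for each $\varepsilon>0$, $\mathbb P\big(\big|\frac1N\sum_{n=1}^N g_n-D_N\big|>\varepsilon\,\big|\,\mathcal T_*\big)\to0$ in $\mathbb P$-probability as $N\to\infty$; (ii) for every $\varepsilon>0$, both $T_t(\varepsilon)\to0$ and $\Sigma_t(\varepsilon)\to0$ in $\mathbb P$-probability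 as $t\to\infty$; (ii)$'$ for every $\varepsilon>0$, both $T_t(\varepsilon)\to0$ and $V_t(\varepsilon)\to0$ in $\mathbb P$-probability as $t\to\infty$; (ii)$''$ for every $\varepsilon>0$, $R_t(\varepsilon)\to0$ in $\mathbb P$-probability as $t\to\infty$; (iii) for every $\varepsilon>0$, $\frac1M\int_0^M T_t(\varepsilon)\,dt\to0$ in $\mathbb P$-probability as $M\to\infty$; (iii)$'$ for every $\varepsilon>0$, $M\int_M^\infty\frac{\Sigma_t(\varepsilon)}{t^2}dt\to0$ in $\mathbb P$-probability as $M\to\infty$; (iii)$''$ for every $\varepsilon>0$, $M\int_M^\infty\frac{V_t(\varepsilon)}{t^2}dt\to0$ in $\mathbb P$-probability as $M\to\infty$. Moreover, when any (hence all) of (ii)–(iii)$''$ hold, then (i) and (i)$'$ hold with $D_N=\Delta_N$; and $\mathcal T_*$-measurable correctors $D_N$ for which (i) or (i)$'$ holds satisfy $D_N/\sqrt N\to0$ in $\mathbb P$-probability. *)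

(* Defs.v *)
From HB Require Import structures.
From mathcomp Require Import all_boot all_order all_algebra fingroup perm.
From mathcomp Require Import all_classical all_reals all_analysis.

Set Implicit Arguments.
Unset Strict Implicit.
Unset Printing Implicit Defensive.

Import Order.TTheory GRing.Theory Num.Theory.
Import numFieldNormedType.Exports.

Local Open Scope classical_set_scope.
Local Open Scope ring_scope.

Section Defs.
Context d (Omega : measurableType d) (R : realType) (P : probability Omega R).

(* g : nat -> Omega -> R ; g 0 is g_1, g n is g_{n+1}. *)

(* Exchangeability: for every n and every permutation s of {0,..,n-1}, the
   vectors (g_{s 0},...,g_{s (n-1)}) and (g_0,...,g_{n-1}) have the same law,
   i.e. give the same probability to every Borel rectangle
   (rectangles form a pi-system generating the product sigma-algebra). *)
Definition exchangeable (g : nat -> Omega -> R) : Prop :=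
  forall (n : nat) (s : {perm 'I_n}) (B : 'I_n -> set R),
    (forall i, measurable (B i)) ->
    P [set w | forall i : 'I_n, B i (g (s i) w)] =
    P [set w | forall i : 'I_n, B i (g i w)].

Definition sigma_from (g : nat -> Omega -> R) (n : nat) : set (set Omega) :=
  <<s [set A | exists k, (n <= k)%N /\
               exists B : set R, measurable B /\ A = g k @^-1` B] >>.

Definition tail_sigma (g : nat -> Omega -> R) : set (set Omega) :=
  [set A | forall n, sigma_from g n A].

Definition meas_wrt (G : set (set Omega)) (Y : Omega -> R) : Prop :=
  forall B : set R, measurable B -> G (Y @^-1` B).

Definition is_cond_prob (G : set (set Omega)) (A : set Omega)
    (Y : Omega -> R) : Prop :=
  meas_wrt G Y /\ P.-integrable setT (EFin \o Y) /\
  forall C, G C -> (\int[P]_(w in C) (Y w)%:E)%E = P (C `&` A).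

Definition is_rcd (G : set (set Omega)) (X : Omega -> R)
    (kappa : Omega -> probability R R) : Prop :=
  forall B : set R, measurable B ->
    meas_wrt G (fun w => fine (kappa w B)) /\
    forall C, G C -> (\int[P]_(w in C) kappa w B)%E = P (C `&` X @^-1` B).

Definition cvg0_in_prob (I : Type) (F : set_system I) (X : I -> Omega -> R) : Prop :=
  forall eta : R, 0 < eta ->
    (fun i => P [set w | eta < `|X i w|]) @ F --> (0 : \bar R)%E.

End Defs.

Section Quantities.
Context (Omega : Type) (R : realType) (kappa : Omega -> probability R R).

Definition trunc (c : R) (x : R) : R := if `|x| <= c then x else 0.

(* All conditional quantities given T_* are computed through a regular
   conditional distribution kappa of g_1 given T_*. *)

Definition Delta (t : R) (w : Omega) : R :=
  \int[kappa w]_(x in setT) trunc t x.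

Definition Tq (eps t : R) (w : Omega) : R :=
  t * fine (kappa w [set x | eps * t < `|x|]).

Definition Sigmaq (eps t : R) (w : Omega) : R :=
  t^-1 * \int[kappa w]_(x in setT) (trunc (eps * t) x) ^+ 2.

Definition Vq (eps t : R) (w : Omega) : R :=
  t^-1 * (\int[kappa w]_(x in setT) (trunc (eps * t) x) ^+ 2
          - (\int[kappa w]_(x in setT) trunc (eps * t) x) ^+ 2).

Definition Rq (eps t : R) (w : Omega) : R :=
  t^-1 * \int[kappa w]_(x in setT) (Num.min `|x| (eps * t)) ^+ 2.

Definition avgT (eps M : R) (w : Omega) : R :=
  M^-1 * \int[lebesgue_measure]_(t in `[0, M]) Tq eps t w.

Definition tailSigma (eps M : R) (w : Omega) : R :=
  M * \int[lebesgue_measure]_(t in `[M, +oo[) (Sigmaq eps t w / t ^+ 2).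

Definition tailV (eps M : R) (w : Omega) : R :=
  M * \int[lebesgue_measure]_(t in `[M, +oo[) (Vq eps t w / t ^+ 2).

End Quantities.

Section Conditions.
Context d (Omega : measurableType d) (R : realType) (P : probability Omega R)
  (g : nat -> Omega -> R).

Definition dev_event (D : nat -> Omega -> R) (eps : R) (N : nat) : set Omega :=
  [set w | eps < `|N%:R^-1 * (\sum_(i < N) g i w) - D N w|].

Definition cond_i (D : nat -> Omega -> R) : Prop :=
  forall eps : R, 0 < eps ->
    (fun N => P (dev_event D eps N)) @ \oo --> (0 : \bar R)%E.

(* (i)' for a given corrector sequence D: some (equivalently any) version
   Y_N of P(dev_event | T_* ) tends to 0 in probability *)
Definition cond_i' (D : nat -> Omega -> R) : Prop :=
  forall eps : R, 0 < eps ->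
    exists Y : nat -> Omega -> R,
      (forall N, is_cond_prob P (tail_sigma g) (dev_event D eps N) (Y N)) /\
      cvg0_in_prob P \oo Y.

Definition Tmeas_seq (D : nat -> Omega -> R) : Prop :=
  forall N, meas_wrt (tail_sigma g) (D N).

End Conditions.

(* Main.v *)
Require Import Defs.
From HB Require Import structures.
From mathcomp Require Import all_boot all_order all_algebra fingroup perm.
From mathcomp Require Import all_classical all_reals all_analysis.
From mathcomp Require Import measurable_realfun.
From mathcomp Require Import ring lra.

(** Conditionally on the tail, the [g n] are independent with common law [kappa]:
    along [4 ^ k] the averages of [h (g n)] have [L^1]-summable increments, their
    limit is tail-measurable, hence equals the [kappa]-integral of [h], and
    exchangeability lets [h (g n)] be replaced by such an average of later terms.

    All analytic conditions reduce to [Rq]: [Rq = Sigmaq + eps^2 Tq], and by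
    Tonelli [tailSigma = Rq / 2] and [avgT = Rq / (2 eps^2)].  Where [kappa w] puts
    mass at least [1/2] on [[-b, b]], a second moment is controlled by the variance
    up to a multiple of [b^2], which handles [Vq] and [tailV].

    Sufficiency is truncation and Chebyshev on the tail event [Rq <= a].  For
    necessity, with [phi] the characteristic function of [kappa w],
    [E cos (u (S_N / N - D_N)) <= E |phi (u / N)| ^ N] for every tail-measurable
    [D_N], so [1 - |phi (u / N)| ^ N] is small in mean for [u] in [[0, 1]]; averaging
    over [u] and using [1 - sin y / y >= min (|y|, 1) ^ 2 / 8] bounds [Rq]. *)

Set Implicit Arguments.
Unset Strict Implicit.
Unset Printing Implicit Defensive.

Import Order.TTheory GRing.Theory Num.Theory.
Import numFieldNormedType.Exports.

Local Open Scope classical_set_scope.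
Local Open Scope ring_scope.

(** * Bounded measurable functions *)

(** Conditioning on the tail is expressed by identities [E (X * h (g n)) = E (X * K h)], where [K h]
    is the [kappa]-integral of [h] and [X] is bounded and measurable in the past of [n]. No moment
    of [g n] is assumed, so only truncations, indicators, sines and cosines are integrated:
    boundedness ([bdm]) makes every such integral finite and linear. The obstacle in necessity is
    that [D_N] is arbitrary and [phi] has an unknown phase, while [Rq] calls for [1 - Re phi]. The
    centring enters only through the tail-measurable unit vector [(cos (u D_N), sin (u D_N))], of
    which the bound sees the norm alone. The phase is controlled by [1 - |phi| ^ 2] up to a term of
    order [1 / N ^ 2]; after multiplication by [N] this is dominated by the gap [1 - |phi| ^ N]
    where [|phi| ^ N >= 1/2]. Elsewhere a multiple of [Rq] itself is the bound, but it carries the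
    gap as a factor and is absorbed once the averaged gap is at most [1/64]. Pointwise inequalities
    become convergence in probability by tightness: one [b] serves all [w] outside an event of small
    probability. *)

Definition bdm d (T : measurableType d) (R : realType) (f : T -> R) : Prop :=
  measurable_fun setT f /\ exists M : R, forall x, `|f x| <= M.

Section BoundedMeasurable.
Context d (T : measurableType d) (R : realType).
Implicit Types (f h : T -> R) (c : R).

Lemma measurable_ler f h : measurable_fun setT f -> measurable_fun setT h ->
  measurable [set x | f x <= h x].
Proof.
by move=> mf mh; rewrite -[X in measurable X]setTI; exact: measurable_fun_ler.
Qed.

Lemma measurable_ltr f h : measurable_fun setT f -> measurable_fun setT h ->
  measurable [set x | f x < h x].
Proof.
by move=> mf mh; rewrite -[X in measurable X]setTI; exact: measurable_fun_ltr.
Qed.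

Lemma bdm_cst c : bdm (fun _ : T => c).
Proof. by split => //; exists `|c|. Qed.

Lemma bdmD f h : bdm f -> bdm h -> bdm (fun x => f x + h x).
Proof.
move=> [mf [M fM]] [mh [K hK]]; split; first exact: measurable_funD.
by exists (M + K) => x; rewrite (le_trans (ler_normD _ _))// lerD.
Qed.

Lemma bdmM f h : bdm f -> bdm h -> bdm (fun x => f x * h x).
Proof.
move=> [mf [M fM]] [mh [K hK]]; split; first exact: measurable_funM.
by exists (M * K) => x; rewrite normrM ler_pM.
Qed.

Lemma bdmN f : bdm f -> bdm (fun x => - f x).
Proof.
move=> [mf [M fM]]; split; first exact: measurableT_comp.
by exists M => x; rewrite normrN.
Qed.

Lemma bdmB f h : bdm f -> bdm h -> bdm (fun x => f x - h x).
Proof. by move=> bf bh; apply: bdmD => //; exact: bdmN. Qed.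

Lemma bdmX f n : bdm f -> bdm (fun x => f x ^+ n).
Proof.
move=> bf; elim: n => [|n ih]; first exact: bdm_cst.
by under eq_fun do rewrite exprS; exact: bdmM.
Qed.

Lemma bdm_norm f : bdm f -> bdm (fun x => `|f x|).
Proof.
move=> [mf [M fM]]; split; first exact: measurableT_comp.
by exists M => x; rewrite normr_id.
Qed.

Lemma bdm_sum n (f : nat -> T -> R) :
  (forall i, (i < n)%N -> bdm (f i)) -> bdm (fun x => \sum_(i < n) f i x).
Proof.
elim: n => [_|n ih bf]; first by under eq_fun do rewrite big_ord0; exact: bdm_cst.
under eq_fun do rewrite big_ord_recr /=.
by apply: bdmD; [apply: ih => i /ltnW; exact: bf | exact: bf].
Qed.

Lemma bdm_indic (A : set T) : measurable A -> bdm (\1_A : T -> R).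
Proof.
move=> mA; split; first exact: measurable_indic.
by exists 1 => x; rewrite ger0_norm// indicE lern1 leq_b1.
Qed.

Lemma bdm_comp d' (T' : measurableType d') (phi : T' -> T) f :
  measurable_fun setT phi -> bdm f -> bdm (fun x => f (phi x)).
Proof.
by move=> mphi [mf [M fM]]; split; [exact: measurableT_comp | exists M].
Qed.

Context (P : probability T R).
Local Notation E f := (\int[P]_(w in setT) f w).

Lemma bdm_integrable (D : set T) f : measurable D -> bdm f -> P.-integrable D (EFin \o f).
Proof.
move=> mD [mf [M fM]]; apply: measurable_bounded_integrable => //.
- by rewrite (le_lt_trans (probability_le1 P mD))// ltry.
- exact: measurable_funTS.
- exists M; split; first exact: num_real.
  by move=> y My x _ /=; rewrite (le_trans (fM x))// ltW.
Qed.

Lemma expD f h : bdm f -> bdm h -> E (fun w => f w + h w) = E f + E h.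
Proof. by move=> bf bh; rewrite RintegralD//; exact: bdm_integrable. Qed.

Lemma expB f h : bdm f -> bdm h -> E (fun w => f w - h w) = E f - E h.
Proof. by move=> bf bh; rewrite RintegralB//; exact: bdm_integrable. Qed.

Lemma expZ c f : bdm f -> E (fun w => c * f w) = c * E f.
Proof. by move=> bf; rewrite RintegralZl//; exact: bdm_integrable. Qed.

Lemma exp_cst c : E (fun _ => c) = c.
Proof. 
rewrite Rintegral_cst// (_ : fine _ = 1) ?mulr1//.
by rewrite -[RHS]/(fine 1%:E); congr fine; exact: probability_setT.
 Qed.

Lemma exp_sum n (f : nat -> T -> R) : (forall i, (i < n)%N -> bdm (f i)) ->
  E (fun w => \sum_(i < n) f i w) = \sum_(i < n) E (f i).
Proof.
elim: n => [_|n ih bf].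
  by rewrite big_ord0; under eq_Rintegral do rewrite big_ord0; rewrite exp_cst.
rewrite big_ord_recr /= -ih; last by move=> i /ltnW; exact: bf.
under eq_Rintegral do rewrite big_ord_recr /=.
apply: expD; last exact: bf.
by apply: bdm_sum => i /ltnW; exact: bf.
Qed.

Lemma exp_le f h : bdm f -> bdm h -> (forall w, f w <= h w) -> E f <= E h.
Proof. by move=> bf bh fh; apply: le_Rintegral => //; exact: bdm_integrable. Qed.

Lemma exp_norm f : bdm f -> `|E f| <= E (fun w => `|f w|).
Proof. by move=> bf; apply: le_normr_Rintegral => //; exact: bdm_integrable. Qed.

Lemma exp_ge0 f : (forall w, 0 <= f w) -> 0 <= E f.
Proof. by move=> f0; exact: Rintegral_ge0. Qed.

Lemma exp_bound c f : bdm f -> (forall w, `|f w| <= c) -> `|E f| <= c.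
Proof.
move=> bf fc; rewrite (le_trans (exp_norm bf))// -[leRHS]exp_cst.
by apply: exp_le => //; [exact: bdm_norm | exact: bdm_cst].
Qed.

Lemma expE f : bdm f -> (\int[P]_(w in setT) (f w)%:E)%E = (E f)%:E.
Proof.
by move=> bf; rewrite /Rintegral fineK//; apply: integrable_fin_num => //; exact: bdm_integrable.
Qed.

Lemma exp_indic (A : set T) : measurable A -> (E (\1_A))%:E = P A.
Proof.
by move=> mA; rewrite -expE ?integral_indic ?setIT//; exact: bdm_indic.
Qed.

Lemma exp_indicM (A : set T) f : measurable A -> bdm f ->
  (E (fun w => \1_A w * f w))%:E = (\int[P]_(w in A) (f w)%:E)%E.
Proof.
move=> mA bf; rewrite -expE; last by apply: bdmM => //; exact: bdm_indic.
rewrite [RHS]integral_mkcond; apply: eq_integral => x _.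
by rewrite patchE indicE; case: ifP => xA; rewrite ?mul1r ?mul0r.
Qed.

Lemma exp_sqr_le f : bdm f -> (E f) ^+ 2 <= E (fun w => f w ^+ 2).
Proof.
move=> bf; have b2 := bdmX 2 bf.
have : 0 <= E (fun w => (f w - E f) ^+ 2) by apply: exp_ge0 => w; exact: sqr_ge0.
have -> : E (fun w => (f w - E f) ^+ 2) = E (fun w => f w ^+ 2) - (E f) ^+ 2.
  transitivity (E (fun w => f w ^+ 2 - (2 * E f * f w - (E f) ^+ 2))).
    by apply: eq_Rintegral => w _; ring.
  rewrite expB//; last by apply: bdmB; [apply: bdmM => //|]; exact: bdm_cst.
  rewrite expB; [|by apply: bdmM => //; exact: bdm_cst|exact: bdm_cst].
  by rewrite expZ// exp_cst; ring.
by rewrite subr_ge0.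
Qed.

Lemma markov (f : T -> R) (c : R) : bdm f -> (forall w, 0 <= f w) -> 0 < c ->
  (P [set w | (c <= f w)%R] <= (c^-1 * E f)%:E)%E.
Proof.
move=> bf f0 c0; have mA : measurable [set w | c <= f w].
  by apply: measurable_ler; [exact: measurable_cst | case: bf].
rewrite -exp_indic// lee_fin ler_pdivlMl// -expZ; last exact: bdm_indic.
apply: exp_le => //; first by apply: bdmM; [exact: bdm_cst|exact: bdm_indic].
move=> w; rewrite indicE; have [|_] := boolP (w \in _); last by rewrite mulr0.
by rewrite inE /= mulr1.
Qed.

End BoundedMeasurable.

(** * Measurability for sub-sigma-algebras and comparison of joint laws *)

Section SubSigmaAlgebra.
Context d (Omega : measurableType d) (R : realType).

Lemma sigma_sub_measurable (G : set (set Omega)) :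
  G `<=` measurable -> <<s G >> `<=` measurable.
Proof. by move=> hG; apply: smallest_sub => //; exact: sigma_algebra_measurable. Qed.

Lemma measurable_fun_coarse d' (Y : measurableType d') (G H : set (set Omega))
  (f : Omega -> Y) : G `<=` H ->
  measurable_fun setT (f : g_sigma_algebraType G -> Y) ->
  measurable_fun setT (f : g_sigma_algebraType H -> Y).
Proof.
move=> GH mf mT B mB.
by apply: (sub_sigma_algebra2 GH); apply: (mf _ _ mB); exact: measurableT.
Qed.

Lemma measurable_fun_sub d' (Y : measurableType d') (G : set (set Omega))
  (f : Omega -> Y) : G `<=` measurable ->
  measurable_fun setT (f : g_sigma_algebraType G -> Y) ->
  measurable_fun setT f.
Proof.
move=> hG mf mT B mB.
by apply: (sigma_sub_measurable hG); apply: (mf _ _ mB); exact: measurableT.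
Qed.

Lemma bdm_coarse (G H : set (set Omega)) (f : Omega -> R) : G `<=` H ->
  bdm (f : g_sigma_algebraType G -> R) -> bdm (f : g_sigma_algebraType H -> R).
Proof. by move=> GH [mf bf]; split => //; exact: measurable_fun_coarse mf. Qed.

Lemma bdm_sub (G : set (set Omega)) (f : Omega -> R) : G `<=` measurable ->
  bdm (f : g_sigma_algebraType G -> R) -> bdm f.
Proof. by move=> hG [mf bf]; split => //; exact: measurable_fun_sub mf. Qed.

Lemma meas_wrtP (G : set (set Omega)) (Y : Omega -> R) : sigma_algebra setT G ->
  meas_wrt G Y <-> measurable_fun setT (Y : g_sigma_algebraType G -> R).
Proof.
move=> sG; split=> [h _ B mB|h B mB].
  by rewrite setTI; apply: sub_sigma_algebra; exact: h.
have := h measurableT _ mB; rewrite setTI.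
by rewrite measurable_g_measurableTypeE.
Qed.

Definition mfun_of d1 d2 (T1 : measurableType d1) (T2 : measurableType d2) (f : T1 -> T2)
  (mf : measurable_fun setT f) : {mfun T1 >-> T2} :=
  HB.pack f (isMeasurableFun.Build _ _ _ _ f mf).

Context (P : probability Omega R).

(** With [w] seen as a point of the coarse space [T], the hypothesis says that the pairs [(w, x w)]
    and [(w, y w)] give equal mass to all rectangles. Rectangles are a pi-system generating the
    product, so the two laws coincide and integrate [X p.1 * h p.2] alike. *)
Lemma swap_exp (G : set (set Omega)) (x y : Omega -> R)
    (X : Omega -> R) (h : R -> R) :
  G `<=` measurable ->
  measurable_fun setT x -> measurable_fun setT y ->
  (forall C B, <<s G >> C -> measurable B ->
    P (C `&` x @^-1` B) = P (C `&` y @^-1` B)) ->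
  bdm (X : g_sigma_algebraType G -> R) -> bdm h ->
  \int[P]_(w in setT) (X w * h (x w)) = \int[P]_(w in setT) (X w * h (y w)).
Proof.
move=> hG mx my hxy bX bh.
pose T := g_sigma_algebraType G.
have mid : measurable_fun setT (id : Omega -> T).
  by move=> _ B mB; rewrite setTI preimage_id; exact: (sigma_sub_measurable hG).
have mp z : measurable_fun setT z -> measurable_fun setT (fun w : Omega => (w : T, z w : R)).
  by move=> mz; exact: measurable_fun_pair.
pose F (p : T * R) := (X p.1 * h p.2)%:E.
have bF : bdm (fun p : T * R => X p.1 * h p.2).
  by apply: bdmM; exact: bdm_comp.
have mF : measurable_fun setT F by apply/measurable_EFinP; case: bF.
have key z (mz : measurable_fun setT z) :
    (\int[P]_(w in setT) (X w * h (z w))%:E =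
     \int[distribution P (mfun_of (mp z mz))]_p F p)%E.
  rewrite integral_distribution//.
  by apply: bdm_integrable => //; apply: (bdm_comp (mp z mz) bF).
rewrite /Rintegral; congr fine; rewrite (key x mx) (key y my).
apply: eq_measure_integral => A mA _.
pose C : set (set (T * R)) := [set A `*` B | A in measurable & B in measurable].
apply: (measure_unique C (fun=> setT)) => //.
- exact: measurable_prod_measurableType.
- move=> _ _ [A1 mA1 [B1 mB1 <-]] [A2 mA2 [B2 mB2 <-]].
  rewrite -setXI; exists (A1 `&` A2); first exact: measurableI.
  by exists (B1 `&` B2) => //; exact: measurableI.
- by move=> i; exists setT => //; exists setT => //; rewrite setXTT.
- by rewrite bigcup_const//; exists 0%N.
- move=> _ [A1 mA1 [B1 mB1 <-]].
  by rewrite /distribution /pushforward /=; exact: hxy.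
- by move=> k; rewrite (le_lt_trans (probability_le1 _ _))// ltry.
Qed.

End SubSigmaAlgebra.

(** * Exchangeability and the past *)

Section Exchangeable.
Context d (Omega : measurableType d) (R : realType) (P : probability Omega R).
Context (g : nat -> Omega -> R).
Hypotheses (mg : forall n, measurable_fun setT (g n)) (exg : exchangeable P g).

(** Rectangles that leave the coordinates [i] and [j] free, hence are unaffected by exchanging them.
    Indexing the sides by all of [nat], eventually [setT], makes intersections coordinatewise. *)
Definition cylinders (i j : nat) : set (set Omega) :=
  [set A | exists (m : nat) (B : nat -> set R),
    [/\ forall k, measurable (B k), forall k, (m <= k)%N -> B k = setT &
    A = [set w | forall k, k != i -> k != j -> B k (g k w)]]].

Lemma cylinders_setI i j : setI_closed (cylinders i j).
Proof.
move=> _ _ [m1 [B1 [mB1 B1T ->]]] [m2 [B2 [mB2 B2T ->]]].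
exists (maxn m1 m2), (fun k => B1 k `&` B2 k); split.
- by move=> k; exact: measurableI.
- by move=> k; rewrite geq_max => /andP[? ?]; rewrite B1T// B2T// setTI.
- apply/seteqP; split=> w /=.
    by move=> [h1 h2] k ki kj; split; [exact: h1|exact: h2].
  by move=> h; split=> k ki kj; have [] := h k ki kj.
Qed.

Lemma cylinders_setT i j : cylinders i j setT.
Proof.
by exists 0%N, (fun=> setT); split => //; apply/seteqP; split.
Qed.

Lemma preimage_cylinders i j k B : k != i -> k != j -> measurable B ->
  cylinders i j (g k @^-1` B).
Proof.
move=> ki kj mB; exists k.+1, (fun l => if l == k then B else setT); split.
- by move=> l; case: ifP.
- by move=> l kl; rewrite gtn_eqF.
- apply/seteqP; split=> w /=; last by move=> /(_ k ki kj); rewrite eqxx.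
  by move=> Bw l _ _; case: eqP => // ->.
Qed.

Lemma cylinders_measurable i j : cylinders i j `<=` measurable.
Proof.
move=> _ [m [B [mB BT ->]]].
rewrite (_ : [set _ | _] = \bigcap_(k in [set k | k != i /\ k != j]) (g k @^-1` B k)).
  by apply: bigcap_measurableType => k _; rewrite -[X in measurable X]setTI; exact: mg.
by apply/seteqP; split=> w /= h k; [case=> ? ?; exact: h | move=> ? ?; apply: h].
Qed.

(** The transposition of [i] and [j] fixes every coordinate constrained by [C] and moves the
    constraint [B] from one of the two coordinates to the other; [n] only has to exceed [i], [j] and
    the support of [C]. *)
Lemma exchangeable_cylinder i j C B : i != j -> cylinders i j C -> measurable B ->
  P (C `&` g i @^-1` B) = P (C `&` g j @^-1` B).
Proof.
move=> ij [m [B' [mB' B'T ->]]] mB.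
pose n := (maxn m (maxn i j)).+1.
have iN : (i < n)%N by rewrite ltnS !leq_max leqnn orbT.
have jN : (j < n)%N by rewrite ltnS !leq_max leqnn !orbT.
have mN k : (m <= k)%N || (k < n)%N.
  by case: (leqP m k) => //= km; rewrite (leq_trans km)// leqW// leq_maxl.
pose oi := Ordinal iN; pose oj := Ordinal jN.
pose BB (k : 'I_n) := if k == oi then B else if k == oj then setT else B' k.
have mBB k : measurable (BB k) by rewrite /BB; case: ifP => // _; case: ifP.
have := @exg n (tperm oi oj) BB mBB.
set L := [set w | _]; set M := [set w | _] => LM.
rewrite [in LHS](_ : _ `&` _ = M); last first.
  apply/seteqP; split=> w; rewrite /M /BB /=.
    move=> [h Bw] k; case: eqP => [->//|/eqP ki]; case: eqP => // /eqP kj.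
    exact: h.
  move=> h; split; last by have := h oi; rewrite eqxx.
  move=> k ki kj; have /orP[mk|kn] := mN k; first by rewrite B'T.
  by have := h (Ordinal kn); rewrite -!val_eqE /= (negbTE ki) (negbTE kj).
rewrite -LM; congr (P _); apply/seteqP; split=> w; rewrite /L /BB /=.
  move=> h; split; last by have := h oi; rewrite tpermL eqxx.
  move=> k ki kj; have /orP[mk|kn] := mN k; first by rewrite B'T.
  have := h (Ordinal kn).
  by rewrite tpermD -?val_eqE /= ?(negbTE ki) ?(negbTE kj)// eq_sym.
move=> [h Bw] k; case: tpermP => [->|->|/eqP ki /eqP kj].
- by rewrite eqxx.
- by rewrite -val_eqE /= eq_sym (negbTE ij) eqxx.
- by rewrite (negbTE ki) (negbTE kj); exact: h.
Qed.

Lemma exchangeable_sigma i j C B : i != j -> <<s cylinders i j >> C -> measurable B ->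
  P (C `&` g i @^-1` B) = P (C `&` g j @^-1` B).
Proof.
move=> ij hC mB.
have mgB k : measurable (g k @^-1` B) by rewrite -[X in measurable X]setTI; exact: mg.
apply: (g_sigma_algebra_measure_unique (cylinders i j) (@cylinders_measurable i j)
  (fun=> setT) _ _ (mrestr P (mgB i)) (mrestr P (mgB j))) => //.
- by move=> _; exact: cylinders_setT.
- by rewrite bigcup_const//; exists 0%N.
- exact: cylinders_setI.
- by move=> A hA; exact: exchangeable_cylinder.
- by move=> k; rewrite /mrestr/= (le_lt_trans (probability_le1 _ _))// ?ltry//; exact: measurableI.
Qed.

Lemma exchangeable_exp i j (X : Omega -> R) (h : R -> R) : i != j ->
  bdm (X : g_sigma_algebraType (cylinders i j) -> R) -> bdm h ->
  \int[P]_(w in setT) (X w * h (g i w)) = \int[P]_(w in setT) (X w * h (g j w)).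
Proof.
move=> ij bX bh; apply: (@swap_exp _ _ _ _ (cylinders i j)) => //.
- exact: cylinders_measurable.
- by move=> C B hC mB; exact: exchangeable_sigma.
Qed.

(* The events on which [g n] may be exchanged with any later [g j]: they
   contain the tail events and those generated by [g 0, ..., g n.-1]. *)
Definition past (n : nat) : set (set Omega) :=
  [set A | forall j, (n < j)%N -> <<s cylinders n j >> A].

Lemma past_measurable n : past n `<=` measurable.
Proof.
by move=> A /(_ n.+1 (leqnn _)); apply: sigma_sub_measurable; exact: cylinders_measurable.
Qed.

Lemma bdm_past n j (X : Omega -> R) : (n < j)%N ->
  bdm (X : g_sigma_algebraType (past n) -> R) ->
  bdm (X : g_sigma_algebraType (cylinders n j) -> R).
Proof.
move=> nj [mX bX]; split => // mT B mB.
have : <<s past n >> (setT `&` X @^-1` B) by apply: mX => //; exact: measurableT.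
apply: smallest_sub; first exact: smallest_sigma_algebra.
by move=> A; exact.
Qed.

Lemma sigma_from_cylinders i j n : (maxn i j < n)%N ->
  sigma_from g n `<=` <<s cylinders i j >>.
Proof.
rewrite gtn_max => /andP[iN jN].
apply: smallest_sub; first exact: smallest_sigma_algebra.
move=> _ [k [nk [B [mB ->]]]]; apply: sub_sigma_algebra.
by apply: preimage_cylinders => //; rewrite gtn_eqF// (leq_trans _ nk).
Qed.

Lemma tail_past n : tail_sigma g `<=` past n.
Proof.
move=> A tA j nj; apply: (@sigma_from_cylinders _ _ j.+1); last exact: tA.
by rewrite gtn_max leqnn andbT ltnS ltnW.
Qed.

Lemma sigma_algebra_tail : sigma_algebra setT (tail_sigma g).
Proof.
split=> [n|A hA n|F hF n]; first exact: sigma_algebra0.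
- by apply: sigma_algebraCD; exact: hA.
- by apply: sigma_algebra_bigcup => k; exact: hF.
Qed.

Lemma tail_measurable : tail_sigma g `<=` measurable.
Proof. by move=> A /tail_past -/(_ 0%N); exact: past_measurable. Qed.

Lemma bdm_tail n (X : Omega -> R) : bdm (X : g_sigma_algebraType (tail_sigma g) -> R) ->
  bdm (X : g_sigma_algebraType (past n) -> R).
Proof. by apply: bdm_coarse; exact: tail_past. Qed.

Lemma measurable_past n k : (k < n)%N ->
  measurable_fun setT (g k : g_sigma_algebraType (past n) -> R).
Proof.
move=> kn _ B mB; rewrite setTI; apply: sub_sigma_algebra => j nj.
apply: sub_sigma_algebra; apply: preimage_cylinders => //; first by rewrite ltn_eqF.
by rewrite ltn_eqF// (ltn_trans kn).
Qed.

End Exchangeable.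

(** * Measurable dependence of integrals on a family of laws *)

Section ProbabilityKernel.
Context dX dY (X : measurableType dX) (Y : measurableType dY) (R : realType).
Context (k : X -> probability Y R).
Hypothesis mk : forall U, measurable U -> measurable_fun setT (fun x => k x U).

Definition family_measure : X -> {measure set Y -> \bar R} := fun x => k x.

HB.instance Definition _ := @isKernel.Build _ _ X Y R family_measure mk.

Let family_measureT x : family_measure x setT = 1%E.
Proof. exact: probability_setT. Qed.

HB.instance Definition _ := @Kernel_isProbability.Build _ _ X Y R family_measure
  family_measureT.

Lemma bdm_kernel (F : X * Y -> R) : bdm F ->
  bdm (fun x => \int[k x]_(y in setT) F (x, y)).
Proof.
move=> bF; have [mF [M FM]] := bF.
have bF1 x : bdm (fun y => F (x, y)).
  by apply: (bdm_comp _ bF); exact: measurable_pair1.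
split; last by exists M => x; apply: exp_bound => // y.
have bM : bdm (fun _ : X * Y => M) by exact: bdm_cst.
(* Measurability of kernel integrals is used for nonnegative integrands: adding the bound [M] makes
   [F] nonnegative and, under a probability, changes the integral by exactly [M]. *)
have -> : (fun x => \int[k x]_(y in setT) F (x, y)) =
    (fun x => \int[k x]_(y in setT) (F (x, y) + M) - M).
  by apply/funext => x; rewrite expD ?exp_cst ?addrK//; exact: bdm_cst.
apply: measurable_funB => //.
have := @measurable_fun_integral_sfinite_kernel _ _ X Y R (fun p => (F p + M)%:E)
  family_measure.
move=> h; have {}h : measurable_fun setT
    (fun x => (\int[family_measure x]_(y in setT) (F (x, y) + M)%:E)%E).
  apply: h.
    by move=> p; rewrite lee_fin; have := FM p; rewrite ler_norml; lra.
  by apply/measurable_EFinP; exact: (bdmD bF bM).1.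
rewrite (_ : (fun x => _) = fine \o
  (fun x => (\int[family_measure x]_(y in setT) (F (x, y) + M)%:E)%E))//.
exact: measurableT_comp.
Qed.

End ProbabilityKernel.

(** * Bounded integrands against a regular conditional distribution *)

Section RegularConditional.
Context d (Omega : measurableType d) (R : realType) (P : probability Omega R).
Context (G : set (set Omega)) (x : Omega -> R) (kappa : Omega -> probability R R).
Hypotheses (sG : sigma_algebra setT G) (hG : G `<=` measurable)
  (mx : measurable_fun setT x) (rcd : is_rcd P G x kappa).

Local Notation T := (g_sigma_algebraType G).
Local Notation E f := (\int[P]_(w in setT) f w).
Local Notation K h := (fun w => \int[kappa w]_(y in setT) h y).

Lemma measurable_rcd (B : set R) : measurable B ->
  measurable_fun setT ((fun w => kappa w B) : T -> \bar R).
Proof.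
move=> mB; have [m1 _] := rcd mB; have {}m1 := (meas_wrtP _ sG).1 m1.
rewrite (_ : (fun w => kappa w B) = EFin \o (fun w => fine (kappa w B))); last first.
  by apply/funext => w /=; rewrite fineK//; exact: fin_num_measure.
exact/measurable_EFinP.
Qed.

Lemma bdm_rcd (h : R -> R) : bdm h -> bdm (K h : T -> R).
Proof.
move=> bh.
apply: (@bdm_kernel _ _ T R R kappa measurable_rcd (fun p => h p.2)).
by apply: bdm_comp.
Qed.

Lemma rcd_exp_indic (C : set Omega) (B : set R) : G C -> measurable B ->
  E (fun w => \1_C w * \1_B (x w)) = E (fun w => \1_C w * K (\1_B) w).
Proof.
move=> GC mB; have [_ /(_ C GC) h] := rcd mB.
have mC := hG GC; apply: EFin_inj; rewrite !exp_indicM//; last 2 first.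
- by apply: bdm_sub hG _; apply: bdm_rcd; exact: bdm_indic.
- by apply: bdm_comp mx _; exact: bdm_indic.
transitivity (P (C `&` x @^-1` B)).
  have mxB : measurable (x @^-1` B) by rewrite -[X in measurable X]setTI; exact: mx.
  by rewrite setIC -(integral_indic P mC mxB).
rewrite -h; apply: eq_integral => w _.
by rewrite exp_indic.
Qed.

(** [is_rcd] speaks of indicators only. Rounding [n * h] down to an integer gives a finite
    combination [hn] of indicators within [1 / n] of [h] uniformly, so replacing [h] by [hn] moves
    each side by at most [e / 2], for arbitrary [e]. *)
Lemma rcd_exp (C : set Omega) (h : R -> R) : G C -> bdm h ->
  E (fun w => \1_C w * h (x w)) = E (fun w => \1_C w * K h w).
Proof.
move=> GC bh; have mC := hG GC; have [mh [M hM]] := bh.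
have bC : bdm (\1_C : Omega -> R) by exact: bdm_indic.
have bK f : bdm f -> bdm (K f : Omega -> R).
  by move=> bf; apply: bdm_sub hG _; exact: bdm_rcd.
apply/eqP; rewrite -subr_eq0 -normr_le0; apply/ler_addgt0Pl => e e0; rewrite addr0.
have [n n0 ne] : exists2 n : nat, (0 < n)%N & n%:R^-1 <= e / 2.
  exists (Num.bound (e / 2)^-1).+1 => //.
  rewrite -[leRHS]invrK lef_pV2 ?posrE ?invr_gt0 ?divr_gt0//.
  rewrite (le_trans (ltW (Num.Theory.archi_boundP _)))// ?ler_nat//.
  by rewrite invr_ge0 divr_ge0// ltW.
have n0' : 0 < n%:R :> R by rewrite ltr0n.
(* The integer parts of [n * h] lie in [[-L, L)]; shifting by [L] indexes the levels by naturals
   below [L + L]. *)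
pose L := (Num.bound (n%:R * M)).+1.
pose f (j : nat) y := \1_[set y | Num.floor (n%:R * h y) = j%:Z - L%:Z] y : R.
have mfl (j : nat) : measurable [set y | Num.floor (n%:R * h y) = j%:Z - L%:Z].
  rewrite (_ : [set _ | _] =
    [set y | ((j%:Z - L%:Z)%:~R <= n%:R * h y)] `&`
    [set y | (n%:R * h y < (j%:Z - L%:Z + 1)%:~R)]).
    apply: measurableI; [apply: measurable_ler|apply: measurable_ltr] => //;
    exact: measurable_funM.
  apply/seteqP; split=> y /=.
    by move=> <-; split; [exact: floor_le | exact: floorD1_gt].
  by move=> [h1 h2]; apply: floor_def; rewrite h1 h2.
have bf j : bdm (f j) by exact: bdm_indic.
pose hn y := \sum_(j < L + L) n%:R^-1 * (j%:Z - L%:Z)%:~R * f j y.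
have bfj j : bdm (fun y => n%:R^-1 * (j%:Z - L%:Z)%:~R * f j y).
  by apply: bdmM => //; exact: bdm_cst.
have bhn : bdm hn by exact: (bdm_sum (f := fun j y => n%:R^-1 * (j%:Z - L%:Z)%:~R * f j y)).
have hhn y : `|h y - hn y| <= n%:R^-1.
  have : `|n%:R * h y| < (Num.bound (n%:R * M))%:R.
    rewrite (le_lt_trans _ (Num.Theory.archi_boundP _))//.
      by rewrite normrM ger0_norm// ler_wpM2l.
    by rewrite mulr_ge0// (le_trans _ (hM point)).
  rewrite ltr_norml => /andP[l1 l2].
  set z := Num.floor (n%:R * h y).
  have zL : - L%:Z <= z.
    rewrite floor_ge_int rmorphN/=.
    rewrite (le_trans _ (ltW l1))// lerN2 ler_nat. exact: leqnSn.
  have zU : z < L%:Z.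
    rewrite floor_lt_int (lt_le_trans l2)// ler_nat; exact: leqnSn.
  have [j jz] : exists j : nat, z = j%:Z - L%:Z.
    by exists (absz (z + L%:Z)); rewrite gez0_abs ?addrK// -lerBlDr sub0r.
  have jL : (j < L + L)%N.
    by rewrite -ltz_nat PoszD; move: zU; rewrite jz ltrBlDr.
  have -> : hn y = n%:R^-1 * z%:~R.
    rewrite /hn (bigD1 (Ordinal jL))//= big1 ?addr0.
      by rewrite /f indicE mem_set ?mulr1 ?jz//= -jz.
    move=> i ij; rewrite /f indicE memNset ?mulr0//=.
    rewrite -/z jz => /addIr [] ji; move/negP : ij; apply; apply/eqP/val_inj.
    by rewrite /= ji.
  have -> : h y - n%:R^-1 * z%:~R = n%:R^-1 * (n%:R * h y - z%:~R).
    by rewrite mulrBr mulrA mulVf ?mul1r// gt_eqF.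
  rewrite normrM ger0_norm ?invr_ge0// -[leRHS]mulr1 ler_wpM2l ?invr_ge0//.
  have := floor_le (n%:R * h y); have := floorD1_gt (n%:R * h y).
  rewrite -/z rmorphD /= => u1 u2.
  by rewrite ger0_norm ?subr_ge0// lerBlDr addrC ltW.
have hE : E (fun w => \1_C w * hn (x w)) = E (fun w => \1_C w * K hn w).
  transitivity (E (fun w => \sum_(j < L + L) n%:R^-1 * (j%:Z - L%:Z)%:~R * (\1_C w * f j (x w)))).
    by apply: eq_Rintegral => w _; rewrite mulr_sumr; apply: eq_bigr => j _; ring.
  transitivity (E (fun w => \sum_(j < L + L) n%:R^-1 * (j%:Z - L%:Z)%:~R * (\1_C w * K (f j) w))).
    have b1 j : bdm (fun w => \1_C w * f j (x w)).
      by apply: bdmM => //; exact: bdm_comp mx _.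
    have b2 j : bdm (fun w => \1_C w * K (f j) w) by apply: bdmM => //; exact: bK.
    rewrite (exp_sum _ (f := fun j w => n%:R^-1 * (j%:Z - L%:Z)%:~R * (\1_C w * f j (x w)))).
      rewrite (exp_sum _ (f := fun j w => n%:R^-1 * (j%:Z - L%:Z)%:~R * (\1_C w * K (f j) w))).
        apply: eq_bigr => j _; rewrite !expZ//; congr (_ * _).
        exact: rcd_exp_indic.
      by move=> j _; apply: bdmM => //; exact: bdm_cst.
    by move=> j _; apply: bdmM => //; exact: bdm_cst.
  apply: eq_Rintegral => w _.
  rewrite (exp_sum _ (f := fun j y => n%:R^-1 * (j%:Z - L%:Z)%:~R * f j y))// mulr_sumr.
  by apply: eq_bigr => j _; rewrite expZ//; ring.
have C1 w : `|\1_C w| <= 1 :> R by rewrite indicE ger0_norm// lern1 leq_b1.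
have step (u v : Omega -> R) : bdm u -> bdm v -> (forall w, `|u w - v w| <= n%:R^-1) ->
    `|E (fun w => \1_C w * u w) - E (fun w => \1_C w * v w)| <= e / 2.
  move=> bu bv uv; rewrite -expB; [|exact: bdmM|exact: bdmM].
  rewrite (le_trans _ ne)//; apply: exp_bound.
    by apply: bdmB; exact: bdmM.
  move=> w; rewrite -mulrBr normrM -[leRHS]mul1r; exact: ler_pM.
have bhx : bdm (fun w => h (x w)) by exact: bdm_comp mx _.
have bhnx : bdm (fun w => hn (x w)) by exact: bdm_comp mx _.
have s1 := step _ _ bhx bhnx (fun w => hhn (x w)).
have s2 : `|E (fun w => \1_C w * K hn w) - E (fun w => \1_C w * K h w)| <= e / 2.
  apply: step => [||w]; [exact: bK|exact: bK|].
  rewrite -expB//; apply: exp_bound => [|y]; first exact: bdmB.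
  by rewrite distrC.
rewrite [leRHS]splitr (le_trans (ler_distD (E (fun w => \1_C w * hn (x w))) _ _))//.
by rewrite lerD// hE.
Qed.

End RegularConditional.

(** * Conditional independence given the tail *)

Section LimSup.
Context (R : realType).
Implicit Types u v : nat -> R.

Lemma bounded_funP u (M : R) : (forall k, `|u k| <= M) -> bounded_fun u.
Proof.
move=> uM; exists M; split; first exact: num_real.
by move=> y My x _ /=; rewrite (le_trans (uM x))// ltW.
Qed.

Lemma limn_sup_dist u (M c S : R) (k : nat) : (forall l, `|u l| <= M) ->
  (forall l, (k <= l)%N -> `|u l - c| <= S) -> `|limn_sup u - c| <= S.
Proof.
move=> uM h; have bu := bounded_funP uM.
have ub m : has_ubound (sdrop u m) by exact/has_ubound_sdrop/bounded_fun_has_ubound.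
rewrite limn_supE// ler_norml; apply/andP; split.
  rewrite lerBrDl; apply: lb_le_inf; first by exists (sups u 0); exists 0%N.
  move=> _ [m _ <-].
  have : u (maxn m k) <= sups u m.
    by apply: ub_le_sup => //; exists (maxn m k) => //=; rewrite leq_maxl.
  by have := h (maxn m k) (leq_maxr _ _); rewrite ler_norml; lra.
rewrite lerBlDr (@le_trans _ _ (sups u k))//.
  apply: ge_inf; last by exists k.
  exists (- M) => _ [m _ <-]; apply: (@le_trans _ _ (u m)).
    by have := uM m; rewrite ler_norml => /andP[].
  by apply: ub_le_sup => //; exists m => /=.
apply: ge_sup; first by exists (u k); exists k => /=.
move=> _ [l /= kl <-]; have := h l kl; rewrite ler_norml; lra.
Qed.

Lemma limn_sup_eq u v (M : R) : (forall k, `|u k| <= M) -> (forall k, `|v k| <= M) ->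
  (fun k => u k - v k) @ \oo --> 0 -> limn_sup u = limn_sup v.
Proof.
suff le a b : (forall k, `|a k| <= M) -> (forall k, `|b k| <= M) ->
    (fun k => a k - b k) @ \oo --> 0 -> limn_sup a <= limn_sup b.
  move=> uM vM uv; apply/eqP; rewrite eq_le !le//.
  rewrite -oppr0; under eq_fun do rewrite -opprB.
  exact: cvgN.
move=> aM bM ab.
have bd : bounded_fun (fun k => a k - b k).
  apply: (@bounded_funP _ (M + M)) => k.
  by rewrite (le_trans (ler_normB _ _))// lerD.
have := le_limn_supD (bounded_funP bM) bd.
rewrite (_ : b \+ _ = a); last by apply/funext => k /=; rewrite addrC subrK.
by rewrite [X in _ + X](cvg_limn_inf_sup ab).2 addr0.
Qed.

End LimSup.

(** * Second moments of block averages of an exchangeable sequence *)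

Section Averages.
Context d (Omega : measurableType d) (R : realType) (P : probability Omega R).
Context (g : nat -> Omega -> R).
Hypotheses (mg : forall n, measurable_fun setT (g n)) (exg : exchangeable P g).
Context (h : R -> R) (M : R).
Hypotheses (mh : measurable_fun setT h) (hM : forall y, `|h y| <= M).

Local Notation E f := (\int[P]_(w in setT) f w).
Let bh : bdm h. Proof. by split => //; exists M. Qed.
Let bhg i : bdm (fun w => h (g i w)). Proof. exact: bdm_comp (mg i) bh. Qed.
Let M0 : 0 <= M. Proof. by rewrite (le_trans _ (hM point)). Qed.

Let ex1 (f : R -> R) i : bdm f -> E (fun w => f (g i w)) = E (fun w => f (g 0%N w)).
Proof.
move=> bf; have [->//|i0] := eqVneq i 0%N.
have := @exchangeable_exp _ _ _ _ _ mg exg i 0%N (fun=> 1) f i0 (bdm_cst _ _) bf.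
under eq_Rintegral do rewrite mul1r.
by under [X in _ = X -> _]eq_Rintegral do rewrite mul1r.
Qed.

Let ex2 i i' j : j != i -> j != i' ->
  E (fun w => h (g j w) * h (g i w)) = E (fun w => h (g j w) * h (g i' w)).
Proof.
move=> ji ji'; have [->//|ii'] := eqVneq i i'.
apply: (@exchangeable_exp _ _ _ _ _ mg exg i i' (fun w => h (g j w)) h ii') => //.
apply: bdm_comp bh => _ B mB; rewrite setTI; apply: sub_sigma_algebra.
exact: preimage_cylinders.
Qed.

Let a := E (fun w => h (g 0%N w) ^+ 2).
Let b := E (fun w => h (g 0%N w) * h (g 1%N w)).

(** The indices are moved to [0] and [1] one at a time by [ex2]; the case distinction keeps the two
    indices distinct throughout. *)
Let exp_hh i j : i != j -> E (fun w => h (g i w) * h (g j w)) = b.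
Proof.
have sym k l : E (fun w => h (g k w) * h (g l w)) = E (fun w => h (g l w) * h (g k w)).
  by under eq_Rintegral do rewrite mulrC.
move=> ij; have [i0|i0] := eqVneq i 0%N.
  by rewrite i0; apply: ex2; rewrite // -i0.
have [i1|i1] := eqVneq i 1%N.
  by rewrite i1 [RHS]sym; apply: ex2; rewrite // -i1.
have [j0|j0] := eqVneq j 0%N.
  by rewrite sym j0; apply: ex2 => //; rewrite eq_sym.
rewrite (@ex2 j 0%N i)// sym; apply: ex2 => //; by rewrite eq_sym.
Qed.

(** Diagonal products have mean [a] and all others mean [b]. For weights of zero sum the common
    correlation [b] drops out of the first term, so differences of averages are small although the
    terms need not be independent. *)
Let exp_sum_sqr (s n : nat) (c : nat -> R) :
  E (fun w => (\sum_(i < n) c i * h (g (s + i)%N w)) ^+ 2) =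
  b * (\sum_(i < n) c i) ^+ 2 + (a - b) * \sum_(i < n) c i ^+ 2.
Proof.
have bc i : bdm (fun w => c i * h (g (s + i)%N w)).
  by apply: bdmM => //; exact: bdm_cst.
have bS m : bdm (fun w => \sum_(i < m) c i * h (g (s + i)%N w)).
  exact: (bdm_sum (f := fun i w => c i * h (g (s + i)%N w))).
elim: n => [|n ih].
  under eq_Rintegral do rewrite big_ord0 expr0n/=.
  by rewrite exp_cst !big_ord0; ring.
have hS m : (m <= n)%N -> E (fun w => (\sum_(i < m) c i * h (g (s + i)%N w)) * h (g (s + n)%N w)) =
   b * \sum_(i < m) c i.
  elim: m => [_|m ihm mn].
    under eq_Rintegral do rewrite big_ord0 mul0r.
    by rewrite exp_cst big_ord0 mulr0.
  under eq_Rintegral do rewrite big_ord_recr/= mulrDl -mulrA.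
  rewrite expD; [|exact: bdmM (bS m) (bhg _)|by apply: bdmM; [exact: bdm_cst|exact: bdmM (bhg _) (bhg _)]].
  rewrite ihm 1?ltnW// expZ; last exact: bdmM (bhg _) (bhg _).
  by rewrite exp_hh ?eqn_add2l ?ltn_eqF// big_ord_recr/=; ring.
transitivity (E (fun w => (\sum_(i < n) c i * h (g (s + i)%N w)) ^+ 2 +
   (2 * c n * ((\sum_(i < n) c i * h (g (s + i)%N w)) * h (g (s + n)%N w)) +
   c n ^+ 2 * h (g (s + n)%N w) ^+ 2))).
  by apply: eq_Rintegral => w _; rewrite big_ord_recr/=; ring.
have b1 : bdm (fun w => 2 * c n * ((\sum_(i < n) c i * h (g (s + i)%N w)) * h (g (s + n)%N w))).
  by apply: bdmM; [exact: bdm_cst|exact: bdmM (bS n) (bhg _)].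
have b2 : bdm (fun w => c n ^+ 2 * h (g (s + n)%N w) ^+ 2).
  by apply: bdmM; [exact: bdm_cst|exact: bdmX].
rewrite expD ?ih; [|exact: bdmX|exact: bdmD].
rewrite expD// !expZ ?hS//; [|exact: bdmX (bhg _)|exact: bdmM (bS n) (bhg _)].
rewrite (ex1 _ (bdmX 2 bh)) -/a !big_ord_recr/=.
by ring.
Qed.

(** The offset [n] makes the average depend on [g n, g n.+1, ...] only, as tail measurability of the
    limit demands. Lengths [4 ^ k] give increments of order [4 ^ - k] in mean square, that is
    [2 ^ - k] in mean. *)
Definition average (n k : nat) (w : Omega) : R :=
  (4 ^ k)%:R^-1 * \sum_(i < 4 ^ k) h (g (n + i)%N w).

Lemma bdm_average n k : bdm (average n k).
Proof.
apply: bdmM; first exact: bdm_cst.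
exact: (bdm_sum (f := fun i w => h (g (n + i)%N w))).
Qed.

Lemma average_le n k w : `|average n k w| <= M.
Proof.
have p4 : 0 < (4 ^ k)%:R :> R by rewrite ltr0n expn_gt0.
rewrite /average normrM gtr0_norm ?invr_gt0// mulrC ler_pdivrMr//.
rewrite (le_trans (ler_norm_sum _ _ _))// (le_trans (ler_sum _ (fun i _ => hM _)))//.
by rewrite sumr_const card_ord mulr_natr.
Qed.

(** Moving the window by one place drops one term and adds one, which changes the sum by at most
    [2 * M]. *)
Lemma average_shift n k w : `|average n k w - average 0 k w| <= 2 * n%:R * M / (4 ^ k)%:R.
Proof.
have p4 : 0 < (4 ^ k)%:R :> R by rewrite ltr0n expn_gt0.
rewrite -mulrBr normrM gtr0_norm ?invr_gt0// mulrC ler_pM2r ?invr_gt0//.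
elim: n => [|n ih].
  under [X in _ - X]eq_bigr do rewrite add0n.
  by rewrite subrr normr0 mulr0 mul0r.
have -> : \sum_(i < 4 ^ k) h (g (n.+1 + i)%N w) =
    \sum_(i < 4 ^ k) h (g (n + i)%N w) + (h (g (n + 4 ^ k)%N w) - h (g n w)).
  have : \sum_(i < (4 ^ k).+1) h (g (n + i)%N w) =
    h (g n w) + \sum_(i < 4 ^ k) h (g (n.+1 + i)%N w).
    rewrite big_ord_recl/= addn0; congr (_ + _); apply: eq_bigr => i _.
    by rewrite /bump leq0n add1n addnS addSn.
  by rewrite big_ord_recr/= => e; rewrite addrA e addrAC subrr add0r.
have := ih; have := hM (g (n + 4 ^ k)%N w); have := hM (g n w).
have -> : 2 * n.+1%:R * M = 2 * n%:R * M + 2 * M by rewrite -(natr1 n); ring.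
rewrite !ler_norml; lra.
Qed.

Lemma average_step n k :
  E (fun w => `|average n k.+1 w - average n k w|) <= (M ^+ 2 + 1) * 2^-1 ^+ k.
Proof.
have p2 : 0 < 2 ^+ k :> R by rewrite exprn_gt0.
pose D w := average n k.+1 w - average n k w.
have bD : bdm D by apply: bdmB; exact: bdm_average.
pose m := (4 ^ k)%N; pose m' := (4 ^ k.+1)%N.
have m0 : 0 < m%:R :> R by rewrite ltr0n expn_gt0.
have m'0 : 0 < m'%:R :> R by rewrite ltr0n expn_gt0.
have mm' : (m <= m')%N by rewrite leq_exp2l.
(* Weights of the increment over the longer block. Their sum is zero, so [exp_sum_sqr] leaves
   [(a - b)] times the sum of squares, at most [2 M ^ 2 / m]. *)
pose c (i : nat) : R := m'%:R^-1 - (if (i < m)%N then m%:R^-1 else 0).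
have D2 : E (fun w => D w ^+ 2) <= 2 * M ^+ 2 * m%:R^-1.
  have DE w : D w = \sum_(i < m') c i * h (g (n + i)%N w).
    rewrite /D /average -/m -/m' !mulr_sumr.
    rewrite (big_ord_widen _ (fun i => m%:R^-1 * h (g (n + i)%N w)) mm').
    rewrite [X in _ - X]big_mkcond/= -sumrB; apply: eq_bigr => i _.
    by rewrite /c; case: ifP => _; ring.
  under eq_Rintegral do rewrite DE.
  have sm (x : R) : \sum_(i < m') (if (i < m)%N then x else 0) = m%:R * x.
    rewrite -big_mkcond/= -(big_ord_widen _ (fun=> x) mm').
    by rewrite sumr_const card_ord mulr_natl.
  have sc (x : R) : \sum_(i < m') x = m'%:R * x by rewrite sumr_const card_ord mulr_natl.
  have c1 : \sum_(i < m') c i = 0.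
    by rewrite sumrB sm sc !mulfV ?subrr ?gt_eqF.
  have c2 : \sum_(i < m') c i ^+ 2 <= m%:R^-1.
    have -> : \sum_(i < m') c i ^+ 2 = \sum_(i < m') (m'%:R^-1 ^+ 2 +
        (if (i < m)%N then m%:R^-1 ^+ 2 - 2 * m'%:R^-1 * m%:R^-1 else 0)).
      by apply: eq_bigr => i _; rewrite /c; case: ifP => _; ring.
    rewrite big_split/= sm sc.
    have -> : m'%:R * m'%:R^-1 ^+ 2 = m'%:R^-1 :> R by rewrite expr2 mulrA mulfV ?mul1r// gt_eqF.
    have -> : m%:R * (m%:R^-1 ^+ 2 - 2 * m'%:R^-1 * m%:R^-1) =
       (m%:R * m%:R^-1) * (m%:R^-1 - 2 * m'%:R^-1) :> R by ring.
    rewrite mulfV ?gt_eqF// mul1r.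
    have : 0 < m'%:R^-1 :> R by rewrite invr_gt0.
    lra.
  rewrite exp_sum_sqr c1 expr0n/= mulr0 add0r.
  have hh i j : `|E (fun w => h (g i w) * h (g j w))| <= M ^+ 2.
    apply: exp_bound; first exact: bdmM.
    by move=> w; rewrite normrM expr2 ler_pM.
  have aM : `|a| <= M ^+ 2 by rewrite /a; under eq_Rintegral do rewrite expr2; exact: hh.
  have bM : `|b| <= M ^+ 2 by exact: hh.
  have c20 : 0 <= \sum_(i < m') c i ^+ 2 by apply: sumr_ge0 => i _; exact: sqr_ge0.
  apply: (@le_trans _ _ (2 * M ^+ 2 * \sum_(i < m') c i ^+ 2)).
    by rewrite ler_wpM2r//; move: aM bM; rewrite !ler_norml; lra.
  by rewrite ler_wpM2l// mulr_ge0// sqr_ge0.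
(* Since [q ^ 2 = 1 / m], the bound [x <= (x ^ 2 + 1) / 2] at [x = |D| / q] turns the mean square
   estimate into one for the mean of [|D|], in place of Cauchy-Schwarz. *)
pose q : R := 2^-1 ^+ k.
have q0 : 0 < q by rewrite /q exprn_gt0// invr_gt0.
have qE : m%:R^-1 = q ^+ 2.
  by rewrite /m natrX /q exprAC -exprVn; congr (_ ^+ _); field.
have -> : E (fun w => `|D w|) = q * E (fun w => q^-1 * `|D w|).
  rewrite expZ; last exact: bdm_norm.
  by rewrite mulrA mulfV ?mul1r// gt_eqF.
rewrite mulrC ler_pM2r//.
have bq : bdm (fun w => q^-1 * `|D w|) by apply: bdmM; [exact: bdm_cst|exact: bdm_norm].
apply: (@le_trans _ _ (E (fun w => 2^-1 * (q^-1 ^+ 2) * D w ^+ 2 + 2^-1))).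
  apply: exp_le => //.
    by apply: bdmD; [apply: bdmM; [exact: bdm_cst|exact: bdmX]|exact: bdm_cst].
  move=> w; have := sqr_ge0 (q^-1 * `|D w| - 1).
  have -> : (q^-1 * `|D w| - 1) ^+ 2 = q^-1 ^+ 2 * `|D w| ^+ 2 - 2 * (q^-1 * `|D w|) + 1 by ring.
  by rewrite real_normK ?num_real//; lra.
rewrite expD; [|by apply: bdmM; [exact: bdm_cst|exact: bdmX]|exact: bdm_cst].
rewrite exp_cst expZ; last exact: bdmX.
apply: (@le_trans _ _ (2^-1 * q^-1 ^+ 2 * (2 * M ^+ 2 * q ^+ 2) + 2^-1)).
  by rewrite lerD2r ler_wpM2l// -?qE// mulr_ge0// ?invr_ge0// sqr_ge0.
have -> : 2^-1 * q^-1 ^+ 2 * (2 * M ^+ 2 * q ^+ 2) = M ^+ 2 :> R.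
  by field; rewrite gt_eqF.
lra.
Qed.

End Averages.

(** * The limit of the averages and its identification with the conditional law *)

Section ConditionalIndependence.
Context d (Omega : measurableType d) (R : realType) (P : probability Omega R).
Context (g : nat -> Omega -> R).
Hypotheses (mg : forall n, measurable_fun setT (g n)) (exg : exchangeable P g).
Context (kappa : Omega -> probability R R).
Hypothesis rcd : is_rcd P (tail_sigma g) (g 0%N) kappa.

Local Notation E f := (\int[P]_(w in setT) f w).
Local Notation K h := (fun w => \int[kappa w]_(y in setT) h y).
Local Notation T := (g_sigma_algebraType (tail_sigma g)).

Lemma geometric_le0 (x c : R) : (forall k, x <= c * 2^-1 ^+ k) -> x <= 0.
Proof.
move=> h; have cv : (geometric c 2^-1 : R^nat) @ \oo --> 0.
  by apply: cvg_geometric; rewrite gtr0_norm ?invr_gt0// invf_lt1// ltr1n.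
rewrite -(cvg_lim _ cv)//; apply: limr_ge; first by apply/cvg_ex; exists 0.
by apply: nearW => k; rewrite /geometric/=.
Qed.

Section Limit.
Context (h : R -> R) (M : R).
Hypotheses (mh : measurable_fun setT h) (hM : forall y, `|h y| <= M).

Let bh : bdm h. Proof. by split => //; exists M. Qed.
Let bhg i : bdm (fun w => h (g i w)). Proof. exact: bdm_comp (mg i) bh. Qed.
Let avg := average g h.
Let bavg n k : bdm (avg n k). Proof. exact: (bdm_average mg mh hM). Qed.
Let avgM n k w : `|avg n k w| <= M. Proof. exact: (average_le g hM). Qed.

(** A limsup exists at every [w], and is finite as [h] is bounded; no exceptional null set, which
    could spoil tail measurability, has to be removed. *)
Definition average_limit (w : Omega) : R := limn_sup (fun k => average g h 0 k w).
Let H := average_limit.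

(** Windows starting at [0] and at [n] have averages differing by a multiple of [4 ^ - k]. The limit
    can thus be computed without [g 0, ..., g n.-1], for every [n], which is why it is
    tail-measurable. *)
Lemma average_limitE n w : H w = limn_sup (fun k => avg n k w).
Proof.
apply/esym/(@limn_sup_eq _ _ _ M); [by move=> k; exact: avgM..|].
apply/norm_cvg0P.
apply: (@squeeze_cvgr _ _ _ _ (cst 0) (geometric (2 * n%:R * M) 4^-1)).
- apply: nearW => k; rewrite normr_ge0/= (le_trans (average_shift g hM n k w))//.
  by rewrite natrX exprVn.
- exact: cvg_cst.
- by apply: cvg_geometric; rewrite gtr0_norm ?invr_gt0// invf_lt1// ltr1n.
Qed.

Lemma bdm_average_limit : bdm (H : T -> R).
Proof.
split; last first.
  exists M => w; rewrite -[H w]subr0.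
  apply: (@limn_sup_dist _ _ M _ _ 0%N) => [l|l _]; first exact: avgM.
  by rewrite subr0; exact: avgM.
apply/(meas_wrtP _ (sigma_algebra_tail g)) => B mB n.
rewrite /sigma_from; set Gn := (X in <<s X >>).
have mk k : (n <= k)%N -> measurable_fun setT (g k : g_sigma_algebraType Gn -> R).
  move=> nk _ C mC; rewrite setTI; apply: sub_sigma_algebra.
  by exists k; split => //; exists C.
suff : measurable_fun setT (H : g_sigma_algebraType Gn -> R).
  by move=> /(_ measurableT _ mB); rewrite setTI.
rewrite (_ : H = fun w => limn_sup (fun k => avg n k w)); last first.
  by apply/funext => w; exact: average_limitE.
apply: (@measurable_fun_limn_sup _ (g_sigma_algebraType Gn) R setT (fun k w => avg n k w)).
- by move=> w _; exists M => _ [k _ <-]; have := avgM n k w; rewrite ler_norml => /andP[].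
- by move=> w _; exists (- M) => _ [k _ <-]; have := avgM n k w; rewrite ler_norml => /andP[].
- move=> k; apply: measurable_funM => //.
  apply: (@measurable_sum _ (g_sigma_algebraType Gn)) => i.
  by apply: measurableT_comp => //; apply: mk; rewrite leq_addr.
Qed.

Let bH : bdm H.
Proof. exact: bdm_sub (tail_measurable mg) bdm_average_limit. Qed.

Lemma average_limit_dist n k :
  E (fun w => `|avg n k w - H w|) <= 2 * (M ^+ 2 + 1) * 2^-1 ^+ k.
Proof.
pose D l w := `|avg n (k + l).+1 w - avg n (k + l) w|.
have bD l : bdm (D l) by apply: bdm_norm; exact: bdmB.
have D0 l w : (0 <= (D l w)%:E)%E by rewrite lee_fin normr_ge0.
have C0 : 0 <= M ^+ 2 + 1 by rewrite addr_ge0// sqr_ge0.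
rewrite -lee_fin -expE; last by apply: bdm_norm; exact: bdmB.
(* Where the series is infinite there is nothing to prove. Where it is finite, all later averages
   stay within its sum of [avg n k w], and so does their limsup; almost sure convergence is never
   invoked. *)
have pw w : (`|avg n k w - H w|%:E <= \sum_(l <oo) (D l w)%:E)%E.
  have := @nneseries_lim_ge R (fun l => (D l w)%:E) xpredT 0.
  move=> /(_ _ (fun l _ _ => D0 l w)) => hge.
  have S0 : (0 <= \sum_(l <oo) (D l w)%:E)%E by exact: nneseries_ge0.
  case: (\sum_(l <oo) (D l w)%:E)%E hge S0 => [S|_ _|_]; last by rewrite leNgt ltNyr.
    move=> hge S0; rewrite lee_fin distrC (average_limitE n).
    apply: (@limn_sup_dist _ _ M _ _ k) => [l|l kl]; first exact: avgM.
    rewrite -(subnKC kl); set m := (l - k)%N.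
    apply: (@le_trans _ _ (\sum_(0 <= l < m) D l w)); last first.
      by rewrite -lee_fin -sumEFin; exact: hge.
    elim: (m) => [|j ih]; first by rewrite addn0 subrr normr0 big_nil.
    rewrite big_nat_recr//= addrC addnS.
    rewrite (le_trans (ler_distD (avg n (k + j)%N w) _ _))//.
    by rewrite lerD2l.
  by rewrite leey.
apply: (@le_trans _ _ (\int[P]_(w in setT) (\sum_(l <oo) (D l w)%:E))%E).
  apply: ge0_le_integral => //.
  - by have [m _] := bdm_norm (bdmB (bavg n k) bH); apply/measurable_EFinP.
  - by apply: ge0_emeasurable_sum => // l _; apply/measurable_EFinP; case: (bD l).
rewrite integral_nneseries//; last by move=> l; apply/measurable_EFinP; case: (bD l).
under eq_eseriesr do rewrite expE//.
apply: lime_le.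
  by apply: is_cvg_nneseries => l _ _; rewrite lee_fin; apply: exp_ge0 => w; exact: normr_ge0.
apply: nearW => m; rewrite sumEFin lee_fin.
apply: (@le_trans _ _ (\sum_(0 <= l < m) (M ^+ 2 + 1) * 2^-1 ^+ (k + l))).
  by apply: ler_sum => l _; exact: (average_step mg exg mh hM).
have -> : \sum_(0 <= l < m) (M ^+ 2 + 1) * 2^-1 ^+ (k + l) =
    (M ^+ 2 + 1) * 2^-1 ^+ k * (2 - 2 * 2^-1 ^+ m) :> R.
  elim: m => [|m ih]; first by rewrite big_nil expr0; ring.
  by rewrite big_nat_recr//= ih exprD (exprS _ m); move: (2^-1 ^+ k) (2^-1 ^+ m) => a b; field.
have : 0 <= (M ^+ 2 + 1) * 2^-1 ^+ k * (2 * 2^-1 ^+ m).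
  by rewrite mulr_ge0 ?mulr_ge0// exprn_ge0// invr_ge0.
lra.
Qed.

Lemma average_limit_exp n (X : Omega -> R) :
  bdm (X : g_sigma_algebraType (past g n) -> R) ->
  E (fun w => X w * h (g n w)) = E (fun w => X w * H w).
Proof.
move=> bX; have bX' : bdm X by exact: bdm_sub (@past_measurable _ _ _ _ mg n) bX.
have [_ [C XC]] := bX'.
have C0 : 0 <= C by rewrite (le_trans _ (XC point)).
(* For [i > 0] the index [n + i] is later than [n], so against [X] the variable [g (n + i)] may be
   exchanged with [g n]. Averaging over [i] gives a value independent of [k], and [k] can go to
   infinity. *)
have XA k : E (fun w => X w * avg n k w) = E (fun w => X w * h (g n w)).
  have p4 : 0 < (4 ^ k)%:R :> R by rewrite ltr0n expn_gt0.
  transitivity (E (fun w => (4 ^ k)%:R^-1 * \sum_(i < 4 ^ k) X w * h (g (n + i)%N w))).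
    by apply: eq_Rintegral => w _; rewrite /avg /average mulrCA mulr_sumr.
  have b1 i : bdm (fun w => X w * h (g (n + i)%N w)) by exact: bdmM.
  rewrite expZ; last exact: (bdm_sum (f := fun i w => X w * h (g (n + i)%N w))).
  rewrite (exp_sum _ (f := fun i w => X w * h (g (n + i)%N w)))//.
  rewrite (eq_bigr (fun=> E (fun w => X w * h (g n w)))).
    by rewrite sumr_const card_ord -[X in _ * X]mulr_natl mulrA mulVf ?mul1r// gt_eqF.
  move=> [[|i] ilt] _ /=; first by rewrite addn0.
  have ni : (n < n + i.+1)%N by rewrite addnS ltnS leq_addr.
  apply/esym/(exchangeable_exp mg exg) => //; first by rewrite ltn_eqF.
  exact: bdm_past.
apply/eqP; rewrite -subr_eq0 -normr_le0.
apply: (@geometric_le0 _ (C * (2 * (M ^+ 2 + 1)))) => k.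
rewrite -(XA k) -expB; [|exact: bdmM|exact: bdmM].
rewrite (le_trans (exp_norm _ _))//; first by apply: bdmB; exact: bdmM.
rewrite -[leRHS]mulrA.
apply: (@le_trans _ _ (C * E (fun w => `|avg n k w - H w|))); last first.
  by rewrite ler_wpM2l//; exact: average_limit_dist.
have bd : bdm (fun w => `|avg n k w - H w|) by apply: bdm_norm; exact: bdmB.
rewrite -expZ//; apply: exp_le.
- by apply: bdm_norm; apply: bdmB; exact: bdmM.
- by apply: bdmM => //; exact: bdm_cst.
- by move=> w; rewrite -mulrBr normrM ler_wpM2r.
Qed.

Let bK : bdm (K h : T -> R).
Proof. exact: (bdm_rcd (sigma_algebra_tail g) rcd). Qed.

(** Both functions are tail-measurable and have the same integral over each tail event, by
    [average_limit_exp] at index [0] and by [rcd_exp]. The set where [K h <= H] and its complement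
    are tail events, and together they yield the integral of the absolute value. *)
Lemma average_limit_rcd : E (fun w => `|H w - K h w|) = 0.
Proof.
have bK' : bdm (K h : Omega -> R) by exact: bdm_sub (tail_measurable mg) bK.
have bHK : bdm (fun w => H w - K h w) by exact: bdmB.
have key C : tail_sigma g C -> E (fun w => \1_C w * (H w - K h w)) = 0.
  move=> tC; have mC := tail_measurable mg tC.
  have bC : bdm (\1_C : Omega -> R) by exact: bdm_indic.
  have bC' : bdm (\1_C : T -> R).
    by apply: bdm_indic; exact: sub_sigma_algebra.
  transitivity (E (fun w => \1_C w * H w - \1_C w * K h w)).
    by apply: eq_Rintegral => w _; rewrite mulrBr.
  rewrite expB; [|exact: bdmM|exact: bdmM].
  rewrite -(rcd_exp (sigma_algebra_tail g) (tail_measurable mg) (mg 0%N) rcd tC bh).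
  by rewrite -(average_limit_exp (@bdm_tail _ _ _ g 0%N _ bC')) subrr.
pose C := [set w | K h w <= H w].
have tC : tail_sigma g C.
  rewrite -(measurable_g_measurableTypeE (sigma_algebra_tail g)).
  by apply: (@measurable_ler _ T); [case: bK|case: bdm_average_limit].
have tC' : tail_sigma g (~` C).
  have [_ hC _] := sigma_algebra_tail g; rewrite -setTD; exact: hC.
have mC := tail_measurable mg tC; have mC' := tail_measurable mg tC'.
transitivity (E (fun w => \1_C w * (H w - K h w) - \1_(~` C) w * (H w - K h w))).
  apply: eq_Rintegral => w _; rewrite !indicE in_setC.
  have [|] := boolP (w \in C).
    by rewrite inE /C /= => le; rewrite mul1r mul0r subr0 ger0_norm// subr_ge0.
  rewrite notin_setE /C /= => /negP; rewrite -ltNge => lt.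
  by rewrite mul1r mul0r sub0r ltr0_norm// subr_lt0.
rewrite expB; [|by apply: bdmM => //; exact: bdm_indic..].
by rewrite !key// subrr.
Qed.

End Limit.

(* The law of large numbers along [4 ^ k] makes [g n] conditionally independent
   of its past given the tail: replacing [h (g n)] by its averages over later
   indices does not change the expectation. *)
Lemma exp_past n (X : Omega -> R) (h : R -> R) :
  bdm (X : g_sigma_algebraType (past g n) -> R) -> bdm h ->
  E (fun w => X w * h (g n w)) = E (fun w => X w * K h w).
Proof.
move=> bX bh; have [mh [M hM]] := bh.
have bX' : bdm X by exact: bdm_sub (@past_measurable _ _ _ _ mg n) bX.
have bK : bdm (K h : Omega -> R).
  exact: bdm_sub (tail_measurable mg) (bdm_rcd (sigma_algebra_tail g) rcd bh).
have bH : bdm (average_limit h : Omega -> R).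
  exact: bdm_sub (tail_measurable mg) (bdm_average_limit mh hM).
have [_ [C XC]] := bX'.
rewrite (average_limit_exp mh hM bX).
apply/eqP; rewrite -subr_eq0 -normr_le0.
rewrite -expB; [|exact: bdmM|exact: bdmM].
rewrite (le_trans (exp_norm _ _))//; first by apply: bdmB; exact: bdmM.
have bd : bdm (fun w => `|average_limit h w - K h w|) by apply: bdm_norm; exact: bdmB.
rewrite -(mulr0 C) -[X in C * X](average_limit_rcd mh hM) -expZ//; apply: exp_le.
- by apply: bdm_norm; apply: bdmB; exact: bdmM.
- by apply: bdmM => //; exact: bdm_cst.
- by move=> w; rewrite -mulrBr normrM ler_wpM2r.
Qed.

End ConditionalIndependence.

(** * Bounded measurable functions under square root, cosine and sine *)

Section SqrtCosSin.
Context d (T : measurableType d) (R : realType).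

Lemma bdm_sqrt (f : T -> R) : bdm f -> bdm (fun x => Num.sqrt (f x)).
Proof.
move=> [mf [M fM]]; split.
  apply: measurableT_comp mf; apply: continuous_measurable_fun => x.
  exact: sqrt_continuous.
exists (1 + M) => x; rewrite ger0_norm ?sqrtr_ge0//.
have M0 : 0 <= M by rewrite (le_trans _ (fM x)).
rewrite -(@ger0_norm _ (1 + M)) ?addr_ge0// -sqrtr_sqr ler_wsqrtr//.
have := fM x; rewrite ler_norml => /andP[_ h].
rewrite (le_trans h)// sqrrD expr1n mul1r.
by have := sqr_ge0 M; lra.
Qed.

Lemma bdm_cos (f : T -> R) : measurable_fun setT f -> bdm (fun x => cos (f x)).
Proof.
move=> mf; split; first by apply: measurableT_comp mf; apply: continuous_measurable_fun => x; exact: continuous_cos.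
by exists 1 => x; rewrite ler_norml cos_geN1 cos_le1.
Qed.

Lemma bdm_sin (f : T -> R) : measurable_fun setT f -> bdm (fun x => sin (f x)).
Proof.
move=> mf; split; first by apply: measurableT_comp mf; apply: continuous_measurable_fun => x; exact: continuous_sin.
by exists 1 => x; rewrite ler_norml sin_geN1 sin_le1.
Qed.

End SqrtCosSin.

(** * Characteristic functions and variances given the tail *)

Section TailConditioning.
Context d (Omega : measurableType d) (R : realType) (P : probability Omega R).
Context (g : nat -> Omega -> R).
Hypotheses (mg : forall n, measurable_fun setT (g n)) (exg : exchangeable P g).
Context (kappa : Omega -> probability R R).
Hypothesis rcd : is_rcd P (tail_sigma g) (g 0%N) kappa.

Local Notation E f := (\int[P]_(w in setT) f w).
Local Notation K h := (fun w => \int[kappa w]_(y in setT) h y).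
Local Notation T := (g_sigma_algebraType (tail_sigma g)).

Lemma bdm_tail_sub (X : Omega -> R) : bdm (X : T -> R) -> bdm X.
Proof. exact: bdm_sub (tail_measurable mg). Qed.

Lemma bdm_condT (h : R -> R) : bdm h -> bdm (K h : T -> R).
Proof. by move=> bh; exact: (bdm_rcd (sigma_algebra_tail g) rcd bh). Qed.

Lemma bdm_cond (h : R -> R) : bdm h -> bdm (K h : Omega -> R).
Proof. by move=> bh; exact: bdm_tail_sub (bdm_condT bh). Qed.

Lemma exp_tail n (X : Omega -> R) (h : R -> R) : bdm (X : T -> R) -> bdm h ->
  E (fun w => X w * h (g n w)) = E (fun w => X w * K h w).
Proof. by move=> bX bh; apply: (exp_past mg exg rcd) => //; exact: bdm_tail. Qed.

(** The modulus [|phi v|] of the characteristic function of [kappa w], through its real and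
    imaginary parts. *)
Definition charfun_norm (v : R) (w : Omega) : R :=
  Num.sqrt (K (fun y => cos (v * y)) w ^+ 2 + K (fun y => sin (v * y)) w ^+ 2).

Lemma bdm_cosM (v : R) : bdm (fun y : R => cos (v * y)).
Proof. by apply: bdm_cos. Qed.

Lemma bdm_sinM (v : R) : bdm (fun y : R => sin (v * y)).
Proof. by apply: bdm_sin. Qed.

Lemma bdm_charfun_norm v : bdm (charfun_norm v : T -> R).
Proof.
apply: bdm_sqrt; apply: bdmD; apply: bdmX; apply: bdm_condT.
  exact: bdm_cosM.
exact: bdm_sinM.
Qed.

(** The integrand is the real part of [(a - i b) e ^ (i S)]. Integrating out the last variable given
    its past multiplies the coefficient by [phi v], which is tail-measurable, so the induction
    continues with new coefficients whose norm has gained a factor [|phi v|]. Letting [a] and [b]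
    vary is what later admits any tail-measurable centring. *)
Lemma exp_cos_sum_le (v : R) n (a b : Omega -> R) :
  bdm (a : T -> R) -> bdm (b : T -> R) ->
  E (fun w => a w * cos (\sum_(i < n) v * g i w) + b w * sin (\sum_(i < n) v * g i w)) <=
  E (fun w => Num.sqrt (a w ^+ 2 + b w ^+ 2) * charfun_norm v w ^+ n).
Proof.
elim: n a b => [|n ih] a b ba bb.
  have ba' := bdm_tail_sub ba; have bb' := bdm_tail_sub bb.
  have bs : bdm (fun w => Num.sqrt (a w ^+ 2 + b w ^+ 2)).
    by apply: bdm_sqrt; apply: bdmD; exact: bdmX.
  under eq_Rintegral do rewrite big_ord0 cos0 sin0 mulr1 mulr0 addr0.
  under [leRHS]eq_Rintegral do rewrite expr0 mulr1.
  apply: exp_le => // w; rewrite (le_trans (ler_norm _))// -sqrtr_sqr.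
  by rewrite ler_wsqrtr// lerDl sqr_ge0.
pose S w := \sum_(i < n) v * g i w.
have mS : measurable_fun setT (S : g_sigma_algebraType (past g n) -> R).
  apply: (@measurable_sum _ (g_sigma_algebraType (past g n))) => i.
  by apply: measurable_funM => //; exact: measurable_past.
pose p := K (fun y => cos (v * y)); pose q := K (fun y => sin (v * y)).
have bp : bdm (p : T -> R) by exact: bdm_condT (bdm_cosM v).
have bq : bdm (q : T -> R) by exact: bdm_condT (bdm_sinM v).
(* Real form of [a' - i b' = (a - i b) (p + i q)]. *)
pose a' w := a w * p w + b w * q w; pose b' w := b w * p w - a w * q w.
have ba' : bdm (a' : T -> R) by apply: bdmD; exact: bdmM.
have bb' : bdm (b' : T -> R) by apply: bdmB; exact: bdmM.
have bcp : bdm ((fun w => cos (S w)) : g_sigma_algebraType (past g n) -> R) by exact: bdm_cos.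
have bsp : bdm ((fun w => sin (S w)) : g_sigma_algebraType (past g n) -> R) by exact: bdm_sin.
have bc := bdm_sub (@past_measurable _ _ _ _ mg n) bcp.
have bs := bdm_sub (@past_measurable _ _ _ _ mg n) bsp.
have [ta tb tp tq] : [/\ bdm a, bdm b, bdm p & bdm q] by split; exact: bdm_tail_sub.
have pa := @bdm_tail _ _ _ g n _ ba; have pb := @bdm_tail _ _ _ g n _ bb.
pose X1 w := a w * cos (S w) + b w * sin (S w).
pose X2 w := b w * cos (S w) - a w * sin (S w).
have bX1 : bdm (X1 : g_sigma_algebraType (past g n) -> R) by apply: bdmD; exact: bdmM.
have bX2 : bdm (X2 : g_sigma_algebraType (past g n) -> R) by apply: bdmB; exact: bdmM.
have tX1 : bdm X1 by apply: bdmD; exact: bdmM.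
have tX2 : bdm X2 by apply: bdmB; exact: bdmM.
have bcn : bdm (fun w => cos (v * g n w)) by exact: bdm_comp (mg n) (bdm_cosM v).
have bsn : bdm (fun w => sin (v * g n w)) by exact: bdm_comp (mg n) (bdm_sinM v).
have -> : E (fun w => a w * cos (\sum_(i < n.+1) v * g i w) + b w * sin (\sum_(i < n.+1) v * g i w)) =
  E (fun w => a' w * cos (S w) + b' w * sin (S w)).
  transitivity (E (fun w => X1 w * cos (v * g n w) + X2 w * sin (v * g n w))).
    apply: eq_Rintegral => w _; rewrite big_ord_recr/= -/(S w) cosD sinD /X1 /X2; ring.
  transitivity (E (fun w => X1 w * p w + X2 w * q w)).
    rewrite [LHS]expD; [|exact: bdmM|exact: bdmM].
    rewrite [RHS]expD; [|exact: bdmM|exact: bdmM].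
    by congr (_ + _); apply: (exp_past mg exg rcd) => //; [exact: bdm_cosM|exact: bdm_sinM].
  by apply: eq_Rintegral => w _; rewrite /X1 /X2 /a' /b'; ring.
rewrite (le_trans (ih _ _ ba' bb'))// le_eqVlt; apply/orP; left; apply/eqP.
apply: eq_Rintegral => w _.
rewrite (exprS _ n) mulrA; congr (_ * _).
rewrite /charfun_norm -sqrtrM; last by rewrite addr_ge0// sqr_ge0.
by congr (Num.sqrt _); rewrite /a' /b' -/(p w) -/(q w); ring.
Qed.

(** Against the past quantity [\1_C * S] the variable [tau (g n)] integrates like [K tau], so the
    cross term vanishes and variances add. The squared conditional mean is dropped from each
    variance. *)
Lemma exp_centered_sum_le (C : set Omega) (tau : R -> R) n :
  tail_sigma g C -> bdm tau ->
  E (fun w => \1_C w * (\sum_(i < n) (tau (g i w) - K tau w)) ^+ 2) <=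
  n%:R * E (fun w => \1_C w * K (fun y => tau y ^+ 2) w).
Proof.
move=> tC bt.
have mC := tail_measurable mg tC.
have bC : bdm (\1_C : Omega -> R) by exact: bdm_indic.
have bCT : bdm (\1_C : T -> R) by apply: bdm_indic; exact: sub_sigma_algebra.
have btK := bdm_condT bt; have bt2 := bdmX 2 bt.
have bK := bdm_cond bt; have bK2 := bdm_cond bt2.
have bg i : bdm (fun w => tau (g i w)) by exact: bdm_comp (mg i) bt.
have bY i : bdm (fun w => tau (g i w) - K tau w) by exact: bdmB.
have bS m : bdm (fun w => \sum_(i < m) (tau (g i w) - K tau w)).
  exact: (bdm_sum (f := fun i w => tau (g i w) - K tau w)).
elim: n => [|n ih].
  under eq_Rintegral do rewrite big_ord0 expr0n mulr0.
  by rewrite exp_cst mul0r.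
pose S w := \sum_(i < n) (tau (g i w) - K tau w).
have bSp : bdm (S : g_sigma_algebraType (past g n) -> R).
  apply: (@bdm_sum _ (g_sigma_algebraType (past g n)) R n (fun i w => tau (g i w) - K tau w)) => i ni.
  apply: bdmB; last exact: bdm_tail.
  by apply: bdm_comp bt; exact: measurable_past.
have bCS : bdm ((fun w => \1_C w * S w) : g_sigma_algebraType (past g n) -> R).
  by apply: bdmM => //; exact: (@bdm_tail _ _ _ g n _ bCT).
pose I w := \1_C w : R.
have bSn : bdm S := bS n; have bI : bdm I := bC.
have -> : E (fun w => \1_C w * (\sum_(i < n.+1) (tau (g i w) - K tau w)) ^+ 2) =
    E (fun w => I w * S w ^+ 2) +
    (E (fun w => 2 * ((I w * S w) * tau (g n w) - (I w * S w) * K tau w)) +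
     (E (fun w => I w * tau (g n w) ^+ 2) - 2 * E (fun w => (I w * K tau w) * tau (g n w)) +
      E (fun w => (I w * K tau w) * K tau w))).
  have b1 : bdm (fun w => I w * S w) by exact: bdmM.
  have b2 : bdm (fun w => I w * K tau w) by exact: bdmM.
  have b3 : bdm (fun w => I w * K tau w * tau (g n w)) by exact: bdmM.
  have b4 : bdm (fun w => I w * tau (g n w) ^+ 2) by apply: bdmM => //; exact: bdmX.
  have b5 : bdm (fun w => I w * K tau w * K tau w) by exact: bdmM.
  have b6 : bdm (fun w => 2 * (I w * K tau w * tau (g n w))) by apply: bdmM => //; exact: bdm_cst.
  have b7 : bdm (fun w => 2 * (I w * S w * tau (g n w) - I w * S w * K tau w)).
    by apply: bdmM; [exact: bdm_cst|apply: bdmB; exact: bdmM].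
  have b8 : bdm (fun w => I w * S w ^+ 2) by apply: bdmM => //; exact: bdmX.
  rewrite -expZ// -expB// -expD//; last exact: bdmB.
  rewrite -expD//; last by apply: bdmD => //; exact: bdmB.
  rewrite -expD//; last by apply: bdmD => //; apply: bdmD => //; exact: bdmB.
  by apply: eq_Rintegral => w _; rewrite big_ord_recr/= -/(S w) -/(I w); ring.
have -> : E (fun w => 2 * ((I w * S w) * tau (g n w) - (I w * S w) * K tau w)) = 0.
  have b1 : bdm (fun w => I w * S w) by exact: bdmM.
  rewrite expZ; last by apply: bdmB; exact: bdmM.
  rewrite expB; [|exact: bdmM|exact: bdmM].
  by rewrite (exp_past mg exg rcd)// subrr mulr0.
rewrite (@exp_tail n I (fun y => tau y ^+ 2))//.
rewrite (@exp_tail n (fun w => I w * K tau w))//; last exact: bdmM.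
have : 0 <= E (fun w => (I w * K tau w) * K tau w).
  apply: exp_ge0 => w; rewrite -mulrA; apply: mulr_ge0; first by rewrite /I indicE.
  by rewrite -expr2 sqr_ge0.
have := ih; rewrite -/S -(natr1 n) mulrDl mul1r -/I.
lra.
Qed.

End TailConditioning.

(** * Trigonometric and elementary integrals *)

Section RealIntegrals.
Context (R : realType).
Local Notation mu := (@lebesgue_measure R).

Lemma is_derive_poly_trig (p : {poly R}) (a b z : R) :
  is_derive z (1 : R) (fun z => p.[z] + a * sin z + b * cos z)
    ((p^`()).[z] + a * cos z - b * sin z).
Proof.
have d1 : is_derive z (1 : R) (horner p) (p^`()).[z].
  exact: is_derive_poly.
have d2 : is_derive z (1 : R) (a *: (sin : R -> R) : R -> R) (a *: cos z).
  exact: is_deriveZ.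
have d3 : is_derive z (1 : R) (b *: (cos : R -> R) : R -> R) (b *: - sin z).
  exact: is_deriveZ.
have := is_deriveD (is_deriveD d1 d2) d3.
by rewrite /GRing.scale/= mulrN.
Qed.

Lemma ge0_derive_ge (F f : R -> R) (z : R) :
  (forall x, is_derive x (1 : R) F (f x)) -> (forall x, 0 <= x -> 0 <= f x) ->
  0 <= z -> F 0 <= F z.
Proof.
move=> dF f0 z0.
apply: (@ger0_derive1_ndecr _ F 0 z) => //.
- by move=> x; rewrite in_itv/= => /andP[x0 _]; rewrite derive1E derive_val; exact/f0/ltW.
- apply: continuous_subspaceT => x; apply: differentiable_continuous.
  exact/derivable1_diffP.
Qed.

Lemma integral_derive (F f : R -> R) (a b : R) : a < b ->
  (forall x, is_derive x (1 : R) F (f x)) -> continuous f ->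
  (\int[mu]_(x in `[a, b]) (f x)%:E = (F b - F a)%:E)%E.
Proof.
move=> ab dF cf.
have cF : continuous F.
  by move=> x; exact/differentiable_continuous/derivable1_diffP.
rewrite (@continuous_FTC2 _ f F)//.
- exact: continuous_subspaceT.
- split; first by move=> x _; exact: ex_derive.
  + by apply: cvg_at_right_filter; exact: cF.
  + by apply: cvg_at_left_filter; exact: cF.
- by move=> x _; rewrite derive1E derive_val.
Qed.

(** One integration from the origin, where the function vanishes. Starting from [cos <= 1] and
    repeating it produces the alternating Taylor bounds. *)
Lemma poly_trig_ge0 (p : {poly R}) (a b : R) :
  (forall x, 0 <= x -> 0 <= (p^`()).[x] + a * cos x - b * sin x) ->
  p.[0] + b = 0 -> forall x, 0 <= x -> 0 <= p.[x] + a * sin x + b * cos x.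
Proof.
move=> h pb x x0.
have := @ge0_derive_ge (fun z => p.[z] + a * sin z + b * cos z) _ x
  (is_derive_poly_trig p a b) h x0.
by rewrite sin0 cos0 mulr0 addr0 mulr1 pb.
Qed.

Lemma one_sub_cos_le (z : R) : 1 - cos z <= 2^-1 * z ^+ 2.
Proof.
wlog z0 : z / 0 <= z.
  move=> h; have [/h//|z0] := leP 0 z.
  by rewrite -cosN -sqrrN; apply: h; rewrite oppr_ge0 ltW.
have h1 x : 0 <= x -> 0 <= ('X : {poly R}).[x] + (-1) * sin x + 0 * cos x.
  apply: poly_trig_ge0; last by rewrite hornerX addr0.
  by move=> y _; rewrite derivX hornerC; have := cos_le1 y; lra.
suff : 0 <= (2^-1 *: 'X^2 - 1 : {poly R}).[z] + 0 * sin z + 1 * cos z.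
  by rewrite !hornerE/=; lra.
apply: poly_trig_ge0 z0; last by rewrite !hornerE/=; ring.
by move=> y /h1; rewrite derivB derivZ derivXn derivC !hornerE/=; lra.
Qed.

Lemma sin_upper (z : R) : 0 <= z -> sin z <= z - z ^+ 3 / 6 + z ^+ 5 / 120.
Proof.
(* Each of the next three functions is the derivative of the following one: lower bound for [sin],
   upper bound for [cos], upper bound for [sin]. *)
have h3 x : 0 <= x -> 0 <= (6^-1 *: 'X^3 - 'X : {poly R}).[x] + 1 * sin x + 0 * cos x.
  apply: poly_trig_ge0; last by rewrite !hornerE/=; ring.
  by move=> y _; rewrite derivB derivZ derivXn derivX !hornerE/=; have := one_sub_cos_le y; lra.
have h4 x : 0 <= x -> 0 <= (24^-1 *: 'X^4 - 2^-1 *: 'X^2 + 1 : {poly R}).[x] + 0 * sin x + (-1) * cos x.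
  apply: poly_trig_ge0; last by rewrite !hornerE/=; ring.
  by move=> y /h3; rewrite derivD derivB !derivZ !derivXn derivC !hornerE/=; lra.
have h5 x : 0 <= x -> 0 <= (120^-1 *: 'X^5 - 6^-1 *: 'X^3 + 'X : {poly R}).[x] + (-1) * sin x + 0 * cos x.
  apply: poly_trig_ge0; last by rewrite !hornerE/=; ring.
  by move=> y /h4; rewrite derivD derivB !derivZ !derivXn derivX !hornerE/=; lra.
by move=> /h5; rewrite !hornerE/=; lra.
Qed.

Lemma integral_one_sub_cos (y : R) :
  (\int[mu]_(u in `[0%R, 1%R]) (1 - cos (u * y))%:E >= (8^-1 * Num.min `|y| 1 ^+ 2)%:E)%E.
Proof.
wlog y0 : y / 0 <= y.
  move=> h; have [/h//|y0] := leP 0 y.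
  rewrite -normrN (le_trans (h (- y) _))//; first by rewrite oppr_ge0 ltW.
  by under eq_integral do rewrite mulrN cosN.
rewrite ger0_norm//.
move: y0; rewrite le_eqVlt => /predU1P[<-|y0].
  rewrite min_l// expr0n mulr0; apply: integral_ge0 => u _.
  by rewrite lee_fin subr_ge0 cos_le1.
pose F u : R := u - sin (u * y) / y.
have dF u : is_derive u (1 : R) F (1 - cos (u * y)).
  have d2 : is_derive u (1 : R) (fun u => sin (u * y)) (y * cos (u * y)).
    have d3 : is_derive u (1 : R) (fun u => u * y) y.
      have := @is_deriveZ _ _ _ (@idfun R) y u (1 : R) 1 _.
      rewrite (_ : y \*: _ = fun u => u * y); last by apply/funext => v /=; rewrite /GRing.scale/= mulrC.
      by rewrite /GRing.scale/= mulr1; apply.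
    by rewrite mulrC; exact: (@is_derive1_comp _ sin (fun u => u * y) u _ _ (is_derive_sin _) d3).
  have := is_deriveB (is_derive_id u (1 : R)) (is_deriveZ y^-1 d2).
  rewrite /GRing.scale/= mulrA mulVf ?gt_eqF// mul1r.
  by rewrite (_ : _ - _ = F)//; apply/funext => v; rewrite /F mulrC.
rewrite (@integral_derive F (fun u => 1 - cos (u * y)))//; last first.
  move=> u; apply: cvgB; first exact: cvg_cst.
  apply: continuous_comp; last exact: continuous_cos.
  exact: mulrr_continuous.
rewrite /F mul0r sin0 mul0r subrr subr0 mul1r lee_fin.
(* The integral is [1 - sin y / y]. Up to [1] the quintic bound with [y ^ 5 <= y ^ 3] leaves
   [19/120 >= 1/8] of [y ^ 2]; up to [2], [y ^ 5 <= 4 y ^ 3] and [y <= y ^ 3] suffice; beyond,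
   [sin y <= 1] does. *)
have [y1|y1] := leP y 1.
  have s := sin_upper (ltW y0).
  suff : sin y / y <= 1 - 8^-1 * y ^+ 2 by lra.
  rewrite ler_pdivrMr//.
  have y3 : 0 <= y ^+ 3 by rewrite exprn_ge0// ltW.
  have y5 : y ^+ 5 <= y ^+ 3.
    by rewrite (_ : y ^+ 5 = y ^+ 3 * y ^+ 2); [rewrite ler_piMr// expr_le1// ltW|ring].
  have -> : (1 - 8^-1 * y ^+ 2) * y = y - y ^+ 3 / 8 by ring.
  lra.
have [y2|y2] := leP y 2.
  have s := sin_upper (ltW y0).
  suff : sin y / y <= 1 - 8^-1 by rewrite expr1n; lra.
  rewrite ler_pdivrMr//.
  have y3 : 0 <= y ^+ 3 by rewrite exprn_ge0// ltW.
  have y31 : y <= y ^+ 3.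
    by rewrite (_ : y ^+ 3 = y * y ^+ 2); [rewrite ler_peMr ?exprn_ege1// ltW|ring].
  have y5 : y ^+ 5 <= 4 * y ^+ 3.
    rewrite (_ : y ^+ 5 = y ^+ 2 * y ^+ 3); last by ring.
    rewrite ler_wpM2r// (_ : 4 = 2 ^+ 2 :> R); last by ring.
    by rewrite lerXn2r// nnegrE ltW.
  lra.
rewrite expr1n.
suff : sin y / y <= 2^-1 by lra.
by rewrite ler_pdivrMr//; have := sin_le1 y; lra.
Qed.

Lemma integral_id_itv (a : R) : 0 <= a ->
  (\int[mu]_(t in `[0%R, a]) t%:E = (2^-1 * a ^+ 2)%:E)%E.
Proof.
rewrite le_eqVlt => /predU1P[<-|a0].
  by rewrite set_itv1 integral_set1 expr0n mulr0.
have dF x : is_derive x (1 : R) (fun z : R => 2^-1 * z ^+ 2) x.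
  have := is_derive_poly_trig (2^-1 *: 'X^2) 0 0 x.
  rewrite (_ : (fun z => _ + _) = fun z => 2^-1 * z ^+ 2); last first.
    by apply/funext => z; rewrite !hornerE/= ?mul0r ?addr0.
  by move=> h; apply: is_derive_eq; rewrite derivZ derivXn !hornerE/=; field.
rewrite (integral_derive a0 dF); last by move=> x; exact: cvg_id.
by rewrite expr0n mulr0 subr0.
Qed.

Lemma integral_inv_cube (a : R) : 0 < a ->
  (\int[mu]_(t in `[a, +oo[) (t^-1 ^+ 3)%:E = (2^-1 * a^-1 ^+ 2)%:E)%E.
Proof.
move=> a0; pose F t : R := - (2^-1 * t^-1 ^+ 2).
have dV (t : R) : 0 < t -> is_derive t (1 : R) (fun t => t^-1) (- t ^- 2).
  move=> t0; have := @is_deriveV _ idfun t 1 1 _ (is_derive_id t 1).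
  by rewrite /GRing.scale/= mulr1; apply; rewrite gt_eqF.
have dF (t : R) : 0 < t -> is_derive t (1 : R) F (t^-1 ^+ 3).
  move=> t0; have := is_deriveN (is_deriveZ 2^-1 (is_deriveX 2 (dV t t0))).
  rewrite /GRing.scale/=.
  rewrite (_ : - _ = F); last by [].
  move=> h; apply: is_derive_eq h _.
  by field; rewrite gt_eqF.
rewrite (@ge0_continuous_FTC2y _ _ F _ 0)//.
- by rewrite /F -EFinN opprK add0e.
- by move=> x ax; rewrite exprn_ge0// invr_ge0 (le_trans (ltW a0)).
- apply: continuous_in_subspaceT => x; rewrite inE/= in_itv/= andbT => ax.
  have h := is_deriveX 3 (dV x (lt_le_trans a0 ax)).
  have {h} := @ex_derive _ _ _ _ _ _ _ h.
  by move=> /derivable1_diffP/differentiable_continuous.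
- have h : (fun x : R => x^-1) @ +oo%R --> (0 : R).
    apply/(@gtr0_cvgV0 _ _ _ _ id); last exact: cvg_id.
    by apply: nbhs_pinfty_gt.
  have := cvgN (cvgM (cvg_cst (2^-1 : R)) (cvgM h h)).
  by rewrite !mulr0 oppr0 => h2; exact: h2.
- by move=> x ax; have h := dF x (lt_trans a0 ax); exact: ex_derive.
- apply: cvg_at_right_filter; apply/differentiable_continuous/derivable1_diffP.
  by have h := dF a a0; exact: ex_derive.
- move=> x; rewrite in_itv/= andbT => ax; rewrite derive1E.
  by have h := dF x (lt_trans a0 ax); rewrite derive_val.
Qed.

End RealIntegrals.

(** * Estimates for a fixed law *)

Section FixedLaw.
Context d (Omega : measurableType d) (R : realType) (kappa : Omega -> probability R R) (w : Omega).
Local Notation E f := (\int[kappa w]_(x in setT) f x).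

Lemma measurable_norm_le (K : R) : measurable [set x : R | `|x| <= K].
Proof. exact: measurable_ler. Qed.

Lemma bdm_trunc (c : R) : bdm (trunc c).
Proof.
split.
  apply: measurable_fun_ifT => //.
  by apply: measurable_fun_ler.
exists `|c| => x; rewrite /trunc; case: ifP => [h|_]; last by rewrite normr0.
by rewrite (le_trans h)// ler_norm.
Qed.

Lemma bdm_min_norm (c : R) : bdm (fun x : R => Num.min `|x| c).
Proof.
split; first by apply: measurable_minr.
exists `|c| => x; have [h|h] := leP `|x| c; last by [].
by rewrite normr_id (le_trans h)// ler_norm.
Qed.

Lemma min_norm_sqr (c x : R) : 0 <= c ->
  Num.min `|x| c ^+ 2 = trunc c x ^+ 2 + c ^+ 2 * \1_[set x : R | c < `|x|] x.
Proof.
move=> c0; rewrite /trunc indicE; have [h|h] := leP `|x| c.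
  rewrite memNset/=; last by apply/negP; rewrite -leNgt.
  by rewrite mulr0 addr0 real_normK ?num_real.
by rewrite mem_set// mulr1 expr0n add0r.
Qed.

Lemma measurable_norm_gt (c : R) : measurable [set x : R | c < `|x|].
Proof. exact: measurable_ltr. Qed.

Lemma Tq_exp (eps t : R) :
  Tq kappa eps t w = t * E (\1_[set x : R | eps * t < `|x|]).
Proof.
rewrite /Tq; congr (_ * _); rewrite -exp_indic//; exact: measurable_norm_gt.
Qed.

Lemma RqE (eps t : R) : 0 < eps -> 0 < t ->
  Rq kappa eps t w = Sigmaq kappa eps t w + eps ^+ 2 * Tq kappa eps t w.
Proof.
move=> e0 t0; have et : 0 <= eps * t by rewrite mulr_ge0// ltW.
rewrite Tq_exp /Rq /Sigmaq.
under eq_Rintegral do rewrite min_norm_sqr//.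
have bi : bdm (\1_[set x : R | eps * t < `|x|] : R -> R).
  by apply: bdm_indic; exact: measurable_norm_gt.
rewrite expD; [|exact: bdmX (bdm_trunc _)|by apply: bdmM => //; exact: bdm_cst].
by rewrite expZ//; field; rewrite gt_eqF.
Qed.

Lemma Tq_ge0 (eps t : R) : 0 <= t -> 0 <= Tq kappa eps t w.
Proof. by move=> t0; rewrite mulr_ge0// fine_ge0. Qed.

Lemma Sigmaq_ge0 (eps t : R) : 0 <= t -> 0 <= Sigmaq kappa eps t w.
Proof. by move=> t0; rewrite mulr_ge0// ?invr_ge0//; apply: exp_ge0 => x; exact: sqr_ge0. Qed.

Lemma Rq_ge0 (eps t : R) : 0 <= t -> 0 <= Rq kappa eps t w.
Proof. by move=> t0; rewrite mulr_ge0// ?invr_ge0//; apply: exp_ge0 => x; exact: sqr_ge0. Qed.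

Lemma Vq_ge0 (eps t : R) : 0 <= t -> 0 <= Vq kappa eps t w.
Proof.
move=> t0; rewrite mulr_ge0// ?invr_ge0// subr_ge0.
exact: exp_sqr_le (bdm_trunc _).
Qed.

Lemma Vq_le (eps t : R) : 0 <= t -> Vq kappa eps t w <= Sigmaq kappa eps t w.
Proof. by move=> t0; rewrite ler_wpM2l ?invr_ge0// gerBl sqr_ge0. Qed.

(** For [|x| <= t] the minimum is at most [|x|], otherwise at most [eps * t]; each case uses one
    summand of the constant. Hence the scale [eps = 1] governs all the others. *)
Lemma Rq_scale (eps t : R) : 0 < eps -> 0 < t ->
  Rq kappa eps t w <= (1 + eps ^+ 2) * Rq kappa 1 t w.
Proof.
move=> e0 t0; rewrite /Rq mulrCA ler_pM2l ?invr_gt0// mul1r -expZ; last first.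
  exact: bdmX (bdm_min_norm _).
apply: exp_le; [exact: bdmX (bdm_min_norm _)|
  by apply: bdmM; [exact: bdm_cst|exact: bdmX (bdm_min_norm _)]|].
move=> x; have et : 0 < eps * t by rewrite mulr_gt0.
have x0 := normr_ge0 x.
have m0 : 0 <= Num.min `|x| (eps * t) by rewrite le_min x0 ltW.
have m1 : Num.min `|x| (eps * t) <= `|x| by rewrite ge_min lexx.
have m2 : Num.min `|x| (eps * t) <= eps * t by rewrite ge_min lexx orbT.
have [h|h] := leP `|x| t.
  apply: (@le_trans _ _ (`|x| ^+ 2)).
    by rewrite lerXn2r ?nnegrE.
  by rewrite mulrDl mul1r lerDl mulr_ge0 ?sqr_ge0.
apply: (@le_trans _ _ ((eps * t) ^+ 2)).
  by rewrite lerXn2r ?nnegrE// ltW.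
by rewrite exprMn ler_wpM2r ?sqr_ge0// lerDr.
Qed.

(** The truncated square increases with the level, and the prefactors differ by a ratio of at most
    [2]. This carries convergence along the integers over to real [t]. *)
Lemma Rq_dilate (t t' : R) : 0 < t -> t <= t' -> t' <= 2 * t ->
  Rq kappa 1 t w <= 2 * Rq kappa 1 t' w.
Proof.
move=> t0 tt' t2; have t'0 : 0 < t' by exact: lt_le_trans tt'.
rewrite /Rq !mul1r mulrA; apply: ler_pM.
- by rewrite invr_ge0 ltW.
- by apply: exp_ge0 => x; exact: sqr_ge0.
- by rewrite -[leRHS]invrK lef_pV2 ?posrE ?invr_gt0 ?divr_gt0// invfM invrK ler_pdivrMl.
- apply: exp_le; [exact: bdmX (bdm_min_norm _)|exact: bdmX (bdm_min_norm _)|] => x.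
  have m0 s : 0 < s -> 0 <= Num.min `|x| s by move=> s0; rewrite le_min normr_ge0 ltW.
  have m1 : Num.min `|x| t <= Num.min `|x| t'.
    by rewrite le_min !ge_min lexx tt' orbT.
  by rewrite lerXn2r ?nnegrE ?m0.
Qed.

(** With [m = E h], the inequality [m ^ 2 <= 2 (h - m) ^ 2 + 2 h ^ 2] is integrated over [A], where
    [h ^ 2 <= L ^ 2]. As [A] has mass at least [1/2], this gives [m ^ 2 <= 4 Var + 4 L ^ 2]; adding
    the variance produces the [5]. *)
Lemma mass_bound (h : R -> R) (K L : R) : bdm h ->
  2^-1 <= fine (kappa w [set x | `|x| <= K]) ->
  (forall x, `|x| <= K -> `|h x| <= L) ->
  E (fun x => h x ^+ 2) <= 5 * (E (fun x => h x ^+ 2) - E h ^+ 2) + 4 * L ^+ 2.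
Proof.
move=> bh hK hL; set m := E h; pose A := [set x : R | `|x| <= K].
have mA : measurable A by exact: measurable_norm_le.
have bA : bdm (\1_A : R -> R) by exact: bdm_indic.
have b2 := bdmX 2 bh.
have {}hK : 2^-1 <= E \1_A by rewrite -lee_fin exp_indic// -[leRHS]fineK// fin_num_measure.
have bm c : bdm (fun _ : R => c) by exact: bdm_cst.
have bmm : bdm (fun x => 2 * m * h x) by exact: bdmM.
have : m ^+ 2 * E \1_A <= E (fun x => 2 * (h x ^+ 2 - (2 * m * h x - m ^+ 2)) + 2 * L ^+ 2).
  rewrite -expZ//; apply: exp_le.
  - exact: bdmM.
  - by apply: bdmD => //; apply: bdmM => //; apply: bdmB => //; exact: bdmB.
  - move=> x; have e : h x ^+ 2 - (2 * m * h x - m ^+ 2) = (h x - m) ^+ 2 by ring.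
    rewrite e indicE; have [xA|_] := boolP (x \in A); last first.
      by rewrite mulr0 addr_ge0// mulr_ge0// sqr_ge0.
    have hx : h x ^+ 2 <= L ^+ 2.
      rewrite -real_normK ?num_real// lerXn2r ?nnegrE ?(le_trans _ (hL x _))//;
        exact: set_mem xA.
    rewrite mulr1; have := sqr_ge0 (2 * h x - m).
    have -> : (2 * h x - m) ^+ 2 = 2 * (h x - m) ^+ 2 + 2 * h x ^+ 2 - m ^+ 2 by ring.
    lra.
rewrite expD//; last by apply: bdmM => //; apply: bdmB => //; exact: bdmB.
rewrite expZ; last by apply: bdmB => //; exact: bdmB.
rewrite expB//; last exact: bdmB.
have e1 : E (fun x => 2 * m * h x) = 2 * m * m by rewrite expZ.
rewrite expB// !exp_cst e1 => key.
have : m ^+ 2 * 2^-1 <= m ^+ 2 * E \1_A by rewrite ler_wpM2l// sqr_ge0.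
move: key; set s := E (fun x => _ ^+ 2); lra.
Qed.

Lemma Sigmaq_le_Vq (eps t K : R) : 0 < t ->
  2^-1 <= fine (kappa w [set x | `|x| <= K]) ->
  Sigmaq kappa eps t w <= 5 * Vq kappa eps t w + 4 * K ^+ 2 / t.
Proof.
move=> t0 hK.
have h : forall x, `|x| <= K -> `|trunc (eps * t) x| <= K.
  move=> x xK; rewrite /trunc; case: ifP => // _.
  by rewrite normr0 (le_trans _ xK).
have := mass_bound (bdm_trunc (eps * t)) hK h.
rewrite /Sigmaq /Vq => hh.
rewrite mulrCA mulrC [X in _ + X]mulrC -mulrDr [leLHS]mulrC.
by rewrite ler_wpM2l// invr_ge0 ltW.
Qed.

Local Notation p v := (E (fun y => cos (v * y))).
Local Notation q v := (E (fun y => sin (v * y))).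

Lemma charfun_le1 (v : R) : p v ^+ 2 + q v ^+ 2 <= 1.
Proof.
rewrite (le_trans (lerD (exp_sqr_le _ (bdm_cosM v)) (exp_sqr_le _ (bdm_sinM v))))//.
rewrite -expD; [|exact: bdmX (bdm_cosM v)|exact: bdmX (bdm_sinM v)].
by under eq_Rintegral do rewrite cos2Dsin2; rewrite exp_cst.
Qed.

Lemma charfun_norm_le1 (v : R) : charfun_norm kappa v w <= 1.
Proof. by rewrite -sqrtr1 ler_wsqrtr// charfun_le1. Qed.

Lemma charfun_norm_sqr (v : R) : charfun_norm kappa v w ^+ 2 = p v ^+ 2 + q v ^+ 2.
Proof. by rewrite sqr_sqrtr// addr_ge0// sqr_ge0. Qed.

(* [|1 - e^{ivx}|^2 = 2 (1 - cos (v x))] has variance [1 - |phi v|^2], so the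
   phase of [phi v] is controlled by the mass near the origin. *)
Lemma one_sub_cos_charfun (v K : R) :
  2^-1 <= fine (kappa w [set x | `|x| <= K]) ->
  2 * (1 - p v) <= 5 * (1 - charfun_norm kappa v w ^+ 2) + 8 * (v * K) ^+ 2.
Proof.
move=> hK; rewrite charfun_norm_sqr.
have bc := bdm_cosM v; have bs := bdm_sinM v; have b1 : bdm (fun _ : R => 1 : R) by exact: bdm_cst.
have bh : bdm (fun x : R => 1 - cos (v * x)) by exact: bdmB.
have c1 (z : R) : (1 - cos z) ^+ 2 <= z ^+ 2.
  have h1 : 0 <= 1 - cos z <= 2 by have := cos_le1 z; have := cos_geN1 z; lra.
  apply: (@le_trans _ _ (2 * (1 - cos z))); last by have := one_sub_cos_le z; lra.
  by case/andP: h1 => h1 h2; rewrite expr2 ler_wpM2r.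
have s1 (z : R) : sin z ^+ 2 <= z ^+ 2.
  have h1 : 0 <= 1 - cos z by have := cos_le1 z; lra.
  apply: (@le_trans _ _ (2 * (1 - cos z))); last by have := one_sub_cos_le z; lra.
  rewrite sin2cos2 (_ : 1 - cos z ^+ 2 = (1 + cos z) * (1 - cos z)); last by ring.
  by rewrite ler_wpM2r//; have := cos_le1 z; lra.
have hb (z x : R) : z ^+ 2 <= (v * x) ^+ 2 -> `|x| <= K -> `|z| <= `|v| * K.
  move=> h xK; apply: (@le_trans _ _ `|v * x|).
    by rewrite -ler_sqr ?nnegrE// !real_normK ?num_real.
  by rewrite normrM ler_wpM2l.
(* The real and imaginary parts [1 - cos] and [sin] are treated separately, both with [L = |v| * K];
   adding the two bounds turns [4] into [8]. *)
have := mass_bound bh hK (fun x => hb _ _ (c1 (v * x))).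
have := mass_bound bs hK (fun x => hb _ _ (s1 (v * x))).
rewrite expB// exp_cst.
have e2 : E (fun x => (1 - cos (v * x)) ^+ 2) = 1 - 2 * p v + E (fun x => cos (v * x) ^+ 2).
  transitivity (E (fun x => (1 - 2 * cos (v * x)) + cos (v * x) ^+ 2)).
    by apply: eq_Rintegral => x _; ring.
  have b2 : bdm (fun x : R => 2 * cos (v * x)) by apply: bdmM => //; exact: bdm_cst.
  rewrite expD; [|exact: bdmB|exact: bdmX].
  by rewrite expB// exp_cst expZ.
have e3 : E (fun x => cos (v * x) ^+ 2) + E (fun x => sin (v * x) ^+ 2) = 1.
  rewrite -expD; [|exact: bdmX|exact: bdmX].
  by under eq_Rintegral do rewrite cos2Dsin2; rewrite exp_cst.
rewrite e2 !exprMn real_normK ?num_real//.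
have : p v ^+ 2 = p v * p v by rewrite expr2.
have -> : (1 - p v) ^+ 2 = 1 - 2 * p v + p v ^+ 2 by ring.
move: e3; set s2 := E (fun x => sin _ ^+ 2); set c2 := E (fun x => cos _ ^+ 2).
lra.
Qed.

(** For [|x| <= t] use [1 - cos z <= z ^ 2 / 2], beyond it [1 - cos z <= 2]. This crude bound serves
    the frequencies at which [|phi| ^ N < 1/2]. *)
Lemma one_sub_cos_Rq (u t : R) : 0 <= u <= 1 -> 0 < t ->
  t * (1 - p (u / t)) <= 2 * Rq kappa 1 t w.
Proof.
move=> /andP[u0 u1] t0.
have b1 : bdm (fun _ : R => 1 : R) by exact: bdm_cst.
have bm : bdm (fun x : R => Num.min `|x| t ^+ 2) by exact: bdmX (bdm_min_norm _).
have -> : 1 - p (u / t) = E (fun x => 1 - cos (u / t * x)).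
  by rewrite expB// ?exp_cst//; exact: bdm_cosM.
rewrite /Rq mul1r (_ : 2 * _ = t * E (fun x => 2 / t ^+ 2 * Num.min `|x| t ^+ 2)); last first.
  by rewrite expZ//; field; rewrite gt_eqF.
rewrite ler_pM2l//; apply: exp_le.
- by apply: bdmB => //; exact: bdm_cosM.
- by apply: bdmM => //; exact: bdm_cst.
- move=> x; have [h|h] := leP `|x| t.
    rewrite (le_trans (one_sub_cos_le _))// real_normK ?num_real//.
    rewrite (_ : 2^-1 * (u / t * x) ^+ 2 = 2^-1 * u ^+ 2 * (x ^+ 2 / t ^+ 2)); last first.
      by field; rewrite gt_eqF.
    rewrite (_ : 2 / t ^+ 2 * x ^+ 2 = 2 * (x ^+ 2 / t ^+ 2)); last by ring.
    rewrite ler_wpM2r//; first by rewrite divr_ge0// sqr_ge0.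
    have : u ^+ 2 <= 1 by rewrite expr_le1.
    lra.
  rewrite mulfVK ?expf_neq0 ?gt_eqF//.
  by have := cos_geN1 (u / t * x); lra.
Qed.

End FixedLaw.

(** * Tonelli identities and the characteristic function gap of a fixed law *)

Section FixedLawFubini.
Context d (Omega : measurableType d) (R : realType)
  (kappa : Omega -> probability R R) (w : Omega).
Local Notation E f := (\int[kappa w]_(x in setT) f x).
Local Notation mu := (@lebesgue_measure R).

Lemma swap_integral (D : set R) (f : R -> R -> R) : measurable D ->
  measurable_fun setT (fun p : R * R => \1_D p.1 * f p.1 p.2) ->
  (forall t x, D t -> 0 <= f t x) ->
  (\int[mu]_(t in D) \int[kappa w]_x (f t x)%:E =
   \int[kappa w]_x \int[mu]_(t in D) (f t x)%:E)%E.
Proof.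
move=> mD mf f0.
pose F (p : R * R) := (\1_D p.1 * f p.1 p.2)%:E.
have F0 p : (0 <= F p)%E.
  rewrite lee_fin indicE; have [pD|_] := boolP (p.1 \in D); last by rewrite mul0r.
  by rewrite mul1r f0//; exact: set_mem pD.
have mF : measurable_fun setT F by exact/measurable_EFinP.
have := @fubini_tonelli _ _ _ _ _ mu (kappa w) F mF F0.
rewrite /F/= => h.
transitivity (\int[mu]_t \int[kappa w]_x (\1_D t * f t x)%:E)%E.
  rewrite integral_mkcond; apply: eq_integral => t _; rewrite patchE indicE.
  case: ifP => _; first by under [RHS]eq_integral do rewrite mul1r.
  by under [RHS]eq_integral do rewrite mul0r; rewrite integral0.
rewrite h; apply: eq_integral => x _.
rewrite [RHS]integral_mkcond; apply: eq_integral => t _; rewrite patchE indicE.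
by case: ifP => _; rewrite ?mul1r ?mul0r.
Qed.

Lemma measurable_trunc_pair (eps : R) :
  measurable_fun setT (fun p : R * R => trunc (eps * p.1) p.2).
Proof.
have m1 : measurable_fun setT (fun p : R * R => eps * p.1).
  by apply: measurable_funM => //; exact: measurable_fst.
have m2 : measurable_fun setT (fun p : R * R => p.2) by exact: measurable_snd.
apply: measurable_fun_ifT => //.
by apply: measurable_fun_ler => //; exact: measurableT_comp.
Qed.

Lemma measurable_invr : measurable_fun setT (fun t : R => t^-1).
Proof.
have mE : measurable [set 0 : R] by exact: measurable_set1.
rewrite -(setUv [set 0 : R]); apply/measurable_funU; [by []|exact: measurableC|split].
  exact: measurable_fun_set1.
apply: open_continuous_measurable_fun.
  exact: closed_openC.
move=> x; rewrite inE /= => /eqP x0; exact: inv_continuous.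
Qed.

Lemma tailSigma_Rq (eps M : R) : 0 < eps -> 0 < M ->
  (\int[mu]_(t in `[M, +oo[) (Sigmaq kappa eps t w / t ^+ 2)%:E =
   (2^-1 * M^-1 * Rq kappa eps M w)%:E)%E.
Proof.
move=> e0 M0.
have tM t : [set` `[M, +oo[] t -> 0 < t.
  by rewrite /= in_itv/= andbT; exact: lt_le_trans.
transitivity (\int[mu]_(t in `[M, +oo[)
    \int[kappa w]_x (t^-1 ^+ 3 * trunc (eps * t) x ^+ 2)%:E)%E.
  apply: eq_integral => t; rewrite inE => /tM t0.
  rewrite expE; last by apply: bdmM; [exact: bdm_cst|exact: bdmX (bdm_trunc _)].
  rewrite expZ; last exact: bdmX (bdm_trunc _).
  by rewrite /Sigmaq; congr EFin; field; rewrite gt_eqF.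
rewrite swap_integral//; last 2 first.
- apply: measurable_funM.
    by apply: (measurableT_comp _ (@measurable_fst _ _ R R)); exact: measurable_indic.
  apply: measurable_funM.
    apply: measurable_funX; apply: (measurableT_comp _ (@measurable_fst _ _ R R)).
    exact: measurable_invr.
  by apply: measurable_funX; exact: measurable_trunc_pair.
- by move=> t x /tM t0; rewrite mulr_ge0 ?sqr_ge0// exprn_ge0// invr_ge0 ltW.
transitivity (\int[kappa w]_x (2^-1 * M^-1 ^+ 2 * Num.min `|x| (eps * M) ^+ 2)%:E)%E.
  apply: eq_integral => x _.
  (* For fixed [x] the truncation keeps only the times [t >= |x| / eps]. The integral of
     [x ^ 2 / t ^ 3] from [a] on is [x ^ 2 / (2 a ^ 2)], which is the truncated square divided by
     [2 M ^ 2]. *)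
  pose a := Num.max M (`|x| / eps).
  have aM : M <= a by rewrite le_max lexx.
  have a0 : 0 < a by exact: lt_le_trans aM.
  transitivity (\int[mu]_(t in `[a, +oo[) ((x ^+ 2)%:E * (t^-1 ^+ 3)%:E))%E.
    rewrite [LHS]integral_mkcond [RHS]integral_mkcond; apply: eq_integral => t _.
    rewrite !patchE !mem_setE /= !in_itv/= !andbT /a ge_max /trunc ler_pdivrMr//.
    case: leP => //= Mt; rewrite (mulrC t); case: ifP => _.
      by rewrite -EFinM mulrC.
    by rewrite expr0n mulr0.
  rewrite ge0_integralZl//; last 3 first.
  - apply/measurable_EFinP; apply: measurable_funX; apply: measurable_funTS.
    exact: measurable_invr.
  - by move=> t /=; rewrite in_itv/= andbT => at0; rewrite lee_fin exprn_ge0// invr_ge0 (le_trans (ltW a0)).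
  - by rewrite lee_fin sqr_ge0.
  rewrite integral_inv_cube// -EFinM; congr EFin.
  rewrite -real_normK ?num_real// /a.
  have [h|h] := leP `|x| (eps * M).
    by rewrite max_l ?ler_pdivrMr 1?mulrC//; ring.
  rewrite max_r; last by rewrite ler_pdivlMr// mulrC ltW.
  have x0 : 0 < `|x| by rewrite (lt_trans _ h)// mulr_gt0.
  by field; rewrite !gt_eqF.
have bm : bdm (fun x : R => Num.min `|x| (eps * M) ^+ 2) by exact: bdmX (bdm_min_norm _).
rewrite expE; last by apply: bdmM => //; exact: bdm_cst.
by rewrite expZ// /Rq; congr EFin; field; rewrite gt_eqF.
Qed.

Lemma tailSigmaE (eps M : R) : 0 < eps -> 0 < M ->
  tailSigma kappa eps M w = 2^-1 * Rq kappa eps M w.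
Proof.
move=> e0 M0; rewrite /tailSigma /Rintegral tailSigma_Rq//=.
by field; rewrite gt_eqF.
Qed.

Lemma avgTE (eps M : R) : 0 < eps -> 0 < M ->
  avgT kappa eps M w = (2 * eps ^+ 2)^-1 * Rq kappa eps M w.
Proof.
move=> e0 M0.
have bi (c : R) : bdm (\1_[set x : R | c < `|x|] : R -> R).
  by apply: bdm_indic; exact: measurable_norm_gt.
suff h : (\int[mu]_(t in `[0%R, M]) (Tq kappa eps t w)%:E =
   (2^-1 * eps ^- 2 * M * Rq kappa eps M w)%:E)%E.
  by rewrite /avgT /Rintegral h/=; field; rewrite !gt_eqF.
transitivity (\int[mu]_(t in `[0%R, M])
    \int[kappa w]_x (t * \1_[set x : R | eps * t < `|x|] x)%:E)%E.
  apply: eq_integral => t _; rewrite Tq_exp expE ?expZ//.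
  by apply: bdmM => //; exact: bdm_cst.
rewrite swap_integral//; last 2 first.
- apply: measurable_funM.
    by apply: (measurableT_comp _ (@measurable_fst _ _ R R)); exact: measurable_indic.
  apply: measurable_funM; first exact: measurable_fst.
  have m1 : measurable_fun setT (fun p : R * R => eps * p.1).
    by apply: measurable_funM => //; exact: measurable_fst.
  have mA : measurable [set p : R * R | eps * p.1 < `|p.2|].
    by apply: measurable_ltr => //; apply: measurableT_comp => //; exact: measurable_snd.
  rewrite (_ : (fun p => _) = \1_[set p : R * R | eps * p.1 < `|p.2|]).
    exact: measurable_indic.
  by apply/funext => p; rewrite !indicE; congr (nat_of_bool _)%:R; apply/idP/idP; rewrite !inE.
- by move=> t x /=; rewrite in_itv/= => /andP[t0 _]; rewrite mulr_ge0// indicE.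
transitivity (\int[kappa w]_x (2^-1 * eps ^- 2 * Num.min `|x| (eps * M) ^+ 2)%:E)%E.
  apply: eq_integral => x _.
  have [h|h] := leP `|x| (eps * M).
    (* The strict inequality [eps * t < |x|] cuts the range at [a], endpoint excluded; the endpoint
       does not affect the integral. *)
    pose a := `|x| / eps.
    have a0 : 0 <= a by rewrite divr_ge0// ltW.
    have aM : a <= M by rewrite ler_pdivrMr// mulrC.
    transitivity (\int[mu]_(t in `[0%R, a[) t%:E)%E.
      rewrite [LHS]integral_mkcond [RHS]integral_mkcond; apply: eq_integral => t _.
      have e1 : \1_[set x : R | eps * t < `|x|] x = ((eps * t < `|x|)%R : bool)%:R :> R.
        by rewrite indicE; congr (nat_of_bool _)%:R; apply/idP/idP; rewrite !inE.
      rewrite !patchE !mem_setE e1 !in_itv/= /a ltr_pdivlMr// (mulrC t eps).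
      case: (leP 0 t) => //= t0; case: (ltP (eps * t) `|x|) => tx /=.
        by rewrite mulr1 ifT// (le_trans _ aM)// /a ler_pdivlMr// mulrC ltW.
      by rewrite mulr0; case: ifP.
    rewrite integral_itv_bndo_bndc; last exact/measurable_EFinP.
    by rewrite integral_id_itv// /a; congr EFin; field; rewrite gt_eqF.
  transitivity (\int[mu]_(t in `[0%R, M]) t%:E)%E.
    apply: eq_integral => t; rewrite inE/= in_itv/= => /andP[t0 tM].
    by rewrite indicE mem_set ?mulr1//= (le_lt_trans _ h)// ler_pM2l.
  by rewrite integral_id_itv ?ltW//; congr EFin; field; rewrite gt_eqF.
have bm : bdm (fun x : R => Num.min `|x| (eps * M) ^+ 2) by exact: bdmX (bdm_min_norm _).
rewrite expE; last by apply: bdmM => //; exact: bdm_cst.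
by rewrite expZ// /Rq; congr EFin; field; rewrite !gt_eqF.
Qed.

Local Notation p v := (E (fun y => cos (v * y))).

Lemma integral_charfun_ge (t : R) : 0 < t ->
  ((8^-1 * Rq kappa 1 t w)%:E <= \int[mu]_(u in `[0%R, 1%R]) (t * (1 - p (u / t)))%:E)%E.
Proof.
move=> t0.
have b1 : bdm (fun _ : R => 1 : R) by exact: bdm_cst.
have bm : bdm (fun x : R => Num.min `|x| t ^+ 2) by exact: bdmX (bdm_min_norm _).
have -> : (\int[mu]_(u in `[0%R, 1%R]) (t * (1 - p (u / t)))%:E =
    \int[mu]_(u in `[0%R, 1%R]) \int[kappa w]_x (t * (1 - cos (u / t * x)))%:E)%E.
  have bc v : bdm (fun x : R => 1 - cos (v * x)) by apply: bdmB => //; exact: bdm_cosM.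
  apply: eq_integral => u _; rewrite expE; last by apply: bdmM => //; exact: bdm_cst.
  by rewrite expZ// expB ?exp_cst//; exact: bdm_cosM.
have mcos : measurable_fun setT (fun q : R * R => t * (1 - cos (q.1 / t * q.2))).
  apply: measurable_funM => //; apply: measurable_funB => //.
  apply: (measurableT_comp (bdm_cos (@measurable_id _ R setT)).1).
  apply: measurable_funM; last exact: measurable_snd.
  by apply: measurable_funM => //; exact: measurable_fst.
rewrite swap_integral//; last 2 first.
- apply: measurable_funM => //.
  by apply: (measurableT_comp _ (@measurable_fst _ _ R R)); exact: measurable_indic.
- by move=> u x _; rewrite mulr_ge0 ?subr_ge0 ?cos_le1// ltW.
have -> : (8^-1 * Rq kappa 1 t w)%:E =
    (\int[kappa w]_x (8^-1 * t^-1 * Num.min `|x| t ^+ 2)%:E)%E.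
  rewrite expE; last by apply: bdmM => //; exact: bdm_cst.
  by rewrite expZ// /Rq mul1r mulrA.
apply: ge0_le_integral => //.
- by move=> x _; rewrite lee_fin mulr_ge0 ?sqr_ge0// mulr_ge0// invr_ge0 ltW.
- by apply/measurable_EFinP; apply: measurable_funM => //; case: bm.
- pose F (q : R * R) := (\1_(`[0%R, 1%R]%classic : set R) q.1 * (t * (1 - cos (q.1 / t * q.2))))%:E.
  have mF : measurable_fun setT F.
    apply/measurable_EFinP; apply: measurable_funM => //.
    by apply: (measurableT_comp _ (@measurable_fst _ _ R R)); exact: measurable_indic.
  have F0 q : (0 <= F q)%E.
    rewrite lee_fin mulr_ge0 ?indicE// mulr_ge0 ?subr_ge0 ?cos_le1// ltW//.
  have := @measurable_fun_fubini_tonelli_G _ _ _ _ _ mu F mF F0.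
  rewrite (_ : fubini_G mu F = fun x => (\int[mu]_(u in `[0%R, 1%R]) (t * (1 - cos (u / t * x)))%:E)%E)//.
  apply/funext => x; rewrite /fubini_G /F [RHS]integral_mkcond.
  by apply: eq_integral => u _; rewrite /= patchE indicE; case: ifP => _; rewrite ?mul1r ?mul0r.
- move=> x _.
  have -> : (\int[mu]_(u in `[0%R, 1%R]) (t * (1 - cos (u / t * x)))%:E =
      t%:E * \int[mu]_(u in `[0%R, 1%R]) (1 - cos (u * (x / t)))%:E)%E.
    rewrite -ge0_integralZl//; first 1 last.
    - apply/measurable_EFinP; apply: measurable_funTS; apply: measurable_funB => //.
      by apply: (bdm_cos _).1; exact: measurable_funM.
    - by rewrite lee_fin ltW.
    by apply: eq_integral => u _; rewrite -EFinM mulrAC mulrA.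
  apply: (@le_trans _ _ (t%:E * (8^-1 * Num.min `|x / t| 1 ^+ 2)%:E)%E); last first.
    by rewrite lee_pmul2l// integral_one_sub_cos.
  rewrite -EFinM lee_fin normrM normfV (gtr0_norm t0) le_eqVlt; apply/orP; left; apply/eqP.
  have [h|h] := leP `|x| t.
    by rewrite min_l ?ler_pdivrMr ?mul1r//; field; rewrite gt_eqF.
  by rewrite min_r ?ler_pdivlMr ?mul1r 1?ltW//; field; rewrite gt_eqF.
Qed.

(** The intermediary of necessity: its mean is bounded by deviation probabilities, and at a fixed
    [w] it bounds [Rq]. *)
Definition charfun_gap (N : nat) : \bar R :=
  (\int[mu]_(u in `[0%R, 1%R]) (1 - charfun_norm kappa (u / N%:R) w ^+ N)%:E)%E.

(** [1 - r ^ N] is [1 - r] times a sum of [N] powers of [r], each at least [r ^ N >= 1/2]. *)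
Lemma expr_gap_ge (r : R) (N : nat) : 0 <= r <= 1 -> 2^-1 <= r ^+ N ->
  N%:R * (1 - r) <= 2 * (1 - r ^+ N).
Proof.
move=> /andP[r0 r1]; elim: N => [|N ih]; first by rewrite mul0r expr0 subrr mulr0.
rewrite exprS => h.
have rN : r ^+ N <= 1 by rewrite exprn_ile1.
have hN : 2^-1 <= r ^+ N.
  by rewrite (le_trans h)// ler_piMl// exprn_ge0.
have := ih hN; rewrite -(natr1 N) mulrDl mul1r.
have : (1 - r) * 2^-1 <= (1 - r) * r ^+ N by rewrite ler_wpM2l// subr_ge0.
lra.
Qed.

(** If [r ^ N >= 1/2], phase control and [expr_gap_ge] give [2 N (1 - p) <= 20 (1 - r ^ N) + 8 K ^ 2
    / N], whence [10] and [4]. Otherwise the gap exceeds [1/2], and the crude bound [2 Rq] is at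
    most [4 Rq] times the gap. *)
Lemma charfun_pointwise (u K : R) (N : nat) : (0 < N)%N -> 0 <= u <= 1 ->
  2^-1 <= fine (kappa w [set x | `|x| <= K]) ->
  N%:R * (1 - p (u / N%:R)) <=
  (4 * Rq kappa 1 N%:R w + 10) * (1 - charfun_norm kappa (u / N%:R) w ^+ N) + 4 * K ^+ 2 / N%:R.
Proof.
move=> N0 u01 hK; have NR : 0 < N%:R :> R by rewrite ltr0n.
set r := charfun_norm _ _ _.
have r0 : 0 <= r by exact: sqrtr_ge0.
have r1 : r <= 1 by exact: charfun_norm_le1.
have rN : r ^+ N <= 1 by rewrite exprn_ile1.
have Rq0 : 0 <= Rq kappa 1 N%:R w by rewrite Rq_ge0// ltW.
have KN : 0 <= 4 * K ^+ 2 / N%:R.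
  by apply: divr_ge0; [apply: mulr_ge0 => //; exact: sqr_ge0 | exact: ltW].
have [h|h] := leP 2^-1 (r ^+ N).
  have g := expr_gap_ge (introT andP (conj r0 r1)) h.
  have := one_sub_cos_charfun (u / N%:R) hK; rewrite -/r => c.
  have c' : N%:R * (2 * (1 - p (u / N%:R))) <= N%:R * (5 * (1 - r ^+ 2) + 8 * (u / N%:R * K) ^+ 2).
    by rewrite ler_wpM2l// ltW.
  have r2 : N%:R * (1 - r ^+ 2) <= 2 * (N%:R * (1 - r)).
    rewrite (_ : 1 - r ^+ 2 = (1 + r) * (1 - r)); last by ring.
    rewrite mulrCA ler_wpM2r//; last by lra.
    by rewrite mulr_ge0 ?subr_ge0// ltW.
  have uK : N%:R * (8 * (u / N%:R * K) ^+ 2) <= 8 * K ^+ 2 / N%:R.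
    have -> : N%:R * (8 * (u / N%:R * K) ^+ 2) = u ^+ 2 * (8 * K ^+ 2 / N%:R).
      by field; rewrite gt_eqF.
    rewrite ler_piMl//; first by rewrite (_ : _ / _ = 2 * (4 * K ^+ 2 / N%:R)); [rewrite mulr_ge0|ring].
    by case/andP: u01 => u0 u1; rewrite expr_le1.
  have q0 : 0 <= 4 * Rq kappa 1 N%:R w * (1 - r ^+ N).
    by apply: mulr_ge0; [exact: mulr_ge0 | rewrite subr_ge0].
  have e8 : 8 * K ^+ 2 / N%:R = 2 * (4 * K ^+ 2 / N%:R) by ring.
  have c2 : 2 * (N%:R * (1 - p (u / N%:R))) <=
      5 * (N%:R * (1 - r ^+ 2)) + N%:R * (8 * (u / N%:R * K) ^+ 2).
    by rewrite mulrCA (le_trans c')// mulrDr lerD2r mulrCA.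
  rewrite mulrDl; rewrite e8 in uK; move: KN q0 uK r2 c2 g.
  set A := 4 * K ^+ 2 / N%:R; set B := 4 * Rq _ _ _ _ * _.
  set C := N%:R * (8 * _); set D := N%:R * (1 - r ^+ 2); set F := N%:R * (1 - r).
  set G := N%:R * _; set H := 1 - r ^+ N; lra.
have := one_sub_cos_Rq kappa w u01 NR => c.
have : 2 * Rq kappa 1 N%:R w <= 4 * Rq kappa 1 N%:R w * (1 - r ^+ N).
  have : 0 <= Rq kappa 1 N%:R w * (2^-1 - r ^+ N) by rewrite mulr_ge0// subr_ge0 ltW.
  lra.
rewrite mulrDl; have : 0 <= 10 * (1 - r ^+ N) by rewrite mulr_ge0// subr_ge0.
lra.
Qed.

End FixedLawFubini.

(** * Convergence in probability *)

Section ConvergenceInProbability.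
Context d (Omega : measurableType d) (R : realType) (P : probability Omega R).

Lemma cvge0P (I : Type) (F : set_system I) (FF : Filter F) (p : I -> \bar R) :
  (forall i, (0 <= p i)%E) ->
  (p @ F --> (0 : \bar R)%E) <->
  (forall e : R, 0 < e -> \forall i \near F, (p i <= e%:E)%E).
Proof.
move=> p0; split=> [cp e e0|h].
  have /fine_cvgP[fin /cvgr0Pnorm_le/(_ _ e0) le] := cp.
  near=> i; have fi : p i \is a fin_num by near: i.
  rewrite -(fineK fi) lee_fin (le_trans (ler_norm _))//.
  by near: i.
have fin : \forall i \near F, p i \is a fin_num.
  apply: filterS (h 1 ltr01) => i pi.
  by rewrite ge0_fin_numE// (le_lt_trans pi)// ltry.
apply/fine_cvgP; split => //.
apply/cvgr0Pnorm_le => e e0; near=> i.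
have fi : p i \is a fin_num by near: i.
rewrite /= ger0_norm ?fine_ge0// -lee_fin fineK//.
by near: i; exact: h.
Unshelve. all: by end_near.
Qed.

Lemma cvg0_in_probP (I : Type) (F : set_system I) (FF : Filter F)
    (X : I -> Omega -> R) :
  cvg0_in_prob P F X <-> forall eta e : R, 0 < eta -> 0 < e ->
    \forall i \near F, (P [set w | (eta < `|X i w|)%R] <= e%:E)%E.
Proof.
split=> [h eta e eta0 e0|h eta eta0]; first by apply/cvge0P : e e0; [|exact: h].
by apply/cvge0P => // e e0; exact: h.
Qed.

Lemma measurable_norm_ltr (X : Omega -> R) (c : R) : measurable_fun setT X ->
  measurable [set w | c < `|X w|].
Proof. by move=> mX; apply: measurable_ltr => //; exact: measurableT_comp. Qed.

Lemma prob_setU_le (A B C : set Omega) (a b : R) :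
  measurable A -> measurable B -> measurable C -> C `<=` A `|` B ->
  (P A <= a%:E)%E -> (P B <= b%:E)%E -> (P C <= (a + b)%:E)%E.
Proof.
move=> mA mB mC CAB Aa Bb.
have mAB : measurable (A `|` B) by exact: measurableU.
apply: (@le_trans _ _ (P (A `|` B))); first by apply: le_measure; rewrite ?inE.
rewrite (le_trans (measureU2 _ _ _))// EFinD; exact: leeD.
Qed.

End ConvergenceInProbability.

(** * Tightness of the conditional laws and transfer of pointwise bounds *)

Section Mass.
Context d (Omega : measurableType d) (R : realType) (P : probability Omega R).
Context (g : nat -> Omega -> R).
Hypotheses (mg : forall n, measurable_fun setT (g n)) (exg : exchangeable P g).
Context (kappa : Omega -> probability R R).
Hypothesis rcd : is_rcd P (tail_sigma g) (g 0%N) kappa.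

Local Notation E f := (\int[P]_(w in setT) f w).
Local Notation K h := (fun w => \int[kappa w]_(y in setT) h y).
Local Notation T := (g_sigma_algebraType (tail_sigma g)).

Lemma massE (A : set R) w : measurable A -> fine (kappa w A) = K \1_A w.
Proof. by move=> mA; rewrite -exp_indic. Qed.

Lemma measurable_mass (c : R) :
  measurable_fun setT (fun w => fine (kappa w [set x | `|x| <= c])).
Proof.
have mA := measurable_norm_le c.
under eq_fun do rewrite massE//.
by have [] := bdm_cond mg rcd (bdm_indic R mA).
Qed.

(** The mean of [kappa w] of the set [c < |x|] is [P (c < |g 0|)], at most [e / 2] for large [c];
    Markov at level [1/2] costs a factor [2]. *)
Lemma mass_tight (e : R) : 0 < e -> exists c : R, 0 < c /\
  (P [set w | (fine (kappa w [set x | `|x| <= c]) < 2^-1)%R] <= e%:E)%E.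
Proof.
move=> e0.
pose B n := [set w | n%:R < `|g 0%N w|].
have mB n : measurable (B n) by exact: measurable_norm_ltr.
have cB : P (B n) @[n --> \oo] --> P (\bigcap_n B n).
  apply: nonincreasing_cvg_mu => //.
  - by rewrite (le_lt_trans (probability_le1 _ _))// ltry.
  - exact: bigcap_measurableType.
  - move=> m n mn; apply/subsetPset => w; rewrite /B /=; apply: le_lt_trans.
    by rewrite ler_nat.
have B0 : \bigcap_n B n = set0.
  apply/seteqP; split=> // w h.
  have := h (Num.bound `|g 0%N w|) I; rewrite /B /= ltNge => /negP; apply.
  exact/ltW/Num.Theory.archi_boundP.
rewrite B0 measure0 in cB.
have := (@cvge0P R nat \oo _ _ (fun n => measure_ge0 P (B n))).1 cB (e / 2)
  (divr_gt0 e0 (ltr0Sn _ 1)).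
move=> [n _ hn].
have {}hn := hn n.+1 (leqnSn n).
pose c : R := n.+1%:R; exists c; split; first by rewrite ltr0n.
have bi : bdm (\1_[set x : R | c < `|x|] : R -> R).
  by apply: bdm_indic; exact: measurable_norm_gt.
have bic : bdm (\1_[set x : R | `|x| <= c] : R -> R).
  by apply: bdm_indic; exact: measurable_norm_le.
have bK := bdm_cond mg rcd bi.
have h1 w : K (\1_[set x : R | c < `|x|]) w = 1 - K (\1_[set x : R | `|x| <= c]) w.
  rewrite -(exp_cst (kappa w) 1) -expB//; last exact: bdm_cst.
  apply: eq_Rintegral => x _; rewrite !indicE.
  have [h|h] := leP `|x| c.
    by rewrite memNset ?mem_set ?subrr//=; apply/negP; rewrite -leNgt.
  by rewrite mem_set// memNset ?subr0//=; apply/negP; rewrite -ltNge.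
have h2 : E (K (\1_[set x : R | c < `|x|])) <= e / 2.
  have := exp_tail mg exg rcd 0 (@bdm_cst _ T R 1) bi.
  under eq_Rintegral do rewrite mul1r.
  under [X in _ = X -> _]eq_Rintegral do rewrite mul1r.
  move=> <-; rewrite -lee_fin; apply: le_trans hn; rewrite le_eqVlt; apply/orP; left.
  by apply/eqP; exact: (exp_indic P (mB n.+1)).
apply: (@le_trans _ _ (P [set w | (2^-1 <= K (\1_[set x : R | c < `|x|]) w)%R])).
  apply: le_measure; rewrite ?inE.
  - by apply: measurable_ltr => //; exact: measurable_mass.
  - by apply: measurable_ler => //; case: bK.
  - move=> w /=; rewrite massE ?h1; last exact: measurable_norm_le.
    lra.
rewrite (le_trans (markov _ bK _ _))// ?invr_gt0//.
  by move=> w; apply: exp_ge0 => x; rewrite indicE.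
rewrite invrK lee_fin; lra.
Qed.

(** Tightness fixes [b] before the limit in [i] is taken, so the error [D b i] may depend on [b] as
    long as it vanishes along [F]. The restriction [|Y i w| <= c0] is free as well, since it fails
    with vanishing probability. *)
Lemma cvg0_in_prob_mass (I : Type) (F : set_system I) (FF : Filter F)
    (X Y : I -> Omega -> R) (c c0 : R) (D : R -> I -> R) : 0 < c -> 0 < c0 ->
  (\forall i \near F, measurable_fun setT (X i)) ->
  (\forall i \near F, measurable_fun setT (Y i)) ->
  (forall b : R, 0 < b -> \forall i \near F, forall w,
    2^-1 <= fine (kappa w [set x | `|x| <= b]) -> `|Y i w| <= c0 ->
    `|X i w| <= c * `|Y i w| + D b i) ->
  (forall b e : R, 0 < b -> 0 < e -> \forall i \near F, D b i <= e) ->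
  cvg0_in_prob P F Y -> cvg0_in_prob P F X.
Proof.
move=> c0' c00 mX mY XY D0 /cvg0_in_probP cY; apply/cvg0_in_probP => eta e eta0 e0.
have e20 : 0 < e / 2 by rewrite divr_gt0.
have [b [b0 hb]] := mass_tight e20.
pose eta' := Num.min c0 (eta / (2 * c)).
have eta'0 : 0 < eta' by rewrite lt_min c00 divr_gt0// mulr_gt0.
near=> i.
rewrite (splitr e).
apply: (@prob_setU_le _ _ _ _ [set w | eta' < `|Y i w|]
  [set w | fine (kappa w [set x | `|x| <= b]) < 2^-1]) => //.
- by apply: measurable_norm_ltr; near: i.
- by apply: measurable_ltr => //; exact: measurable_mass.
- by apply: measurable_norm_ltr; near: i.
- move=> w /= h; have [?|Yw] := ltP eta' `|Y i w|; [by left|right].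
  rewrite ltNge; apply/negP => hm.
  have Yc0 : `|Y i w| <= c0 by rewrite (le_trans Yw)// ge_min lexx.
  have Yc : c * `|Y i w| <= eta / 2.
    rewrite mulrC -ler_pdivlMr// (le_trans Yw)// ge_min; apply/orP; right.
    by rewrite invfM mulrA.
  have DD : D b i <= eta / 2 by near: i; apply: D0 => //; rewrite divr_gt0.
  have h2 : forall w, 2^-1 <= fine (kappa w [set x | `|x| <= b]) -> `|Y i w| <= c0 ->
    `|X i w| <= c * `|Y i w| + D b i by near: i; exact: XY.
  have := h2 w hm Yc0; lra.
- by near: i; exact: cY.
Unshelve. all: by end_near.
Qed.

Lemma cvg0_in_prob_le (I : Type) (F : set_system I) (FF : Filter F)
    (X Y : I -> Omega -> R) (c : R) : 0 < c ->
  (\forall i \near F, measurable_fun setT (X i)) ->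
  (\forall i \near F, measurable_fun setT (Y i)) ->
  (\forall i \near F, forall w, `|X i w| <= c * `|Y i w|) ->
  cvg0_in_prob P F Y -> cvg0_in_prob P F X.
Proof.
move=> c0 mX mY XY; apply: (@cvg0_in_prob_mass I F FF X Y c 1 (fun _ _ => 0)) => //.
- by move=> b b0; apply: filterS XY => i h w _ _; rewrite addr0.
- by move=> b e _ /ltW e0; exact: nearW.
Qed.

End Mass.

(** * Joint measurability, the variance integral and the averaged gap *)

Section JointMeasurability.
Context d (Omega : measurableType d) (R : realType) (P : probability Omega R).
Context (g : nat -> Omega -> R).
Hypotheses (mg : forall n, measurable_fun setT (g n)) (exg : exchangeable P g).
Context (kappa : Omega -> probability R R).
Hypothesis rcd : is_rcd P (tail_sigma g) (g 0%N) kappa.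

Local Notation E f := (\int[P]_(w in setT) f w).
Local Notation K h := (fun w => \int[kappa w]_(y in setT) h y).
Local Notation T := (g_sigma_algebraType (tail_sigma g)).
Local Notation mu := (@lebesgue_measure R).

Lemma bdm_Tq (eps t : R) : bdm (Tq kappa eps t : T -> R).
Proof.
rewrite (_ : Tq kappa eps t = fun w => t * K \1_[set x : R | eps * t < `|x|] w); last first.
  by apply/funext => w; rewrite Tq_exp.
apply: bdmM; first exact: bdm_cst.
by apply: (bdm_condT rcd); apply: bdm_indic; exact: measurable_norm_gt.
Qed.

Lemma bdm_Sigmaq (eps t : R) : bdm (Sigmaq kappa eps t : T -> R).
Proof.
apply: bdmM; first exact: bdm_cst.
by apply: (bdm_condT rcd); exact: bdmX (bdm_trunc _).
Qed.

Lemma bdm_Delta (t : R) : bdm (Delta kappa t : T -> R).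
Proof. by apply: (bdm_condT rcd); exact: bdm_trunc. Qed.

Lemma bdm_Vq (eps t : R) : bdm (Vq kappa eps t : T -> R).
Proof.
apply: bdmM; first exact: bdm_cst.
apply: bdmB; first by apply: (bdm_condT rcd); exact: bdmX (bdm_trunc _).
by apply: bdmX; apply: (bdm_condT rcd); exact: bdm_trunc.
Qed.

Lemma bdm_Rq (eps t : R) : bdm (Rq kappa eps t : T -> R).
Proof.
apply: bdmM; first exact: bdm_cst.
by apply: (bdm_condT rcd); exact: bdmX (bdm_min_norm _).
Qed.

Lemma bdm_kernel_pair (F : (Omega * R) * R -> R) : bdm F ->
  bdm (fun p : Omega * R => \int[kappa p.1]_(y in setT) F (p, y)).
Proof.
move=> bF; apply: (@bdm_kernel _ _ (Omega * R)%type R R (fun p => kappa p.1)) => // U mU.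
apply: (measurableT_comp (f := fun w => kappa w U)); last exact: measurable_fst.
apply: (measurable_fun_sub (tail_measurable mg)).
exact: (measurable_rcd (sigma_algebra_tail g) rcd).
Qed.

(** Measurability in [(w, t)] jointly is what Tonelli needs for [tailV], which is handled by
    comparison and not by a closed formula in [Rq]. *)
Lemma measurable_tail_pair (eps M : R) : 0 < eps -> 0 < M ->
  measurable_fun setT (fun p : Omega * R =>
    \1_(`[M, +oo[%classic : set R) p.2 * (Sigmaq kappa eps p.2 p.1 / p.2 ^+ 2)) /\
  measurable_fun setT (fun p : Omega * R =>
    \1_(`[M, +oo[%classic : set R) p.2 * (Vq kappa eps p.2 p.1 / p.2 ^+ 2)).
Proof.
move=> e0 M0.
pose D : set R := `[M, +oo[%classic.
have mD : measurable D by exact: measurable_itv.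
have D0 t : t \in D -> 0 < t.
  by rewrite inE /D/= in_itv/= andbT; exact: lt_le_trans.
(* Dividing the truncation by [t] makes the integrand bounded by [eps]. *)
pose F (q : (Omega * R) * R) := \1_D q.1.2 * (trunc (eps * q.1.2) q.2 * q.1.2^-1).
have m12 : measurable_fun setT (fun q : (Omega * R) * R => q.1.2).
  exact: (measurableT_comp measurable_snd measurable_fst).
have bF : bdm F.
  split.
    apply: measurable_funM; first by apply: measurableT_comp m12; exact: measurable_indic.
    apply: measurable_funM; last by apply: measurableT_comp m12; exact: measurable_invr.
    apply: (measurableT_comp (measurable_trunc_pair eps)
      (g := fun q : (Omega * R) * R => (q.1.2, q.2))).
    by apply: measurable_fun_pair => //; exact: measurable_snd.
  exists eps => -[[w t] x]; rewrite /F/= indicE.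
  have [/D0 t0|_] := boolP (t \in D); last by rewrite mul0r normr0 ltW.
  rewrite mul1r normrM normfV (gtr0_norm t0) ler_pdivrMr// /trunc.
  by case: ifP => // _; rewrite normr0 mulr_ge0// ltW.
pose A (p : Omega * R) := \int[kappa p.1]_(y in setT) (F (p, y) ^+ 2).
pose B (p : Omega * R) := \int[kappa p.1]_(y in setT) F (p, y).
have bA : bdm A by apply: (bdm_kernel_pair (F := fun q => F q ^+ 2)); exact: bdmX.
have bB : bdm B by exact: bdm_kernel_pair.
have FE w t y : t \in D -> F ((w, t), y) = t^-1 * trunc (eps * t) y.
  by move=> tD; rewrite /F/= indicE tD mul1r mulrC.
have AE w t : t \in D -> A (w, t) = t^-1 ^+ 2 * K (fun y => trunc (eps * t) y ^+ 2) w.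
  move=> tD; rewrite -expZ; last exact: bdmX (bdm_trunc _).
  by apply: eq_Rintegral => y _; rewrite FE// exprMn.
have BE w t : t \in D -> B (w, t) = t^-1 * K (trunc (eps * t)) w.
  move=> tD; rewrite -expZ; last exact: bdm_trunc.
  by apply: eq_Rintegral => y _; rewrite FE.
have m (H : Omega * R -> R) : bdm H ->
    measurable_fun setT (fun p : Omega * R => \1_D p.2 * (p.2^-1 * H p)).
  move=> [mH _]; apply: measurable_funM.
    by apply: measurableT_comp (@measurable_snd _ _ Omega R); exact: measurable_indic.
  by apply: measurable_funM => //; apply: measurableT_comp (@measurable_snd _ _ Omega R);
    exact: measurable_invr.
split.
- rewrite (_ : (fun p => _) = (fun p : Omega * R => \1_D p.2 * (p.2^-1 * A p))); first exact: m.
  apply/funext => -[w t] /=; rewrite indicE.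
  have [tD|_] := boolP (t \in D); last by rewrite !mul0r.
  by rewrite AE// /Sigmaq; have := D0 _ tD => t0; field; rewrite gt_eqF.
- rewrite (_ : (fun p => _) = (fun p : Omega * R => \1_D p.2 * (p.2^-1 * (A p - B p ^+ 2)))).
    by apply: m; apply: bdmB => //; exact: bdmX.
  apply/funext => -[w t] /=; rewrite indicE.
  have [tD|_] := boolP (t \in D); last by rewrite !mul0r.
  by rewrite AE// BE// /Vq; have := D0 _ tD => t0; field; rewrite gt_eqF.
Qed.

Lemma measurable_tailV (eps M : R) : 0 < eps -> 0 < M ->
  measurable_fun setT (tailV kappa eps M).
Proof.
move=> e0 M0; have [_ mV] := measurable_tail_pair e0 M0.
pose G (p : Omega * R) :=
  (\1_(`[M, +oo[%classic : set R) p.2 * (Vq kappa eps p.2 p.1 / p.2 ^+ 2))%:E.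
have mG : measurable_fun setT G by exact/measurable_EFinP.
have G0 p : (0 <= G p)%E.
  rewrite lee_fin indicE; have [|_] := boolP (p.2 \in _); last by rewrite mul0r.
  rewrite inE/= in_itv/= andbT mul1r => Mt.
  by rewrite divr_ge0 ?sqr_ge0// Vq_ge0// (le_trans _ Mt)// ltW.
have := @measurable_fun_fubini_tonelli_F _ _ _ _ _ mu G mG G0.
rewrite /fubini_F => mfG.
rewrite (_ : tailV kappa eps M = fun w => M * fine (\int[mu]_t G (w, t))%E).
  by apply: measurable_funM => //; exact: measurableT_comp.
apply/funext => w; rewrite /tailV /Rintegral; congr (_ * fine _).
rewrite integral_mkcond; apply: eq_integral => t _.
by rewrite patchE /G/= indicE; case: ifPn => _; rewrite ?mul1r ?mul0r.
Qed.

Lemma measurable_tail_section (eps M : R) w : 0 < eps -> 0 < M ->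
  measurable_fun `[M, +oo[ (fun t => Sigmaq kappa eps t w / t ^+ 2) /\
  measurable_fun `[M, +oo[ (fun t => Vq kappa eps t w / t ^+ 2).
Proof.
move=> e0 M0; have [mS mV] := measurable_tail_pair e0 M0.
have s (H : Omega * R -> R) :
    measurable_fun setT (fun p : Omega * R => \1_(`[M, +oo[%classic : set R) p.2 * H p) ->
    measurable_fun `[M, +oo[ (fun t => H (w, t)).
  move=> mH; have h : measurable_fun setT (fun t : R => \1_(`[M, +oo[%classic : set R) t * H (w, t)).
    by apply: (measurableT_comp mH (g := fun t : R => (w, t))); exact: measurable_pair1.
  apply: (eq_measurable_fun (fun t : R => \1_(`[M, +oo[%classic : set R) t * H (w, t))).
    by move=> t tD; rewrite indicE tD mul1r.
  exact: measurable_funTS.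
split; first exact: (s (fun p => Sigmaq kappa eps p.2 p.1 / p.2 ^+ 2)).
exact: (s (fun p => Vq kappa eps p.2 p.1 / p.2 ^+ 2)).
Qed.

(** [Vq <= Sigmaq <= 5 Vq + 4 b ^ 2 / t] is integrated against [dt / t ^ 2]; the error becomes
    [M * 4 b ^ 2 / (2 M ^ 2)]. *)
Lemma tailV_bounds (eps M : R) w : 0 < eps -> 0 < M ->
  [/\ 0 <= tailV kappa eps M w, tailV kappa eps M w <= tailSigma kappa eps M w &
   forall b, 2^-1 <= fine (kappa w [set x | `|x| <= b]) ->
   tailSigma kappa eps M w <= 5 * tailV kappa eps M w + 2 * b ^+ 2 / M].
Proof.
move=> e0 M0; have [mS mV] := measurable_tail_section w e0 M0.
pose iS := (\int[mu]_(t in `[M, +oo[) (Sigmaq kappa eps t w / t ^+ 2)%:E)%E.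
pose iV := (\int[mu]_(t in `[M, +oo[) (Vq kappa eps t w / t ^+ 2)%:E)%E.
have tM t : [set` `[M, +oo[] t -> 0 < t.
  by rewrite /= in_itv/= andbT; exact: lt_le_trans.
have V0 t : [set` `[M, +oo[] t -> 0 <= Vq kappa eps t w / t ^+ 2.
  by move=> /tM t0; rewrite divr_ge0 ?sqr_ge0// Vq_ge0// ltW.
have iV0 : (0 <= iV)%E by apply: integral_ge0 => t /V0; rewrite lee_fin.
have VS : (iV <= iS)%E.
  apply: ge0_le_integral => //.
  - by apply/measurable_EFinP.
  - by apply/measurable_EFinP.
  - move=> t /tM t0; rewrite lee_fin ler_pM2r ?invr_gt0 ?exprn_gt0//.
    by rewrite Vq_le// ltW.
(* Finiteness comes from the closed formula for the [Sigmaq] integral and passes to the smaller [Vq]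
   integral, so taking [fine] loses nothing. *)
have Sfin : iS \is a fin_num by rewrite /iS tailSigma_Rq.
have Vfin : iV \is a fin_num.
  by rewrite ge0_fin_numE// (le_lt_trans VS)// -ge0_fin_numE// (le_trans iV0).
have tVE : tailV kappa eps M w = M * fine iV by [].
have tSE : tailSigma kappa eps M w = M * fine iS by [].
split.
- by rewrite tVE mulr_ge0 ?fine_ge0// ltW.
- by rewrite tVE tSE ler_pM2l// fine_le.
- move=> b hb; rewrite tVE tSE.
  suff h : (iS <= 5%:E * iV + (4 * b ^+ 2)%:E * (2^-1 * M^-1 ^+ 2)%:E)%E.
    rewrite -(fineK Sfin) -(fineK Vfin) -!EFinM -EFinD lee_fin in h.
    have -> : 5 * (M * fine iV) + 2 * b ^+ 2 / M =
        M * (5 * fine iV + 4 * b ^+ 2 * (2^-1 * M^-1 ^+ 2)).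
      by field; rewrite gt_eqF.
    by rewrite ler_pM2l.
  have mc : measurable_fun `[M, +oo[ (fun t : R => (t^-1 ^+ 3)%:E).
    by apply/measurable_EFinP; apply: measurable_funTS; apply: measurable_funX; exact: measurable_invr.
  have c0 t : [set` `[M, +oo[] t -> (0 <= (t^-1 ^+ 3)%:E)%E.
    by move=> /tM t0; rewrite lee_fin exprn_ge0// invr_ge0 ltW.
  have b40 : (0 <= (4 * b ^+ 2)%:E)%E by rewrite lee_fin; apply: mulr_ge0 => //; exact: sqr_ge0.
  have eV : (5%:E * iV = \int[mu]_(t in `[M, +oo[) (5%:E * (Vq kappa eps t w / t ^+ 2)%:E))%E.
    by rewrite ge0_integralZl//; first [exact/measurable_EFinP|move=> t /V0; rewrite lee_fin].
  have eC : ((4 * b ^+ 2)%:E * (2^-1 * M^-1 ^+ 2)%:E =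
      \int[mu]_(t in `[M, +oo[) ((4 * b ^+ 2)%:E * (t^-1 ^+ 3)%:E))%E.
    by rewrite ge0_integralZl// integral_inv_cube.
  rewrite eV eC.
  rewrite -ge0_integralD//; last 4 first.
  - by move=> t /V0 h; rewrite mule_ge0// lee_fin.
  - by apply: measurable_funeM; exact/measurable_EFinP.
  - by move=> t /c0 h; rewrite mule_ge0.
  - exact: measurable_funeM.
  apply: ge0_le_integral => //.
  - by move=> t /tM t0; rewrite lee_fin divr_ge0 ?sqr_ge0// Sigmaq_ge0// ltW.
  - exact/measurable_EFinP.
  - by apply: emeasurable_funD; apply: measurable_funeM => //; exact/measurable_EFinP.
  - move=> t /tM t0; rewrite -!EFinM -EFinD lee_fin.
    have -> : 5 * (Vq kappa eps t w / t ^+ 2) + 4 * b ^+ 2 * t^-1 ^+ 3 =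
        (5 * Vq kappa eps t w + 4 * b ^+ 2 / t) / t ^+ 2 by field; rewrite gt_eqF.
    by rewrite ler_pM2r ?invr_gt0 ?exprn_gt0//; exact: Sigmaq_le_Vq.
Qed.

Definition gap (N : nat) (w : Omega) : R := fine (charfun_gap kappa w N).

Lemma bdm_charfun_pair (v : R) :
  bdm (fun p : Omega * R => \int[kappa p.1]_(y in setT) cos (p.2 * v * y)) /\
  bdm (fun p : Omega * R => charfun_norm kappa (p.2 * v) p.1).
Proof.
have m : measurable_fun setT (fun q : (Omega * R) * R => q.1.2 * v * q.2).
  apply: measurable_funM; last exact: measurable_snd.
  apply: measurable_funM => //.
  exact: (measurableT_comp measurable_snd measurable_fst).
have bc := bdm_kernel_pair (bdm_cos m); have bs := bdm_kernel_pair (bdm_sin m).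
by split => //; apply: bdm_sqrt; apply: bdmD; exact: bdmX.
Qed.

Lemma charfun_norm_ge0 (v : R) w : 0 <= charfun_norm kappa v w.
Proof. exact: sqrtr_ge0. Qed.

Lemma one_sub_charfun_ge0 (v : R) N w : 0 <= 1 - charfun_norm kappa v w ^+ N.
Proof. by rewrite subr_ge0 exprn_ile1 ?charfun_norm_ge0 ?charfun_norm_le1. Qed.

Lemma one_sub_charfun_le1 (v : R) N w : 1 - charfun_norm kappa v w ^+ N <= 1.
Proof. by rewrite gerBl exprn_ge0// charfun_norm_ge0. Qed.

Lemma mu01 : (mu `[0%R, 1%R] = 1)%E.
Proof. by rewrite lebesgue_measure_itv/= lte01 oppr0 adde0. Qed.

Lemma measurable_charfun_section N w :
  measurable_fun setT (fun u : R => charfun_norm kappa (u / N%:R) w ^+ N).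
Proof.
have [m _] := bdmX N (bdm_charfun_pair N%:R^-1).2.
by apply: (measurableT_comp m (g := fun u : R => (w, u))); exact: measurable_pair1.
Qed.

Lemma gapE N w : charfun_gap kappa w N = (gap N w)%:E /\ 0 <= gap N w <= 1.
Proof.
have h0 : (0 <= charfun_gap kappa w N)%E.
  by apply: integral_ge0 => u _; rewrite lee_fin one_sub_charfun_ge0.
have h1 : (charfun_gap kappa w N <= 1)%E.
  rewrite -mu01 -[leRHS]mul1e -integral_cst//; apply: ge0_le_integral => //.
  - by move=> u _; rewrite lee_fin one_sub_charfun_ge0.
  - apply/measurable_EFinP; apply: measurable_funTS; apply: measurable_funB => //.
    exact: measurable_charfun_section.
  - by move=> u _; rewrite lee_fin one_sub_charfun_le1.
have fg : charfun_gap kappa w N \is a fin_num.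
  by rewrite ge0_fin_numE// (le_lt_trans h1)// ltry.
have e : charfun_gap kappa w N = (gap N w)%:E by rewrite fineK.
by split => //; rewrite -!lee_fin -e h0 h1.
Qed.

Let Gap N (p : Omega * R) :=
  (\1_(`[0%R, 1%R]%classic : set R) p.2 * (1 - charfun_norm kappa (p.2 / N%:R) p.1 ^+ N))%:E.

Let mGap N : measurable_fun setT (Gap N).
Proof.
apply/measurable_EFinP; apply: measurable_funM.
  by apply: measurableT_comp (@measurable_snd _ _ Omega R); exact: measurable_indic.
by apply: measurable_funB => //; case: (bdmX N (bdm_charfun_pair N%:R^-1).2).
Qed.

Let Gap0 N p : (0 <= Gap N p)%E.
Proof. by rewrite lee_fin mulr_ge0 ?indicE// one_sub_charfun_ge0. Qed.

Let gap_Gap N w : charfun_gap kappa w N = (\int[mu]_u Gap N (w, u))%E.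
Proof.
rewrite /charfun_gap integral_mkcond; apply: eq_integral => u _.
by rewrite patchE /Gap/= indicE; case: ifP => _; rewrite ?mul1r ?mul0r.
Qed.

Lemma bdm_gap N : bdm (gap N).
Proof.
split; last by exists 1 => w; have [_ /andP[h0 h1]] := gapE N w; rewrite ger0_norm.
have := @measurable_fun_fubini_tonelli_F _ _ _ _ _ mu (Gap N) (mGap N) (Gap0 N).
rewrite /fubini_F => m; rewrite /gap; under eq_fun do rewrite gap_Gap.
exact: measurableT_comp.
Qed.

Lemma exp_gap_le N (D : R) :
  (forall u : R, 0 <= u <= 1 -> E (fun w => 1 - charfun_norm kappa (u / N%:R) w ^+ N) <= D) ->
  E (gap N) <= D.
Proof.
move=> h; rewrite -lee_fin -expE; last exact: bdm_gap.
under eq_integral do rewrite -(gapE N _).1 gap_Gap.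
rewrite (@fubini_tonelli _ _ _ _ _ P mu (Gap N) (mGap N) (Gap0 N)).
apply: (@le_trans _ _ (\int[mu]_(u in `[0%R, 1%R]) D%:E)%E).
  rewrite [leRHS]integral_mkcond; apply: ge0_le_integral => //.
  - by move=> u _; exact: integral_ge0.
  - exact: (@measurable_fun_fubini_tonelli_G _ _ _ _ _ P (Gap N) (mGap N) (Gap0 N)).
  - by apply/measurable_restrict => //; exact: measurable_cst.
  - move=> u _; rewrite patchE /Gap/= indicE; case: ifPn => u01; last first.
      by under eq_integral do rewrite mul0r; rewrite integral0.
    have bc : bdm (fun w => 1 - charfun_norm kappa (u / N%:R) w ^+ N).
      apply: bdmB; first exact: bdm_cst.
      by apply: bdmX; exact: (bdm_tail_sub mg (bdm_charfun_norm rcd _)).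
    under eq_integral do rewrite mul1r.
    by rewrite expE// lee_fin; apply: h; move: u01; rewrite inE/= in_itv.
by rewrite integral_cst// [X in (_ * X)%E]mu01 mule1.
Qed.

(** Integrating [charfun_pointwise] over [u] gives [Rq / 8 <= (4 Rq + 10) gap + B]. For
    [gap <= 1/64] the term [4 Rq gap] is at most [Rq / 16] and moves to the left; multiplying by
    [16] yields [160] and [64]. *)
Lemma Rq_le_gap (N : nat) (b : R) w : (0 < N)%N ->
  2^-1 <= fine (kappa w [set x | `|x| <= b]) -> gap N w <= 64^-1 ->
  Rq kappa 1 N%:R w <= 160 * gap N w + 64 * b ^+ 2 / N%:R.
Proof.
move=> N0 hb g64; have NR : 0 < N%:R :> R by rewrite ltr0n.
have [ge /andP[g0 _]] := gapE N w.
have R0 : 0 <= Rq kappa 1 N%:R w by rewrite Rq_ge0// ltW.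
pose A := 4 * Rq kappa 1 N%:R w + 10; pose B := 4 * b ^+ 2 / N%:R.
have A0 : 0 <= A by rewrite addr_ge0// mulr_ge0.
have B0 : 0 <= B by apply: divr_ge0; [apply: mulr_ge0 => //; exact: sqr_ge0 | exact: ltW].
have mc : measurable_fun setT (fun u : R => 1 - charfun_norm kappa (u / N%:R) w ^+ N).
  by apply: measurable_funB => //; exact: measurable_charfun_section.
have key : 8^-1 * Rq kappa 1 N%:R w <= A * gap N w + B.
  rewrite -lee_fin; apply: (le_trans (integral_charfun_ge kappa w NR)).
  apply: (@le_trans _ _ (\int[mu]_(u in `[0%R, 1%R])
     (A%:E * (1 - charfun_norm kappa (u / N%:R) w ^+ N)%:E + B%:E))%E).
    apply: ge0_le_integral => //.
    - move=> u _; rewrite lee_fin; apply: mulr_ge0; first exact: ltW.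
      rewrite subr_ge0 -[leRHS](exp_cst (kappa w)).
      by apply: exp_le => [||x]; [exact: bdm_cosM|exact: bdm_cst|exact: cos_le1].
    - apply/measurable_EFinP; apply: measurable_funTS; apply: measurable_funM => //.
      apply: measurable_funB => //; have [m _] := (bdm_charfun_pair N%:R^-1).1.
      by apply: (measurableT_comp m (g := fun u : R => (w, u))); exact: measurable_pair1.
    - apply: measurable_funTS; apply: emeasurable_funD => //.
      by apply/measurable_EFinP; exact: measurable_funM.
    - move=> u /=; rewrite in_itv/= => u01; rewrite -EFinM -EFinD lee_fin.
      exact: charfun_pointwise.
  rewrite ge0_integralD//; last 2 first.
  - by move=> u _; rewrite mule_ge0// lee_fin// one_sub_charfun_ge0.
  - by apply: measurable_funTS; apply/measurable_EFinP; exact: measurable_funM.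
  rewrite ge0_integralZl//; last 2 first.
  - by apply: measurable_funTS; apply/measurable_EFinP.
  - by move=> u _; rewrite lee_fin one_sub_charfun_ge0.
  rewrite integral_cst// [X in (_ + _ * X)%E]mu01 mule1 -/(charfun_gap kappa w N) ge.
  by rewrite -EFinM -EFinD.
have h : Rq kappa 1 N%:R w * gap N w <= Rq kappa 1 N%:R w * 64^-1 by rewrite ler_wpM2l.
have -> : 64 * b ^+ 2 / N%:R = 16 * B by rewrite /B; ring.
move: key h; rewrite /A mulrDl -mulrA.
lra.
Qed.

End JointMeasurability.

(** * The weak law *)

Section WeakLaw.
Context d (Omega : measurableType d) (R : realType) (P : probability Omega R).
Context (g : nat -> Omega -> R).
Hypotheses (mg : forall n, measurable_fun setT (g n)) (exg : exchangeable P g).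
Context (kappa : Omega -> probability R R).
Hypothesis rcd : is_rcd P (tail_sigma g) (g 0%N) kappa.

Local Notation E f := (\int[P]_(w in setT) f w).
Local Notation K h := (fun w => \int[kappa w]_(y in setT) h y).
Local Notation T := (g_sigma_algebraType (tail_sigma g)).

Lemma measurable_dev_event (D : nat -> Omega -> R) eps N :
  measurable_fun setT (D N) -> measurable (dev_event g D eps N).
Proof.
move=> mD; apply: measurable_norm_ltr; apply: measurable_funB => //.
by apply: measurable_funM => //; apply: measurable_sum => i.
Qed.

Lemma measurable_Tmeas (D : nat -> Omega -> R) N : Tmeas_seq g D ->
  measurable_fun setT (D N : T -> R).
Proof. by move=> tD; apply/(meas_wrtP _ (sigma_algebra_tail g)); exact: tD. Qed.

Lemma measurable_Tmeas_sub (D : nat -> Omega -> R) N : Tmeas_seq g D ->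
  measurable_fun setT (D N).
Proof.
by move=> tD; apply: (measurable_fun_sub (tail_measurable mg)); exact: measurable_Tmeas.
Qed.

Definition DeltaN (N : nat) (w : Omega) : R := Delta kappa N%:R w.

Lemma Tmeas_DeltaN : Tmeas_seq g DeltaN.
Proof.
by move=> N; apply/(meas_wrtP _ (sigma_algebra_tail g)); case: (bdm_Delta rcd N%:R).
Qed.

(** On [C] a deviation needs either some [|g i| > N], which costs [Tq <= a] by a union bound, or a
    large centred truncated sum, which costs [Sigmaq / eps ^ 2 <= a / eps ^ 2] by Chebyshev. As [C]
    is a tail event, its indicator passes through the conditioning. *)
Lemma prob_dev_DeltaN (eps a : R) (N : nat) : (0 < N)%N -> 0 < eps -> 0 <= a ->
  (P (dev_event g DeltaN eps N) <=
   P [set w | (a < `|Rq kappa 1 N%:R w|)%R] + (a + a / eps ^+ 2)%:E)%E.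
Proof.
move=> N0 e0 a0; have NR : 0 < N%:R :> R by rewrite ltr0n.
have bR := bdm_Rq rcd 1 N%:R.
pose C := [set w | Rq kappa 1 N%:R w <= a].
have tC : tail_sigma g C.
  rewrite -(measurable_g_measurableTypeE (sigma_algebra_tail g)).
  by apply: (@measurable_ler _ T) => //; case: bR.
have mC := tail_measurable mg tC.
have mR : measurable [set w | a < `|Rq kappa 1 N%:R w|].
  by apply: measurable_norm_ltr; case: (bdm_tail_sub mg bR).
have mdev : measurable (dev_event g DeltaN eps N).
  by apply: measurable_dev_event; apply: measurable_Tmeas_sub; exact: Tmeas_DeltaN.
pose B : set R := [set x | N%:R < `|x|].
have mB : measurable B by exact: measurable_norm_gt.
pose tau := trunc (N%:R : R).
have bt : bdm tau by exact: bdm_trunc.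
have bi (A : set Omega) : measurable A -> bdm (\1_A : Omega -> R) by move=> mA; exact: bdm_indic.
have bC : bdm (\1_C : Omega -> R) by exact: bi.
have biB : bdm (\1_B : R -> R) by exact: bdm_indic.
have bBg i : bdm (fun w => \1_C w * \1_B (g i w) : R) by apply: bdmM; [exact: bC|exact: bdm_comp (mg i) biB].
pose S w := \sum_(i < N) (tau (g i w) - K tau w).
have bKt := bdm_cond mg rcd bt.
have bS : bdm S.
  apply: (bdm_sum (f := fun i w => tau (g i w) - K tau w)) => i _.
  by apply: bdmB; [exact: bdm_comp (mg i) bt|exact: bKt].
have bCS : bdm (fun w => \1_C w * S w ^+ 2) by apply: bdmM; [exact: bC|exact: bdmX].
have bK1 := bdm_cond mg rcd biB; have bK2 := bdm_cond mg rcd (bdmX 2 bt).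
have bsum : bdm (fun w => \sum_(i < N) \1_C w * \1_B (g i w) : R).
  exact: (bdm_sum (f := fun i w => \1_C w * \1_B (g i w) : R)).
have indge (A : set Omega) w : 0 <= \1_A w :> R by rewrite indicE.
have pw w : \1_(dev_event g DeltaN eps N) w <=
    \1_[set w | a < `|Rq kappa 1 N%:R w|] w +
    (\sum_(i < N) \1_C w * \1_B (g i w) + (eps * N%:R) ^- 2 * (\1_C w * S w ^+ 2)).
  have s0 : 0 <= \sum_(i < N) \1_C w * \1_B (g i w) :> R.
    by apply: sumr_ge0 => i _; rewrite mulr_ge0// indicE.
  have q0 : 0 <= (eps * N%:R) ^- 2 * (\1_C w * S w ^+ 2).
    apply: mulr_ge0; first by rewrite invr_ge0 sqr_ge0.
    by apply: mulr_ge0; [exact: indge | exact: sqr_ge0].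
  have [wd|wd] := pselect (dev_event g DeltaN eps N w); last first.
    by rewrite indicE memNset// addr_ge0// addr_ge0.
  rewrite {1}indicE mem_set//=.
  have [wC|wC] := pselect (C w); last first.
    rewrite indicE mem_set/=; first by rewrite lerDl addr_ge0.
    move/negP : wC; rewrite -ltNge => h.
    by rewrite (lt_le_trans h)// ler_norm.
  have wC1 : \1_C w = 1 :> R by rewrite indicE mem_set.
  have [[i gi]|gN] := pselect (exists i : 'I_N, B (g i w)).
    rewrite (bigD1 i)//= wC1 mul1r [\1_B _]indicE mem_set//=.
    have s1 : 0 <= \sum_(j < N | j != i) 1 * \1_B (g j w) :> R.
      by apply: sumr_ge0 => j _; rewrite mul1r indicE.
    have := indge [set w | a < `|Rq kappa 1 N%:R w|] w; rewrite wC1 in q0; lra.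
  suff : 1 <= (eps * N%:R) ^- 2 * (\1_C w * S w ^+ 2).
    by have := indge [set w | a < `|Rq kappa 1 N%:R w|] w; lra.
  rewrite wC1 mul1r ler_pdivlMl ?exprn_gt0 ?mulr_gt0// mulr1.
  move: wd; rewrite /dev_event/=.
  (* No [|g i w|] exceeds [N] here, so truncation changes nothing and the centring is exactly
     [N * DeltaN N w]. *)
  have SE : S w = \sum_(i < N) g i w - N%:R * DeltaN N w.
    rewrite /S sumrB sumr_const card_ord mulr_natl; congr (_ - _).
    apply: eq_bigr => i _; rewrite /tau /trunc ifT// leNgt; apply/negP => h.
    by apply: gN; exists i.
  have -> : N%:R^-1 * (\sum_(i < N) g i w) - DeltaN N w = N%:R^-1 * S w.
    by rewrite SE mulrBr mulKf// gt_eqF.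
  rewrite normrM gtr0_norm ?invr_gt0// ltr_pdivlMl// => h.
  have hh : eps * N%:R <= `|S w| by rewrite mulrC ltW.
  have eN : 0 <= eps * N%:R by apply: mulr_ge0; exact: ltW.
  by rewrite -[leRHS]real_normK ?num_real// lerXn2r ?nnegrE.
have sumle : E (fun w => \sum_(i < N) \1_C w * \1_B (g i w)) = E (fun w => \1_C w * Tq kappa 1 N%:R w).
  rewrite (exp_sum _ (f := fun i w => \1_C w * \1_B (g i w) : R))//.
  transitivity (\sum_(i < N) E (fun w => \1_C w * K (\1_B) w)).
    apply: eq_bigr => i _; apply: (exp_tail mg exg rcd) => //.
    by apply: bdm_indic; exact: sub_sigma_algebra.
  rewrite sumr_const card_ord -[LHS]mulr_natl -expZ; last by apply: bdmM; [exact: bC|].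
  by apply: eq_Rintegral => w _; rewrite Tq_exp mul1r -/B; ring.
have Sle : (eps * N%:R) ^- 2 * E (fun w => \1_C w * S w ^+ 2) <=
    (eps ^+ 2)^-1 * E (fun w => \1_C w * Sigmaq kappa 1 N%:R w).
  have h := exp_centered_sum_le mg exg rcd N tC bt.
  apply: (@le_trans _ _ ((eps * N%:R) ^- 2 * (N%:R * E (fun w => \1_C w * K (fun y => tau y ^+ 2) w)))).
    by rewrite ler_wpM2l ?invr_ge0 ?sqr_ge0.
  rewrite le_eqVlt; apply/orP; left; apply/eqP.
  have -> : E (fun w => \1_C w * Sigmaq kappa 1 N%:R w) =
      N%:R^-1 * E (fun w => \1_C w * K (fun y => tau y ^+ 2) w).
    rewrite -expZ; last by apply: bdmM; [exact: bC|].
    by apply: eq_Rintegral => w _; rewrite /Sigmaq mul1r; ring.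
  by field; rewrite !gt_eqF.
have Cle (q : Omega -> R) : bdm q -> (forall w, q w <= Rq kappa 1 N%:R w) ->
    E (fun w => \1_C w * q w) <= a.
  move=> bq qR; rewrite -[leRHS](exp_cst P); apply: exp_le.
  - by apply: bdmM => //; exact: bC.
  - exact: bdm_cst.
  - move=> w; rewrite indicE; have [wC|_] := boolP (w \in C); last by rewrite mul0r.
    by rewrite mul1r (le_trans (qR w))//; exact: set_mem wC.
have TR w : Tq kappa 1 N%:R w <= Rq kappa 1 N%:R w.
  by rewrite RqE// expr1n mul1r lerDr Sigmaq_ge0// ltW.
have SR w : Sigmaq kappa 1 N%:R w <= Rq kappa 1 N%:R w.
  by rewrite RqE// expr1n mul1r lerDl Tq_ge0// ltW.
have c1 := Cle _ (bdm_tail_sub mg (bdm_Tq rcd 1 N%:R)) TR.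
have c2 := Cle _ (bdm_tail_sub mg (bdm_Sigmaq rcd 1 N%:R)) SR.
rewrite -!exp_indic// -EFinD lee_fin.
have bq : bdm (fun w => (eps * N%:R) ^- 2 * (\1_C w * S w ^+ 2)) by apply: bdmM => //; exact: bdm_cst.
apply: (le_trans (exp_le P (bi _ mdev) (bdmD (bi _ mR) (bdmD bsum bq)) pw)).
rewrite expD//; [|exact: bi|exact: bdmD].
rewrite lerD2l expD// sumle expZ// lerD// (le_trans Sle)// mulrC ler_wpM2r//.
by rewrite invr_ge0 sqr_ge0.
Qed.

Lemma cond_i_DeltaN :
  cvg0_in_prob P \oo (fun N w => Rq kappa 1 N%:R w) -> cond_i P g DeltaN.
Proof.
move=> /cvg0_in_probP cR eps e0; apply/cvge0P => // e e00.
pose c := 1 + (eps ^+ 2)^-1.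
have c0 : 0 < c by rewrite addr_gt0// invr_gt0 exprn_gt0.
pose a := e / 2 / c; have a0 : 0 < a by rewrite divr_gt0// divr_gt0.
have e20 : 0 < e / 2 by rewrite divr_gt0.
near=> N.
have N0 : (0 < N)%N by near: N; exact: nbhs_infty_gt.
rewrite (le_trans (prob_dev_DeltaN N0 e0 (ltW a0)))//.
rewrite [leRHS](_ : _ = ((e / 2)%:E + (a + a / eps ^+ 2)%:E)%E).
  by apply: leeD => //; near: N; exact: cR.
rewrite -EFinD; congr EFin.
have -> : a + a / eps ^+ 2 = a * c by rewrite /c; ring.
by rewrite /a mulfVK ?gt_eqF// -splitr.
Unshelve. all: by end_near.
Qed.

(** Taking [a = cos (u D_N)] and [b = sin (u D_N)] in [exp_cos_sum_le] gives
    [E cos (u Y) <= E |phi (u / N)| ^ N], [Y] being the deviation. Then [1 - cos (u Y)] is at most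
    [2] on the deviation event and at most [eta ^ 2] off it, uniformly in [u]. *)
Lemma exp_gap_dev (D : nat -> Omega -> R) (eta : R) (N : nat) : (0 < N)%N ->
  0 < eta -> Tmeas_seq g D ->
  ((E (gap kappa N))%:E <= (eta ^+ 2)%:E + 2%:E * P (dev_event g D eta N))%E.
Proof.
move=> N0 eta0 tD; have NR : 0 < N%:R :> R by rewrite ltr0n.
have mdev : measurable (dev_event g D eta N).
  by apply: measurable_dev_event; exact: measurable_Tmeas_sub.
have bdev : bdm (\1_(dev_event g D eta N) : Omega -> R) by exact: bdm_indic.
rewrite -exp_indic// -EFinM -EFinD lee_fin.
apply: (exp_gap_le mg rcd) => u /andP[u0 u1].
have mD := measurable_Tmeas N tD.
pose a w := cos (u * D N w); pose b w := sin (u * D N w).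
have ba : bdm (a : T -> R) by apply: bdm_cos; exact: measurable_funM.
have bb : bdm (b : T -> R) by apply: bdm_sin; exact: measurable_funM.
have := exp_cos_sum_le mg exg rcd (u / N%:R) N ba bb.
pose S w := \sum_(i < N) u / N%:R * g i w.
have mS : measurable_fun setT S.
  by apply: measurable_sum => i; exact: measurable_funM.
have ba' := bdm_tail_sub mg ba; have bb' := bdm_tail_sub mg bb.
pose Y w := N%:R^-1 * (\sum_(i < N) g i w) - D N w.
have mD' : measurable_fun setT (D N) by exact: measurable_Tmeas_sub.
have mY : measurable_fun setT Y.
  by apply: measurable_funB => //; apply: measurable_funM => //; exact: measurable_sum.
have SY w : S w - u * D N w = u * Y w.
  by rewrite /S /Y -mulr_sumr mulrBr mulrA.
have -> : E (fun w => a w * cos (S w) + b w * sin (S w)) = E (fun w => cos (u * Y w)).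
  by apply: eq_Rintegral => w _; rewrite -SY cosB /a /b; ring.
have -> : E (fun w => Num.sqrt (a w ^+ 2 + b w ^+ 2) * charfun_norm kappa (u / N%:R) w ^+ N) =
    E (fun w => charfun_norm kappa (u / N%:R) w ^+ N).
  by apply: eq_Rintegral => w _; rewrite /a /b cos2Dsin2 sqrtr1 mul1r.
move=> h.
have b1 : bdm (fun _ : Omega => 1 : R) by exact: bdm_cst.
have br : bdm (fun w => charfun_norm kappa (u / N%:R) w ^+ N).
  by apply: bdmX; exact: (bdm_tail_sub mg (bdm_charfun_norm rcd _)).
have bcY : bdm (fun w => cos (u * Y w)) by apply: bdm_cos; exact: measurable_funM.
rewrite expB// exp_cst.
apply: (@le_trans _ _ (E (fun w => 1 - cos (u * Y w)))).
  by rewrite expB// exp_cst lerB.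
rewrite -(expZ P 2 bdev) -[X in X + _](exp_cst P) -expD; [|exact: bdm_cst|by apply: bdmM => //; exact: bdm_cst].
apply: exp_le; [exact: bdmB|by apply: bdmD; [exact: bdm_cst|by apply: bdmM => //; exact: bdm_cst]|].
move=> w; rewrite indicE; have [wd|] := boolP (w \in _).
  by have := cos_geN1 (u * Y w); have := sqr_ge0 eta; rewrite mulr1; lra.
rewrite notin_setE /dev_event/= => /negP; rewrite -leNgt -/(Y w) => Yeta.
rewrite mulr0 addr0 (le_trans (one_sub_cos_le _))// exprMn.
have Y2 : Y w ^+ 2 <= eta ^+ 2.
  by rewrite -[leLHS]real_normK ?num_real// lerXn2r ?nnegrE// ltW.
have u2 : u ^+ 2 * Y w ^+ 2 <= Y w ^+ 2 by rewrite ler_piMl ?sqr_ge0// expr_le1.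
have := sqr_ge0 (Y w); lra.
Qed.

Lemma cond_i_gap (D : nat -> Omega -> R) : Tmeas_seq g D -> cond_i P g D ->
  cvg0_in_prob P \oo (gap kappa).
Proof.
move=> tD cD; apply/cvg0_in_probP => eta e eta0 e0.
(* As [s <= 1], [s ^ 2 <= s <= eta * e / 4]; with twice a deviation probability of at most
   [eta * e / 4] the mean gap is below [eta * e], as Markov at level [eta] requires. *)
pose s := Num.min 1 (eta * e / 4).
have ee : 0 < eta * e by rewrite mulr_gt0.
have s0 : 0 < s by rewrite lt_min ltr01 divr_gt0.
have s1 : s <= 1 by rewrite ge_min lexx.
have s2 : s <= eta * e / 4 by rewrite ge_min lexx orbT.
have := (@cvge0P R nat \oo _ _ (fun N => measure_ge0 P (dev_event g D s N))).1 (cD s s0)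
  (eta * e / 4) (divr_gt0 ee (ltr0Sn _ 3)) => hD.
near=> N.
have N0 : (0 < N)%N by near: N; exact: nbhs_infty_gt.
have bg := bdm_gap mg rcd N.
have g0 w : 0 <= gap kappa N w by have [_ /andP[]] := gapE mg rcd N w.
apply: (@le_trans _ _ (P [set w | (eta <= gap kappa N w)%R])).
  apply: le_measure; rewrite ?inE.
  - by apply: measurable_norm_ltr; case: bg.
  - by apply: measurable_ler => //; case: bg.
  - by move=> w /=; rewrite ger0_norm// => /ltW.
rewrite (le_trans (markov P bg g0 eta0))// lee_fin ler_pdivrMl//.
rewrite -lee_fin (le_trans (exp_gap_dev N0 s0 tD))//.
apply: (@le_trans _ _ ((eta * e / 4)%:E + 2%:E * (eta * e / 4)%:E)%E).
  apply: leeD; last by apply: lee_wpmul2l; [rewrite lee_fin | near: N; exact: hD].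
  by rewrite lee_fin (le_trans _ s2)// expr2 ler_piMl// ltW.
rewrite -EFinM -EFinD lee_fin; lra.
Unshelve. all: by end_near.
Qed.

Lemma gap_Rq : cvg0_in_prob P \oo (gap kappa) ->
  cvg0_in_prob P \oo (fun N w => Rq kappa 1 N%:R w).
Proof.
apply: (@cvg0_in_prob_mass _ _ _ P g mg exg kappa rcd nat \oo _ _ _ 160 64^-1
  (fun b N => 64 * b ^+ 2 / N%:R)) => //.
- by apply: nearW => N; case: (bdm_tail_sub mg (bdm_Rq rcd 1 N%:R)).
- by apply: nearW => N; case: (bdm_gap mg rcd N).
- move=> b b0; near=> N => w hb.
  have N0 : (0 < N)%N by near: N; exact: nbhs_infty_gt.
  have [_ /andP[g0 _]] := gapE mg rcd N w.
  rewrite !ger0_norm// ?Rq_ge0//; exact: (Rq_le_gap mg rcd).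
- move=> b e b0 e0; near=> N.
  have N0 : (0 < N)%N by near: N; exact: nbhs_infty_gt.
  rewrite ler_pdivrMr ?ltr0n// -ler_pdivrMl//.
  by near: N; exact: nbhs_infty_ger.
Unshelve. all: by end_near.
Qed.

End WeakLaw.

(** * Conditional probabilities given a sub-sigma-algebra *)

Section ConditionalProbability.
Context d (Omega : measurableType d) (R : realType) (P : probability Omega R).
Context (G : set (set Omega)).
Hypotheses (sG : sigma_algebra setT G) (hG : G `<=` measurable).
Local Notation T := (g_sigma_algebraType G).

Section TraceMeasure.
Context (A : set Omega).
Hypothesis mA : measurable A.

(** Its density with respect to [P] on the coarse space is a version of the conditional probability
    of [A]. *)
Definition trace_measure (C : set T) : \bar R := P (C `&` A).

Let sub (C : set T) : measurable C -> measurable (C : set Omega).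
Proof. exact: (sigma_sub_measurable hG). Qed.

Let trace_measure0 : trace_measure set0 = 0%E.
Proof. by rewrite /trace_measure set0I measure0. Qed.

Let trace_measure_ge0 C : (0 <= trace_measure C)%E.
Proof. exact: measure_ge0. Qed.

Let trace_measure_sigma_additive : semi_sigma_additive trace_measure.
Proof.
move=> F mF tF mUF.
by apply: (@measure_semi_sigma_additive _ _ _ (mrestr P mA) F _ tF) => [i|]; exact: sub.
Qed.

HB.instance Definition _ := isMeasure.Build _ _ _ trace_measure
  trace_measure0 trace_measure_ge0 trace_measure_sigma_additive.

Let trace_measure_fin : fin_num_fun trace_measure.
Proof.
by move=> C mC; rewrite fin_num_measure//; apply: measurableI => //; exact: sub.
Qed.

HB.instance Definition _ := Measure_isFinite.Build _ _ _ trace_measure trace_measure_fin.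

Lemma trace_measure_density : exists Y : Omega -> R,
  [/\ measurable_fun setT (Y : T -> R), forall w, 0 <= Y w &
   forall C, <<s G >> C -> (\int[P]_(w in C) (Y w)%:E)%E = P (C `&` A)].
Proof.
have mid : measurable_fun setT (id : Omega -> T).
  by move=> _ B mB; rewrite setTI preimage_id; exact: (sigma_sub_measurable hG).
(* The restriction of [P] to [<<s G >>], as the image of [P] under the identity into the coarse
   space. *)
pose m : probability T R := distribution P (mfun_of mid).
have dom : trace_measure `<< m.
  move=> C nC B mB BC; rewrite /trace_measure.
  have PB : P B = 0%E by exact: (nC B mB BC).
  apply/eqP; rewrite -measure_le0 -PB; apply: le_measure; rewrite ?inE//.
    by apply: measurableI => //; exact: sub.
  exact: sub.
have [f [f0 ffin intf fE]] := radon_nikodym_sigma_finite dom.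
pose Y w := fine (f w).
have YE : EFin \o Y = f by apply/funext => w /=; rewrite fineK.
have mf : measurable_fun setT f by exact: measurable_int intf.
exists Y; split; [exact: measurableT_comp mf|by move=> w; exact: fine_ge0|].
move=> C mC; rewrite -[RHS]/(trace_measure C) fE// [RHS]integral_mkcond.
have mC' : measurable (C : set T) by [].
have mfC : measurable_fun [set: T] (f \_ (C : set T)).
  by apply: (measurable_restrictT f mC').1; exact: measurable_funTS.
rewrite ge0_integral_distribution//=; last first.
  by move=> w; rewrite patchE; case: ifP.
by rewrite integral_mkcond -YE.
Qed.

End TraceMeasure.

Lemma cond_prob_exists (A : set Omega) : measurable A ->
  exists Y : Omega -> R, is_cond_prob P G A Y.
Proof.
move=> mA; have [Y [mY Y0 YA]] := trace_measure_density mA.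
have mYO : measurable_fun setT Y by exact: measurable_fun_sub hG mY.
exists Y; split; [exact/meas_wrtP|split].
- apply/integrableP; split; first exact/measurable_EFinP.
  have -> : (\int[P]_w `|(EFin \o Y) w| = \int[P]_(w in setT) (Y w)%:E)%E.
    by apply: eq_integral => w _; rewrite gee0_abs// lee_fin.
  rewrite YA; last exact: (@measurableT _ T).
  by rewrite setTI (le_lt_trans (probability_le1 _ _))// ltry.
- by move=> C GC; apply: YA; exact: sub_sigma_algebra.
Qed.

(** Markov over the event [eta < Y], which lies in [G]. An arbitrary version may be negative, but
    the integral of [- Y] over [eta < - Y] is [- P (C2 \cap A) <= 0], which makes that event
    null. *)
Lemma cond_prob_tail_le (A : set Omega) (Y : Omega -> R) (eta : R) : 0 < eta ->
  measurable A -> is_cond_prob P G A Y ->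
  (P [set w | (eta < `|Y w|)%R] <= eta^-1%:E * P A)%E.
Proof.
move=> eta0 mA [mY [iY YA]].
pose C1 := [set w | eta < Y w]; pose C2 := [set w | eta < - Y w].
have mYT : measurable_fun setT (Y : T -> R) by exact/meas_wrtP.
have GC1 : G C1.
  rewrite -(measurable_g_measurableTypeE sG).
  by apply: (@measurable_ltr _ T _ (cst eta)).
have GC2 : G C2.
  rewrite -(measurable_g_measurableTypeE sG).
  by apply: (@measurable_ltr _ T _ (cst eta)) => //; exact: measurableT_comp.
have mC1 := hG GC1; have mC2 := hG GC2.
have cst_le C : measurable C -> (forall w, C w -> eta <= Y w) ->
    (eta%:E * P C <= \int[P]_(w in C) (Y w)%:E)%E.
  move=> mC h; rewrite -integral_cst//; apply: ge0_le_integral => //.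
  - by move=> w _; rewrite lee_fin ltW.
  - apply: measurable_funTS; apply/measurable_EFinP; exact: measurable_fun_sub hG mYT.
have P1 : (eta%:E * P C1 <= P A)%E.
  rewrite (le_trans (cst_le C1 mC1 _))//; first by move=> w /ltW.
  by rewrite YA//; apply: le_measure; rewrite ?inE//; exact: measurableI.
have P2 : P C2 = 0%E.
  apply/eqP; rewrite -measure_le0.
  have : (eta%:E * P C2 <= \int[P]_(w in C2) (- Y w)%:E)%E.
    rewrite -integral_cst//; apply: ge0_le_integral => //.
    - by move=> w _; rewrite lee_fin ltW.
    - apply: measurable_funTS; apply/measurable_EFinP; apply: measurableT_comp => //.
      exact: measurable_fun_sub hG mYT.
    - by move=> w /ltW; rewrite lee_fin.
  have -> : (\int[P]_(w in C2) (- Y w)%:E = - P (C2 `&` A))%E.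
    have iYC : P.-integrable C2 (EFin \o Y) := integrableS measurableT mC2 (@subsetT _ _) iY.
    under eq_integral do rewrite EFinN.
    by rewrite (integralN (integrable_add_def mC2 iYC)) -YA.
  move=> h; have : (eta%:E * P C2 <= 0)%E by rewrite (le_trans h)// oppe_le0.
  by rewrite pmule_rle0// lte_fin.
have sub : [set w | eta < `|Y w|] `<=` C1 `|` C2.
  by move=> w /=; rewrite /C1 /C2 /= lter_normr => /orP.
apply: (@le_trans _ _ (P (C1 `|` C2))).
  apply: le_measure; rewrite ?inE//; last exact: measurableU.
  by apply: measurable_norm_ltr; exact: measurable_fun_sub hG mYT.
have P2' : (P C2 <= 0)%E by rewrite P2.
apply: (le_trans (measureU2 _ _ _)) => //; apply: (le_trans (leeD (lexx _) P2')).
by rewrite adde0 lee_pdivlMl.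
Qed.

(** The event [|Y| <= eta] lies in [G], so its intersection with [A] has probability equal to the
    integral of [Y] over it, hence at most [eta]. *)
Lemma cond_prob_le_tail (A : set Omega) (Y : Omega -> R) (eta : R) : 0 < eta ->
  measurable A -> is_cond_prob P G A Y ->
  (P A <= P [set w | (eta < `|Y w|)%R] + eta%:E)%E.
Proof.
move=> eta0 mA [mY [iY YA]].
have mYT : measurable_fun setT (Y : T -> R) by exact/meas_wrtP.
have mYO : measurable_fun setT Y by exact: measurable_fun_sub hG mYT.
pose C := [set w | `|Y w| <= eta].
have GC : G C.
  rewrite -(measurable_g_measurableTypeE sG).
  by apply: (@measurable_ler _ T) => //; exact: measurableT_comp.
have mC := hG GC.
have mB : measurable [set w | eta < `|Y w|] by exact: measurable_norm_ltr.
have PC : (P (C `&` A) <= eta%:E)%E.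
  rewrite -YA//; apply: (@le_trans _ _ (\int[P]_(w in C) eta%:E)%E).
    apply: le_integral => //.
    - exact: (integrableS measurableT mC _ iY).
    - by apply: finite_measure_integrable_cst.
    - by move=> w; rewrite inE /C/= => h; rewrite lee_fin (le_trans (ler_norm _)).
  rewrite integral_cst// -[leRHS]mule1; apply: lee_wpmul2l; first by rewrite lee_fin ltW.
  exact: probability_le1.
apply: (@le_trans _ _ (P ([set w | (eta < `|Y w|)%R] `|` (C `&` A)))).
  apply: le_measure; rewrite ?inE//; first by apply: measurableU => //; exact: measurableI.
  move=> w Aw; have [h|h] := ltP eta `|Y w|; first by left.
  by right; split.
rewrite (le_trans (measureU2 _ _ _))//; first exact: measurableI.
exact: leeD.
Qed.

End ConditionalProbability.

(** * Equivalences *)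

Section Equivalences.
Context d (Omega : measurableType d) (R : realType) (P : probability Omega R).
Context (g : nat -> Omega -> R).
Hypotheses (mg : forall n, measurable_fun setT (g n)) (exg : exchangeable P g).
Context (kappa : Omega -> probability R R).
Hypothesis rcd : is_rcd P (tail_sigma g) (g 0%N) kappa.

Local Notation cvgT X := (cvg0_in_prob P (+oo%R : set_system R) X).

Let mT eps t : measurable_fun setT (Tq kappa eps t).
Proof. by case: (bdm_tail_sub mg (bdm_Tq rcd eps t)). Qed.
Let mS eps t : measurable_fun setT (Sigmaq kappa eps t).
Proof. by case: (bdm_tail_sub mg (bdm_Sigmaq rcd eps t)). Qed.
Let mV eps t : measurable_fun setT (Vq kappa eps t).
Proof. by case: (bdm_tail_sub mg (bdm_Vq rcd eps t)). Qed.
Let mR eps t : measurable_fun setT (Rq kappa eps t).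
Proof. by case: (bdm_tail_sub mg (bdm_Rq rcd eps t)). Qed.

Lemma cvg_Rq_Tq eps : 0 < eps -> cvgT (Rq kappa eps) -> cvgT (Tq kappa eps).
Proof.
move=> e0; apply: (@cvg0_in_prob_le _ _ _ P g mg exg kappa rcd _ _ _ _ _ (eps ^+ 2)^-1) => //.
- by rewrite invr_gt0 exprn_gt0.
- exact: nearW.
- exact: nearW.
- near=> t => w; have t0 : 0 < t by near: t; exact: nbhs_pinfty_gt.
  have t0' := ltW t0.
  rewrite !ger0_norm ?Rq_ge0 ?Tq_ge0// ler_pdivlMl ?exprn_gt0//.
  by rewrite RqE// lerDr Sigmaq_ge0.
Unshelve. all: by end_near.
Qed.

Lemma cvg_Rq_Sigmaq eps : 0 < eps -> cvgT (Rq kappa eps) -> cvgT (Sigmaq kappa eps).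
Proof.
move=> e0; apply: (@cvg0_in_prob_le _ _ _ P g mg exg kappa rcd _ _ _ _ _ 1) => //.
- exact: nearW.
- exact: nearW.
- near=> t => w; have t0 : 0 < t by near: t; exact: nbhs_pinfty_gt.
  have t0' := ltW t0.
  rewrite !ger0_norm ?Rq_ge0 ?Sigmaq_ge0// mul1r.
  by rewrite RqE// lerDl mulr_ge0 ?sqr_ge0// Tq_ge0.
Unshelve. all: by end_near.
Qed.

Lemma cvg_Tq_Sigmaq_Rq eps : 0 < eps -> cvgT (Tq kappa eps) ->
  cvgT (Sigmaq kappa eps) -> cvgT (Rq kappa eps).
Proof.
move=> e0 /cvg0_in_probP cT /cvg0_in_probP cS; apply/cvg0_in_probP => eta e eta0 e00.
have e20 : 0 < e / 2 by rewrite divr_gt0.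
have h1 : 0 < eta / 2 / eps ^+ 2 by rewrite divr_gt0 ?exprn_gt0// divr_gt0.
near=> t; have t0 : 0 < t by near: t; exact: nbhs_pinfty_gt.
  have t0' := ltW t0.
rewrite (splitr e).
apply: (@prob_setU_le _ _ _ _ [set w | eta / 2 < `|Sigmaq kappa eps t w|]
  [set w | eta / 2 / eps ^+ 2 < `|Tq kappa eps t w|]).
- exact: measurable_norm_ltr.
- exact: measurable_norm_ltr.
- exact: measurable_norm_ltr.
- move=> w /=; rewrite !ger0_norm ?Rq_ge0 ?Tq_ge0 ?Sigmaq_ge0// RqE// => h.
  have [?|h2] := ltP (eta / 2) (Sigmaq kappa eps t w); [by left|right].
  rewrite ltr_pdivrMr ?exprn_gt0// mulrC; lra.
- by near: t; apply: cS => //; rewrite divr_gt0.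
- by near: t; exact: cT.
Unshelve. all: by end_near.
Qed.

Lemma cvg_Rq_Vq eps : 0 < eps -> cvgT (Sigmaq kappa eps) -> cvgT (Vq kappa eps).
Proof.
move=> e0; apply: (@cvg0_in_prob_le _ _ _ P g mg exg kappa rcd _ _ _ _ _ 1) => //.
- exact: nearW.
- exact: nearW.
- near=> t => w; have t0 : 0 < t by near: t; exact: nbhs_pinfty_gt.
  have t0' := ltW t0.
  by rewrite !ger0_norm ?Vq_ge0 ?Sigmaq_ge0// mul1r Vq_le.
Unshelve. all: by end_near.
Qed.

Let inv_small (c e : R) : 0 <= c -> 0 < e -> \forall t \near +oo%R, c / t <= e.
Proof.
move=> c0 e0.
have h : \forall t \near +oo%R, c / e <= t by apply: nbhs_pinfty_ge; exact: num_real.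
have h0 : \forall t \near +oo%R, (0 : R) < t by exact: nbhs_pinfty_gt.
apply: filterS2 h h0 => t ct t0.
by rewrite ler_pdivrMr// mulrC -ler_pdivrMr.
Qed.

Lemma cvg_Vq_Sigmaq eps : 0 < eps -> cvgT (Vq kappa eps) -> cvgT (Sigmaq kappa eps).
Proof.
move=> e0; apply: (@cvg0_in_prob_mass _ _ _ P g mg exg kappa rcd R _ _ _ _ 5 1
  (fun b t => 4 * b ^+ 2 / t)) => //.
- exact: nearW.
- exact: nearW.
- move=> b b0; near=> t => w hb _; have t0 : 0 < t by near: t; exact: nbhs_pinfty_gt.
  have t0' := ltW t0.
  rewrite !ger0_norm ?Vq_ge0 ?Sigmaq_ge0//.
  exact: Sigmaq_le_Vq.
- by move=> b e b0; apply: inv_small; apply: mulr_ge0 => //; exact: sqr_ge0.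
Unshelve. all: by end_near.
Qed.

Lemma cvg_Rq_scale eps : 0 < eps -> cvgT (Rq kappa 1) -> cvgT (Rq kappa eps).
Proof.
move=> e0; apply: (@cvg0_in_prob_le _ _ _ P g mg exg kappa rcd _ _ _ _ _ (1 + eps ^+ 2)) => //.
- by rewrite addr_gt0// exprn_gt0.
- exact: nearW.
- exact: nearW.
- near=> t => w; have t0 : 0 < t by near: t; exact: nbhs_pinfty_gt.
  have t0' := ltW t0.
  by rewrite !ger0_norm ?Rq_ge0// Rq_scale.
Unshelve. all: by end_near.
Qed.

Lemma cvg_Rq_nat : cvgT (Rq kappa 1) -> cvg0_in_prob P \oo (fun N w => Rq kappa 1 N%:R w).
Proof.
move=> h eta eta0; have := h eta eta0 => {}h.
exact: (cvg_comp _ _ (@cvgr_idn R) h).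
Qed.

(** For [t >= 1] the next integer lies between [t] and [2 t], so [Rq_dilate] applies and costs a
    factor [2], whence the level [eta / 2]. *)
Lemma cvg_nat_Rq : cvg0_in_prob P \oo (fun N w => Rq kappa 1 N%:R w) -> cvgT (Rq kappa 1).
Proof.
move=> /cvg0_in_probP h; apply/cvg0_in_probP => eta e eta0 e0.
have [N0 _ hN] := h (eta / 2) e (divr_gt0 eta0 (ltr0Sn _ 1)) e0.
near=> t.
have t1 : 1 <= t by near: t; exact: nbhs_pinfty_ge.
have tN : N0%:R <= t by near: t; exact: nbhs_pinfty_ge.
have t0 : 0 < t by exact: lt_le_trans t1.
have := truncn_itv (ltW t0); set n := Num.truncn t => /andP[nt tn].
have Nn : (N0 <= n.+1)%N.
  by rewrite -(ler_nat R) (le_trans tN)// ltW.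
apply: le_trans (hN n.+1 Nn).
apply: le_measure; rewrite ?inE; [exact: measurable_norm_ltr|exact: measurable_norm_ltr|].
move=> w /=; rewrite !ger0_norm ?Rq_ge0// => hw.
have n2 : n.+1%:R <= 2 * t by rewrite -natr1; lra.
have := Rq_dilate kappa w t0 (ltW tn) n2; lra.
Unshelve. all: by end_near.
Qed.

Lemma cvg_avgT_Rq eps : 0 < eps -> cvgT (avgT kappa eps) <-> cvgT (Rq kappa eps).
Proof.
move=> e0; have c0 : 0 < (2 * eps ^+ 2)^-1 by rewrite invr_gt0 mulr_gt0// exprn_gt0.
have mA : \forall M \near +oo%R, measurable_fun setT (avgT kappa eps M).
  near=> M; have M0 : 0 < M by near: M; exact: nbhs_pinfty_gt.
  rewrite (_ : avgT kappa eps M = fun w => (2 * eps ^+ 2)^-1 * Rq kappa eps M w).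
    exact: measurable_funM.
  by apply/funext => w; rewrite avgTE.
split.
- apply: (@cvg0_in_prob_le _ _ _ P g mg exg kappa rcd _ _ _ _ _ (2 * eps ^+ 2)) => //.
  + by rewrite -invr_gt0.
  + exact: nearW.
  + near=> M => w; have M0 : 0 < M by near: M; exact: nbhs_pinfty_gt.
    by rewrite avgTE// [X in _ <= _ * X]normrM (gtr0_norm c0) mulrA divff ?mul1r// gt_eqF// -invr_gt0.
- apply: (@cvg0_in_prob_le _ _ _ P g mg exg kappa rcd _ _ _ _ _ (2 * eps ^+ 2)^-1) => //.
  + exact: nearW.
  + near=> M => w; have M0 : 0 < M by near: M; exact: nbhs_pinfty_gt.
    by rewrite avgTE// normrM (gtr0_norm c0).
Unshelve. all: by end_near.
Qed.

Let mtS eps : 0 < eps -> \forall M \near +oo%R, measurable_fun setT (tailSigma kappa eps M).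
Proof.
move=> e0; near=> M; have M0 : 0 < M by near: M; exact: nbhs_pinfty_gt.
rewrite (_ : tailSigma kappa eps M = fun w => 2^-1 * Rq kappa eps M w).
  exact: measurable_funM.
by apply/funext => w; rewrite tailSigmaE.
Unshelve. all: by end_near.
Qed.

Lemma cvg_tailSigma_Rq eps : 0 < eps -> cvgT (tailSigma kappa eps) <-> cvgT (Rq kappa eps).
Proof.
move=> e0; split.
- apply: (@cvg0_in_prob_le _ _ _ P g mg exg kappa rcd _ _ _ _ _ 2) => //.
  + exact: nearW.
  + exact: mtS.
  + near=> M => w; have M0 : 0 < M by near: M; exact: nbhs_pinfty_gt.
    by rewrite tailSigmaE// [X in _ <= _ * X]normrM (@gtr0_norm _ 2^-1) ?invr_gt0//; lra.
- apply: (@cvg0_in_prob_le _ _ _ P g mg exg kappa rcd _ _ _ _ _ 2^-1) => //.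
  + exact: mtS.
  + exact: nearW.
  + near=> M => w; have M0 : 0 < M by near: M; exact: nbhs_pinfty_gt.
    by rewrite tailSigmaE// normrM gtr0_norm ?invr_gt0.
Unshelve. all: by end_near.
Qed.

Lemma cvg_tailV_tailSigma eps : 0 < eps ->
  cvgT (tailV kappa eps) <-> cvgT (tailSigma kappa eps).
Proof.
move=> e0.
have mtV : \forall M \near +oo%R, measurable_fun setT (tailV kappa eps M).
  near=> M; have M0 : 0 < M by near: M; exact: nbhs_pinfty_gt.
  exact: (measurable_tailV mg rcd).
split.
- apply: (@cvg0_in_prob_mass _ _ _ P g mg exg kappa rcd R _ _ _ _ 5 1
    (fun b M => 2 * b ^+ 2 / M)) => //.
  + exact: mtS.
  + move=> b b0; near=> M => w hb _; have M0 : 0 < M by near: M; exact: nbhs_pinfty_gt.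
    have [V0 VS h] := tailV_bounds mg rcd w e0 M0.
    by rewrite !ger0_norm// ?(le_trans V0)//; exact: h.
  + by move=> b e b0; apply: inv_small; apply: mulr_ge0 => //; exact: sqr_ge0.
- apply: (@cvg0_in_prob_le _ _ _ P g mg exg kappa rcd _ _ _ _ _ 1) => //.
  + exact: mtS.
  + near=> M => w; have M0 : 0 < M by near: M; exact: nbhs_pinfty_gt.
    have [V0 VS _] := tailV_bounds mg rcd w e0 M0.
    by rewrite mul1r !ger0_norm// (le_trans V0).
Unshelve. all: by end_near.
Qed.

End Equivalences.

(** * Conditional form of the weak law and growth of correctors *)

Section Correctors.
Context d (Omega : measurableType d) (R : realType) (P : probability Omega R).
Context (g : nat -> Omega -> R).
Hypotheses (mg : forall n, measurable_fun setT (g n)) (exg : exchangeable P g).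
Context (kappa : Omega -> probability R R).
Hypothesis rcd : is_rcd P (tail_sigma g) (g 0%N) kappa.

Lemma cond_iP (D : nat -> Omega -> R) : cond_i P g D <->
  forall eps e : R, 0 < eps -> 0 < e ->
    \forall N \near \oo, (P (dev_event g D eps N) <= e%:E)%E.
Proof.
split=> [h eps e eps0 e0|h eps eps0].
  by apply/cvge0P : e e0; [|exact: h].
by apply/cvge0P => // e e0; exact: h.
Qed.

(** Conditional probabilities have the deviation probabilities as means, and for such bounded
    quantities convergence in mean and in probability agree. One implication needs chosen versions;
    the other accepts any. *)
Lemma cond_i_cond_i' (D : nat -> Omega -> R) : Tmeas_seq g D ->
  cond_i P g D <-> cond_i' P g D.
Proof.
move=> tD; have sG := sigma_algebra_tail g; have hG := tail_measurable mg.
have mdev eps N : measurable (dev_event g D eps N).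
  by apply: (measurable_dev_event mg); exact: (measurable_Tmeas_sub mg).
split.
- move=> /cond_iP cD eps eps0.
  have [Y hY] := choice (fun N => cond_prob_exists P sG hG (mdev eps N)).
  exists Y; split => //; apply/cvg0_in_probP => eta e eta0 e0.
  have ee : 0 < eta * e by rewrite mulr_gt0.
  near=> N.
  rewrite (le_trans (cond_prob_tail_le sG hG eta0 (mdev eps N) (hY N)))//.
  by rewrite lee_pdivrMl// -EFinM; near: N; exact: cD.
- move=> cD; apply/cond_iP => eps e eps0 e0.
  have [Y [hY /cvg0_in_probP cY]] := cD eps eps0.
  have e20 : 0 < e / 2 by rewrite divr_gt0.
  near=> N.
  rewrite (le_trans (cond_prob_le_tail sG hG e20 (mdev eps N) (hY N)))//.
  rewrite [in leRHS](splitr e) EFinD; apply: leeD => //.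
  by near: N; exact: cY.
Unshelve. all: by end_near.
Qed.

(** The squared mean of the truncation is at most its second moment, so
    [Delta ^ 2 / N <= Sigmaq <= Rq]. *)
Lemma Delta_sqr_le (N : nat) w : (0 < N)%N ->
  (DeltaN kappa N w / Num.sqrt N%:R) ^+ 2 <= Rq kappa 1 N%:R w.
Proof.
move=> N0; have NR : 0 < N%:R :> R by rewrite ltr0n.
rewrite expr_div_n sqr_sqrtr; last exact: ltW.
apply: (@le_trans _ _ (Sigmaq kappa 1 N%:R w)).
  rewrite /Sigmaq mul1r mulrC ler_pM2l ?invr_gt0//.
  exact: exp_sqr_le (bdm_trunc _).
by rewrite RqE// lerDl mulr_ge0 ?sqr_ge0 ?Tq_ge0// ltW.
Qed.

(** [D N] and [DeltaN N] are both close to the same average, so their difference is small even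
    before division by [sqrt N >= 1], while [DeltaN N / sqrt N] is at most the square root of
    [Rq]. *)
Lemma corrector_sqrt (D : nat -> Omega -> R) : Tmeas_seq g D ->
  cond_i P g D -> cond_i P g (DeltaN kappa) ->
  cvg0_in_prob P \oo (fun N w => Rq kappa 1 N%:R w) ->
  cvg0_in_prob P \oo (fun N w => D N w / Num.sqrt N%:R).
Proof.
move=> tD /cond_iP cD /cond_iP cDelta /cvg0_in_probP cR.
apply/cvg0_in_probP => eta e eta0 e0.
have eta4 : 0 < eta / 4 by rewrite divr_gt0.
have e4 : 0 < e / 4 by rewrite divr_gt0.
have eta2 : 0 < (eta / 2) ^+ 2 by rewrite exprn_gt0// divr_gt0.
near=> N.
have N0 : (0 < N)%N by near: N; exact: nbhs_infty_gt.
have NR : 0 < N%:R :> R by rewrite ltr0n.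
have s0 : 0 < Num.sqrt N%:R :> R by rewrite sqrtr_gt0.
have s1 : 1 <= Num.sqrt N%:R :> R by rewrite -[leLHS]sqrtr1 ler_wsqrtr// ler1n.
have mD := measurable_Tmeas_sub mg N tD.
have mDev E : Tmeas_seq g E -> measurable (dev_event g E (eta / 4) N).
  by move=> tE; apply: (measurable_dev_event mg); exact: (measurable_Tmeas_sub mg).
have mR : measurable [set w | (eta / 2) ^+ 2 < `|Rq kappa 1 N%:R w|].
  by apply: measurable_norm_ltr; case: (bdm_tail_sub mg (bdm_Rq rcd 1 N%:R)).
have tDelta : Tmeas_seq g (DeltaN kappa) by exact: (Tmeas_DeltaN rcd).
have -> : e = e / 4 + (e / 4 + e / 2) by field.
apply: (@prob_setU_le _ _ _ _ (dev_event g D (eta / 4) N)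
  (dev_event g (DeltaN kappa) (eta / 4) N `|` [set w | (eta / 2) ^+ 2 < `|Rq kappa 1 N%:R w|])).
- exact: mDev.
- by apply: measurableU => //; exact: mDev.
- by apply: measurable_norm_ltr; exact: measurable_funM.
- move=> w /= hD; have [h1|h1] := pselect (dev_event g D (eta / 4) N w); first by left.
  right; have [h2|h2] := pselect (dev_event g (DeltaN kappa) (eta / 4) N w); first by left.
  right; rewrite ltNge; apply/negP => h3.
  move: h1 h2; rewrite /dev_event/= => /negP; rewrite -leNgt => h1 /negP; rewrite -leNgt => h2.
  have d1 : `|D N w - DeltaN kappa N w| <= eta / 2.
    have := ler_distD (N%:R^-1 * (\sum_(i < N) g i w)) (D N w) (DeltaN kappa N w).
    rewrite [X in _ <= X + _]distrC; lra.
  have d2 : `|DeltaN kappa N w / Num.sqrt N%:R| <= eta / 2.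
    have eta20 : 0 <= eta / 2 by rewrite divr_ge0// ltW.
    rewrite -ler_sqr ?nnegrE// real_normK ?num_real//.
    by rewrite (le_trans (Delta_sqr_le w N0))// (le_trans (ler_norm _)).
  have d3 : `|(D N w - DeltaN kappa N w) / Num.sqrt N%:R| <= eta / 2.
    rewrite normrM normfV (gtr0_norm s0) ler_pdivrMr// (le_trans d1)// ler_peMr//.
    by rewrite divr_ge0// ltW.
  have := ler_normD ((D N w - DeltaN kappa N w) / Num.sqrt N%:R) (DeltaN kappa N w / Num.sqrt N%:R).
  rewrite -mulrDl subrK; lra.
- by near: N; exact: cD.
- apply: (@prob_setU_le _ _ _ _ (dev_event g (DeltaN kappa) (eta / 4) N)
    [set w | (eta / 2) ^+ 2 < `|Rq kappa 1 N%:R w|]) => //.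
  + exact: mDev.
  + by apply: measurableU => //; exact: mDev.
  + by near: N; exact: cDelta.
  + by near: N; apply: cR => //; rewrite divr_gt0.
Unshelve. all: by end_near.
Qed.

End Correctors.

Theorem theorem4p2 (d : measure_display) (Omega : measurableType d)
  (R : realType) (P : probability Omega R) (g : nat -> Omega -> R)
  (kappa : Omega -> probability R R) :
  (forall n, measurable_fun setT (g n)) ->
  exchangeable P g ->
  is_rcd P (tail_sigma g) (g 0%N) kappa ->
  let ii := forall eps : R, 0 < eps ->
      cvg0_in_prob P (+oo%R : set_system R) (Tq kappa eps) /\
      cvg0_in_prob P (+oo%R : set_system R) (Sigmaq kappa eps) in
  let ii' := forall eps : R, 0 < eps ->
      cvg0_in_prob P (+oo%R : set_system R) (Tq kappa eps) /\
      cvg0_in_prob P (+oo%R : set_system R) (Vq kappa eps) in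
  let ii'' := forall eps : R, 0 < eps ->
      cvg0_in_prob P (+oo%R : set_system R) (Rq kappa eps) in
  let iii := forall eps : R, 0 < eps ->
      cvg0_in_prob P (+oo%R : set_system R) (avgT kappa eps) in
  let iii' := forall eps : R, 0 < eps ->
      cvg0_in_prob P (+oo%R : set_system R) (tailSigma kappa eps) in
  let iii'' := forall eps : R, 0 < eps ->
      cvg0_in_prob P (+oo%R : set_system R) (tailV kappa eps) in
  let DeltaN := fun (N : nat) (w : Omega) => Delta kappa N%:R w in
  ((exists D, Tmeas_seq g D /\ cond_i P g D) <-> ii) /\
  ((exists D, Tmeas_seq g D /\ cond_i' P g D) <-> ii) /\
  (ii' <-> ii) /\ (ii'' <-> ii) /\ (iii <-> ii) /\ (iii' <-> ii) /\
  (iii'' <-> ii) /\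
  (ii -> cond_i P g DeltaN /\ cond_i' P g DeltaN) /\
  (forall D, Tmeas_seq g D -> cond_i P g D \/ cond_i' P g D ->
        cvg0_in_prob P \oo (fun N w => D N w / Num.sqrt N%:R)).
Proof.
move=> mg exg rcd ii ii' ii'' iii iii' iii'' DeltaN.
have ii''_ii : ii'' <-> ii.
  split=> h eps eps0; first by split; [apply: cvg_Rq_Tq|apply: cvg_Rq_Sigmaq]; eauto.
  by have [hT hS] := h eps eps0; exact: (cvg_Tq_Sigmaq_Rq mg rcd).
(* The deviation arguments produce and consume [Rq] at scale [1] along the integers only; here this
   form is linked to all scales and real times. *)
have Rq_ii : cvg0_in_prob P \oo (fun N w => Rq kappa 1 N%:R w) <-> ii.
  rewrite -ii''_ii; split=> [h eps eps0|h].
    by apply: (cvg_Rq_scale mg exg rcd) => //; exact: (cvg_nat_Rq mg rcd).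
  by apply: cvg_Rq_nat; exact: h.
have tDelta : Tmeas_seq g DeltaN by exact: (Tmeas_DeltaN rcd).
have i_R D : Tmeas_seq g D -> cond_i P g D ->
    cvg0_in_prob P \oo (fun N w => Rq kappa 1 N%:R w).
  by move=> tD cD; apply: (gap_Rq mg exg rcd); exact: (cond_i_gap mg exg rcd tD).
have R_i : cvg0_in_prob P \oo (fun N w => Rq kappa 1 N%:R w) -> cond_i P g DeltaN.
  exact: (cond_i_DeltaN mg exg rcd).
have i_i' D : Tmeas_seq g D -> cond_i P g D <-> cond_i' P g D by exact: cond_i_cond_i'.
split; [|split; [|split; [|split; [|split; [|split; [|split; [|split]]]]]]] => //.
- split=> [[D [tD cD]]|/Rq_ii h]; first by apply/Rq_ii; exact: i_R cD.
  by exists DeltaN; split => //; exact: R_i.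
- split=> [[D [tD /(i_i' _ tD) cD]]|/Rq_ii h]; first by apply/Rq_ii; exact: i_R cD.
  by exists DeltaN; split => //; apply/(i_i' _ tDelta); exact: R_i.
- split=> h eps eps0; have [hT hV] := h eps eps0; split => //.
    exact: (cvg_Vq_Sigmaq mg exg rcd).
  exact: (cvg_Rq_Vq mg exg rcd).
- rewrite -ii''_ii; split=> h eps eps0; have := h eps eps0;
    by move/(cvg_avgT_Rq mg exg rcd eps0).
- rewrite -ii''_ii; split=> h eps eps0; have := h eps eps0;
    by move/(cvg_tailSigma_Rq mg exg rcd eps0).
- rewrite -ii''_ii; split=> h eps eps0; have := h eps eps0.
    by move/(cvg_tailV_tailSigma mg exg rcd eps0)/(cvg_tailSigma_Rq mg exg rcd eps0).
  by move/(cvg_tailSigma_Rq mg exg rcd eps0)/(cvg_tailV_tailSigma mg exg rcd eps0).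
- by move=> /Rq_ii h; have cD := R_i h; split => //; apply/(i_i' _ tDelta).
- move=> D tD h; have cD : cond_i P g D by case: h => // /(i_i' _ tD).
  have cR := i_R _ tD cD.
  exact: (corrector_sqrt mg rcd tD cD (R_i cR) cR).
Qed.
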